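(* Let $\mathcal{M}$ be a family of axisymmetric metrics with nonnegative scalar curvature which is uniformly asymptotically flat outside of radius $R_0$. Let $\rho_0>0$ and suppose also that $\mathcal{M}$ is radially monotone at $\rho_0$. For any fixed axisymmetric surface $\Sigma$, constants $\epsilon>0$, $\sigma>0$, and $\rho_1>\max\{\rho_0,R_0\}$, there exists a $\delta>0$ such that if $g\in\mathcal{M}$ and $m(g)<\delta$, then $$\big|\Sigma\cap\tilde{\Omega}^{\rho_1}_{\rho_0}(\sigma)\big|+\epsilon\ \ge\ \mathrm{Area}_g\big(\Sigma\cap\tilde{\Omega}^{\rho_1}_{\rho_0}(\sigma)\big)\ \ge\ \big|\Sigma\cap\tilde{\Omega}^{\rho_1}_{\rho_0}(\sigma)\big|-\epsilon,$$ where $|\cdot|$ denotes Euclidean area in the cylindrical coordinates and $\mathrm{Area}_g$ the area with respect to $g$.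
   Context: Axisymmetric metrics: smooth, asymptotically flat Riemannian metrics $g$ given in global cylindrical coordinates $(\rho,z,\phi)$ on $\mathbb{R}^3$ by $g=e^{2\alpha-2u}(d\rho^2+dz^2)+\rho^2e^{-2u}(d\phi+B\,d\rho+A\,dz)^2$, where $\alpha,u,A,B$ depend only on $(\rho,z)$. The Killing field is $\eta=\partial/\partial\phi$. The ADM mass is $m(g)=\lim_{R\to\infty}\frac{1}{16\pi}\int_{S_R}(g_{ij,j}-g_{jj,i})\nu^i$; as a standing fact, $m(g)=\frac1{16\pi}\int_{\mathbb{R}^3}\Big[e^{-2(u-\alpha)}\big(R_g+\tfrac{\rho^2e^{-4\alpha+2u}}{2}(\partial_zB-\partial_\rho A)^2\big)+2|\nabla u|^2\Big]\rho\,d\rho\,dz\,d\phi$, with $R_g$ the scalar curvature and $|\nabla u|$ Euclidean. Uniformly asymptotically flat outside of radius $R_0$: there is a constant $C$ such that for every $g\in\mathcal{M}$ and all $r=\sqrt{\rho^2+z^2}\ge R_0$, $|\partial^I u|,|\partial^I\alpha|,|\partial^I A|,|\partial^I B|\le C/r^{1+|I|}$ for multi-indices $|I|\le 2$. Radially monotone at $\rho_0$: for each $g\in\mathcal{M}$, $\frac{\partial}{\partial\rho}\Big(\frac1\rho\frac{|\eta|_g}{|\nabla\rho|_g}\Big)\le0$ on $\{\rho=\rho_0\}$; equivalently $\partial_\rho(\alpha-2u)(\rho_0,z)\le 0$ for all $z$. Axisymmetric surface: a surface obtained by rotating (in $\phi$) a $C^1$ curve in the $(\rho,z)$ half-plane;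 it is fixed in coordinates, independently of $g$. Region: $\tilde\Omega^{\rho_1}_{\rho_0}(\sigma)=\{\rho_0+\sigma\le\rho\le\rho_1,\ |z|\le\rho_1/2\}\times[0,2\pi)$. *)

(* Defs.v *)
From HB Require Import structures.
From mathcomp Require Import all_boot all_order all_algebra.
From mathcomp Require Import all_classical all_reals all_analysis.
Import Order.TTheory GRing.Theory Num.Theory.
Import numFieldNormedType.Exports.

Set Implicit Arguments.
Unset Strict Implicit.
Unset Printing Implicit Defensive.

Local Open Scope classical_set_scope.
Local Open Scope ring_scope.

Definition vec2 (R : realType) (a b : R) : 'rV[R]_2 := \row_j [:: a; b]`_j.
Definition vec3 (R : realType) (a b c : R) : 'rV[R]_3 := \row_j [:: a; b; c]`_j.

(* The library norm on 'rV[R]_n is the max norm. *)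
Definition enorm (R : realType) (n : nat) (x : 'rV[R]_n) : R :=
  Num.sqrt (\sum_i x 0 i ^+ 2).

Definition partial (R : realType) (n : nat) (i : 'I_n.+1)
    (f : 'rV[R]_n.+1 -> R) : 'rV[R]_n.+1 -> R :=
  fun x => 'D_(delta_mx 0 i) f x.

(* A multi-index I is a sequence of directions s, with |I| = size s. *)
Definition partials (R : realType) (n : nat) (s : seq 'I_n.+1)
    (f : 'rV[R]_n.+1 -> R) : 'rV[R]_n.+1 -> R :=
  foldr (@partial R n) f s.

Definition smooth (R : realType) (n : nat) (f : 'rV[R]_n.+1 -> R) : Prop :=
  forall (s : seq 'I_n.+1) (x : 'rV[R]_n.+1), differentiable (partials s f) x.

(* A metric in a coordinate chart is its matrix of components G x i j. *)

Definition christoffel (R : realType) (n : nat)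
    (G : 'rV[R]_n.+1 -> 'M[R]_n.+1) (k i j : 'I_n.+1) (x : 'rV[R]_n.+1) : R :=
  2^-1 * \sum_l invmx (G x) k l *
    (partial i (fun y => G y j l) x + partial j (fun y => G y i l) x
     - partial l (fun y => G y i j) x).

Definition ricci (R : realType) (n : nat)
    (G : 'rV[R]_n.+1 -> 'M[R]_n.+1) (i j : 'I_n.+1) (x : 'rV[R]_n.+1) : R :=
  \sum_k (partial k (christoffel G k i j) x - partial j (christoffel G k i k) x)
  + \sum_k \sum_l (christoffel G k k l x * christoffel G l i j x
                   - christoffel G k j l x * christoffel G l i k x).

Definition scalar_curvature (R : realType) (n : nat)
    (G : 'rV[R]_n.+1 -> 'M[R]_n.+1) (x : 'rV[R]_n.+1) : R :=
  \sum_i \sum_j invmx (G x) i j * ricci G i j x.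

Definition vector_norm (R : realType) (n : nat)
    (G : 'rV[R]_n.+1 -> 'M[R]_n.+1) (X : 'rV[R]_n.+1) (x : 'rV[R]_n.+1) : R :=
  Num.sqrt (\sum_i \sum_j G x i j * X 0 i * X 0 j).

Definition gradient_norm (R : realType) (n : nat)
    (G : 'rV[R]_n.+1 -> 'M[R]_n.+1) (f : 'rV[R]_n.+1 -> R)
    (x : 'rV[R]_n.+1) : R :=
  Num.sqrt (\sum_i \sum_j invmx (G x) i j * partial i f x * partial j f x).

Definition pullback (R : realType) (n : nat) (P : 'rV[R]_n.+1 -> 'rV[R]_n.+1)
    (h : 'rV[R]_n.+1 -> 'M[R]_n.+1) (q : 'rV[R]_n.+1) : 'M[R]_n.+1 :=
  let J := \matrix_(a, i) partial a (fun q' => P q' 0 i) q in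
  J *m h (P q) *m J^T.

(* Cylindrical coordinates are listed in the order (rho, z, phi), and points of
   the half-plane in the order (rho, z). *)
Definition cyl_to_cart (R : realType) (q : 'rV[R]_3) : 'rV[R]_3 :=
  vec3 (q 0 0 * cos (q 0 2)) (q 0 0 * sin (q 0 2)) (q 0 1).

Definition half_plane_part (R : realType) (q : 'rV[R]_3) : 'rV[R]_2 :=
  vec2 (q 0 0) (q 0 1).

(* [ax_cart] is the metric on R^3 in Cartesian components; the other fields are
   the functions of (rho, z) describing it in cylindrical coordinates. *)
Record axisym_data (R : realType) := AxisymData {
  ax_cart : 'rV[R]_3 -> 'M[R]_3;
  ax_u : 'rV[R]_2 -> R;
  ax_alpha : 'rV[R]_2 -> R;
  ax_A : 'rV[R]_2 -> R;
  ax_B : 'rV[R]_2 -> R }.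

Definition cyl_metric (R : realType) (g : axisym_data R) (q : 'rV[R]_3)
    : 'M[R]_3 :=
  let p := half_plane_part q in
  let drho : 'rV[R]_3 := vec3 1 0 0 in
  let dz : 'rV[R]_3 := vec3 0 1 0 in
  let omega : 'rV[R]_3 := vec3 (ax_B g p) (ax_A g p) 1 in
  expR (2 * ax_alpha g p - 2 * ax_u g p) *: (drho^T *m drho + dz^T *m dz)
  + (q 0 0 ^+ 2 * expR (- (2 * ax_u g p))) *: (omega^T *m omega).

Definition riemannian (R : realType) (n : nat)
    (h : 'rV[R]_n.+1 -> 'M[R]_n.+1) : Prop :=
  [/\ forall i j, smooth (fun x => h x i j),
      forall x, (h x)^T = h x
    & forall x (v : 'rV[R]_n.+1), v != 0 -> 0 < (v *m h x *m v^T) 0 0].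

(* Asymptotic flatness in the Cartesian coordinates of R^3, at some rate above
   the threshold 1/2 for the ADM mass. *)
Definition asymptotically_flat (R : realType)
    (h : 'rV[R]_3 -> 'M[R]_3) : Prop :=
  exists tau C r0 : R, [/\ 2^-1 < tau, 0 < r0 &
    forall (i j : 'I_3) (s : seq 'I_3) (x : 'rV[R]_3),
      (size s <= 2)%N -> r0 <= enorm x ->
      `|partials s (fun y => h y i j - (i == j)%:R) x|
        <= C / (enorm x `^ (tau + (size s)%:R))].

(* Smoothness of u, alpha, A, B up to the axis is expressed by taking them to be
   (restrictions to rho >= 0 of) smooth functions on the whole plane; their
   values at rho < 0 are never used. *)
Definition axisymmetric_metric (R : realType) (g : axisym_data R) : Prop :=
  [/\ riemannian (ax_cart g),
      [/\ smooth (ax_u g), smooth (ax_alpha g), smooth (ax_A g)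
        & smooth (ax_B g)],
      forall q : 'rV[R]_3, 0 < q 0 0 ->
        pullback (@cyl_to_cart R) (ax_cart g) q = cyl_metric g q
    & asymptotically_flat (ax_cart g)].

(* The scalar curvature is computed in the chart (rho, z, phi), which covers the
   complement of the axis; on the axis the inequality follows by continuity. *)
Definition nonneg_scalar_curvature (R : realType) (g : axisym_data R) : Prop :=
  forall q : 'rV[R]_3, 0 < q 0 0 -> 0 <= scalar_curvature (cyl_metric g) q.

Definition sphere_point (R : realType) (r theta phi : R) : 'rV[R]_3 :=
  vec3 (r * sin theta * cos phi) (r * sin theta * sin phi) (r * cos theta).

Definition adm_integrand (R : realType) (h : 'rV[R]_3 -> 'M[R]_3)
    (x : 'rV[R]_3) : R :=
  \sum_i \sum_j (partial j (fun y => h y i j) x - partial i (fun y => h y j j) x)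
    * (x 0 i / enorm x).

Definition adm_flux (R : realType) (h : 'rV[R]_3 -> 'M[R]_3) (r : R) : R :=
  (16 * pi)^-1 *
  \int[lebesgue_measure]_(theta in `[0, pi])
    \int[lebesgue_measure]_(phi in `[0, 2 * pi])
      (adm_integrand h (sphere_point r theta phi) * (r ^+ 2 * sin theta)).

Definition is_adm_mass (R : realType) (g : axisym_data R) (m : R) : Prop :=
  adm_flux (ax_cart g) r @[r --> +oo] --> m.

Definition uniformly_asymptotically_flat (R : realType)
    (M : set (axisym_data R)) (R0 : R) : Prop :=
  exists C : R, forall (g : axisym_data R), M g ->
    forall (p : 'rV[R]_2) (s : seq 'I_2),
      0 <= p 0 0 -> 0 < enorm p -> R0 <= enorm p -> (size s <= 2)%N ->
      [/\ `|partials s (ax_u g) p| <= C / enorm p ^+ (1 + size s),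
          `|partials s (ax_alpha g) p| <= C / enorm p ^+ (1 + size s),
          `|partials s (ax_A g) p| <= C / enorm p ^+ (1 + size s)
        & `|partials s (ax_B g) p| <= C / enorm p ^+ (1 + size s)].

Definition radially_monotone (R : realType)
    (M : set (axisym_data R)) (rho0 : R) : Prop :=
  let eta : 'rV[R]_3 := vec3 0 0 1 in
  let rho : 'rV[R]_3 -> R := fun q => q 0 0 in
  forall g : axisym_data R, M g -> forall q : 'rV[R]_3, rho q = rho0 ->
    partial 0 (fun q' => (rho q')^-1 *
      (vector_norm (cyl_metric g) eta q'
       / gradient_norm (cyl_metric g) rho q')) q <= 0.

Definition velocity (R : realType) (c : R -> 'rV[R]_2) (k : 'I_2) : R -> R :=
  derive1 (fun s : R => c s 0 k).

(* The generating curve [crv], restricted to the closed interval [dom]. It is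
   regular, and proper so that the rotated surface is closed in R^3; for bounded
   [dom] properness is automatic. *)
Record axisym_surface (R : realType) := AxisymSurface {
  dom : set R;
  crv : R -> 'rV[R]_2;
  dom_interval : is_interval dom;
  dom_closed : closed dom;
  crv_half_plane : forall t, dom t -> 0 <= crv t 0 0;
  crv_derivable : forall t k, derivable (fun s => crv s 0 k) t 1;
  crv_C1 : forall k, continuous (velocity crv k);
  crv_regular : forall t, dom t -> exists k, velocity crv k t != 0;
  crv_proper : forall r : R, bounded_set (dom `&` [set t | enorm (crv t) <= r]) }.

(* The point (crv(t), phi) in cylindrical coordinates, for p = (t, phi). *)
Definition surface_point (R : realType) (S : axisym_surface R) (p : R * R)
    : 'rV[R]_3 :=
  vec3 (crv S p.1 0 0) (crv S p.1 0 1) p.2.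

Definition surface_tangents (R : realType) (S : axisym_surface R) (p : R * R)
    : 'M[R]_(2, 3) :=
  \matrix_(a, i)
    [:: vec3 (velocity (crv S) 0 p.1) (velocity (crv S) 1 p.1) 0;
        vec3 0 0 1]`_a 0 i.

Definition area_density (R : realType) (G : 'rV[R]_3 -> 'M[R]_3)
    (S : axisym_surface R) (p : R * R) : R :=
  let T := surface_tangents S p in
  Num.sqrt (\det (T *m G (surface_point S p) *m T^T)).

(* The area of S within a set [D] of cylindrical coordinates, for the metric with
   components [G] in these coordinates. *)
Definition area (R : realType) (G : 'rV[R]_3 -> 'M[R]_3)
    (S : axisym_surface R) (D : set 'rV[R]_3) : \bar R :=
  (\int[lebesgue_measure \x lebesgue_measure]_(p in
      [set p : R * R | dom S p.1 /\ D (surface_point S p)])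
    (area_density G S p)%:E)%E.

Definition euclidean_cyl_metric (R : realType) (q : 'rV[R]_3) : 'M[R]_3 :=
  diag_mx (vec3 1 1 (q 0 0 ^+ 2)).

Definition euclidean_area (R : realType) (S : axisym_surface R)
    (D : set 'rV[R]_3) : \bar R :=
  area (@euclidean_cyl_metric R) S D.

Definition metric_area (R : realType) (g : axisym_data R)
    (S : axisym_surface R) (D : set 'rV[R]_3) : \bar R :=
  area (cyl_metric g) S D.

Definition Omega_tilde (R : realType) (rho0 rho1 sigma : R) : set 'rV[R]_3 :=
  [set q | rho0 + sigma <= q 0 0 <= rho1 /\ `|q 0 1| <= rho1 / 2
           /\ 0 <= q 0 2 < 2 * pi].

(* Main.v *)
(* The area element of a metric g on a rotated curve is e^w times the Euclidean
   one, where w = alpha - 2u.  In terms of the energy density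
   e = div (W_rho, W_z) = rho (4 Lap u - 2 Lap alpha) + 4 u_rho, nonnegative
   scalar curvature reads e >= 2 rho |grad u|^2, and the flux of W through large
   half circles tends to 8 m; hence the integral of e over any rectangle of the
   half-plane is at most 8 m.

   On Q = [rho0, L] x [-L, L] one has Lap w = 2 u_rho / rho - e / (2 rho), where
   the first term is absorbed by the energy, and w_rho <= 0 at rho = rho0.
   Green's formula against the mollified logarithm reflected in rho = rho0 gives
   w >= -small and w <= small + (log potential of a measure of mass O(m)).  The
   upper bound cannot be uniform, but by Jensen's inequality
   e^w <= (1 + small) (1 + K int_Q |x - y|^(-1/2) e(y) dy), and the integral of
   |x - y|^(-1/2) for x along a regular C^1 curve is bounded independently of y,
   so Tonelli's theorem bounds the area by (1 + small) (Euclidean area + O(m)). *)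
From HB Require Import structures.
Require Import Defs.
From mathcomp Require Import all_boot all_order all_algebra.
From mathcomp Require Import all_classical all_reals all_analysis.
From mathcomp Require Import measurable_realfun ring lra.
Import Order.TTheory GRing.Theory Num.Theory.
Import numFieldNormedType.Exports.
Set Implicit Arguments.
Unset Strict Implicit.
Unset Printing Implicit Defensive.
Local Open Scope classical_set_scope.
Local Open Scope ring_scope.

(** * Scalar curvature *)

(** The only smallness available is integral, since the energy has total mass O(m), so every
    constant must be fixed before the metric. The term [2 u_rho / rho] has no sign and is only
    square integrable: Young's inequality with a parameter [lam] trades it, tested against a kernel,
    for [lam] times the squared kernel plus O(1 / lam) times the energy. The sides of Q away from
    rho = rho0 contribute O(C / L), multiplied at worst by a kernel of size O(sqrt L), and uniform
    decay makes this small for large L. Hence the order of choices L, [lam], [delta]; the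
    mollification parameter comes last and may depend on g, because all other bounds are uniform in
    it. Mollifying keeps every integrand continuous, so Green's identity for C2 functions on a
    rectangle suffices. Reflection removes the unknown values of w on rho = rho0 and leaves its
    normal derivative, whose sign is known. On the ADM side, decay of A and B like 1 / r does not
    make [rho A] and [rho B] small; these are off-diagonal Cartesian components, and their decay
    comes from the asymptotic flatness of each single metric. *)

Section polynomial_terms.
Context {R : realType} {V : normedModType R}.

(** Reified polynomials in numbered atoms: derivatives of long component expressions are computed by
    reduction, and the remaining identities go to [ring] and [field]. *)
Inductive tm :=
  | TK of R | TA of nat | TD of tm & tm | TM of tm & tm.

Fixpoint teval (e : nat -> V -> R) (t : tm) (x : V) : R :=
  match t with
  | TK k => k
  | TA n => e n x
  | TD t1 t2 => teval e t1 x + teval e t2 x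
  | TM t1 t2 => teval e t1 x * teval e t2 x
  end.

Fixpoint tderiv (d : nat -> tm) (t : tm) : tm :=
  match t with
  | TK k => TK 0
  | TA n => d n
  | TD t1 t2 => TD (tderiv d t1) (tderiv d t2)
  | TM t1 t2 => TD (TM t1 (tderiv d t2)) (TM t2 (tderiv d t1))
  end.

Fixpoint tatoms (N : nat) (t : tm) : bool :=
  match t with
  | TK k => true
  | TA n => (n < N)%N
  | TD t1 t2 | TM t1 t2 => tatoms N t1 && tatoms N t2
  end.

(** The bound [N] separates the atoms whose derivative is known from those that occur only as
    derivatives: each differentiation uses up one order. *)
Lemma is_derive_teval (e : nat -> V -> R) (d : nat -> tm) (N : nat) (x v : V) :
  (forall n, (n < N)%N -> is_derive x v (e n) (teval e (d n) x)) ->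
  forall t, tatoms N t -> is_derive x v (teval e t) (teval e (tderiv d t) x).
Proof.
move=> He; elim=> [k|n|t1 IH1 t2 IH2|t1 IH1 t2 IH2] /=.
- by move=> _; exact: is_derive_cst.
- by move=> nN; exact: He.
- by case/andP=> /IH1 ? /IH2 ?; exact: is_deriveD.
- by case/andP=> /IH1 h1 /IH2 h2; have := is_deriveM h1 h2.
Qed.

End polynomial_terms.
Arguments TA {R}.

Declare Scope tm_scope.
Delimit Scope tm_scope with T.
Notation "x + y" := (TD x y) : tm_scope.
Notation "x * y" := (TM x y) : tm_scope.
Notation "- x" := (TM (TK (-1)) x) : tm_scope.
Notation "x - y" := (TD x (TM (TK (-1)) y)) : tm_scope.

(** * Curvature of a metric invariant along its third coordinate *)

Section kaluza_klein.
Context {R : realType}.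
Notation tm := (@tm R).

(* Atoms, in order: a = e^(2nu), c = e^(2psi), A, B, c/a, the first derivatives
   of nu, psi, A, B, and then their second derivatives. *)
Definition kk_a : tm := TA 0.
Definition kk_c : tm := TA 1.
Definition kk_A : tm := TA 2.
Definition kk_B : tm := TA 3.
Definition kk_k : tm := TA 4.
Definition kk_n (i : nat) : tm := TA (5 + i).
Definition kk_p (i : nat) : tm := TA (7 + i).
Definition kk_dA (i : nat) : tm := TA (9 + i).
Definition kk_dB (i : nat) : tm := TA (11 + i).
Definition kk_two : tm := TK 2.

(** The third coordinate is the Killing direction, hence the zero. An atom [m] from 5 on is a first
    derivative; its two derivatives sit at [13 + 2 (m - 5)] and the next place. Mixed second
    derivatives are distinct atoms, so their symmetry is never invoked. *)
Definition kk_deriv (i : 'I_3) (n : nat) : tm :=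
  if i == 2 :> nat then TK 0 else
  match n with
  | 0%N => (kk_two * kk_n i * kk_a)%T
  | 1%N => (kk_two * kk_p i * kk_c)%T
  | 2%N => kk_dA i
  | 3%N => kk_dB i
  | 4%N => (kk_two * (kk_p i - kk_n i) * kk_k)%T
  | m => TA (13 + (m - 5) * 2 + i)
  end.

(** The metric [a (dx0^2 + dx1^2) + c (dx2 + B dx0 + A dx1)^2]. *)
Definition kk_metric (i j : nat) : tm :=
  match i, j with
  | 0%N, 0%N => (kk_a + kk_c * (kk_B * kk_B))%T
  | 0%N, 1%N | 1%N, 0%N => (kk_c * (kk_A * kk_B))%T
  | 1%N, 1%N => (kk_a + kk_c * (kk_A * kk_A))%T
  | 0%N, _ | _, 0%N => (kk_c * kk_B)%T
  | 1%N, _ | _, 1%N => (kk_c * kk_A)%T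
  | _, _ => kk_c
  end.

(** Half of the curvature of the connection form [dx2 + B dx0 + A dx1]. *)
Definition kk_F : tm := (TK 2^-1 * (kk_dA 0 - kk_dB 1))%T.

(** Christoffel symbols, upper index first. They are polynomial because [c / a] is an atom, so
    [tderiv] applies to them in turn. *)
Definition kk_gamma (l i j : nat) : tm :=
  let A := kk_A in let B := kk_B in let k := kk_k in
  let n1 := kk_n 0 in let n2 := kk_n 1 in
  let p1 := kk_p 0 in let p2 := kk_p 1 in let F := kk_F in
  match l, i, j with
  | 0%N, 0%N, 0%N => (n1 - k * (B * B * p1))%T
  | 0%N, 0%N, 1%N | 0%N, 1%N, 0%N => (n2 - k * (A * B * p1 + B * F))%T
  | 0%N, 1%N, 1%N => (- n1 - k * (A * A * p1 + kk_two * A * F))%T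
  | 0%N, 0%N, _ | 0%N, _, 0%N => (- (k * (B * p1)))%T
  | 0%N, 1%N, _ | 0%N, _, 1%N => (- (k * (A * p1 + F)))%T
  | 0%N, _, _ => (- (k * p1))%T
  | 1%N, 0%N, 0%N => (- n2 - k * (B * B * p2 - kk_two * B * F))%T
  | 1%N, 0%N, 1%N | 1%N, 1%N, 0%N => (n1 - k * (A * B * p2 - A * F))%T
  | 1%N, 1%N, 1%N => (n2 - k * (A * A * p2))%T
  | 1%N, 0%N, _ | 1%N, _, 0%N => (- (k * (B * p2 - F)))%T
  | 1%N, 1%N, _ | 1%N, _, 1%N => (- (k * (A * p2)))%T
  | 1%N, _, _ => (- (k * p2))%T
  | _, 0%N, 0%N => (kk_dB 0 + kk_two * B * p1 - B * n1 + A * n2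
      + k * (B * B * B * p1 + A * B * B * p2 - kk_two * A * B * F))%T
  | _, 0%N, 1%N | _, 1%N, 0%N => (TK 2^-1 * (kk_dA 0 + kk_dB 1) + A * p1 + B * p2
      - A * n1 - B * n2
      + k * (A * B * B * p1 + A * A * B * p2 + B * B * F - A * A * F))%T
  | _, 1%N, 1%N => (kk_dA 1 + kk_two * A * p2 + B * n1 - A * n2
      + k * (A * A * B * p1 + A * A * A * p2 + kk_two * A * B * F))%T
  | _, 0%N, _ | _, _, 0%N => (p1 + k * (B * B * p1 + A * B * p2 - A * F))%T
  | _, 1%N, _ | _, _, 1%N => (p2 + k * (A * B * p1 + A * A * p2 + B * F))%T
  | _, _, _ => (k * (B * p1 + A * p2))%T
  end.

Variables (e : nat -> 'rV[R]_3 -> R) (G : 'rV[R]_3 -> 'M[R]_3) (U : set 'rV[R]_3).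
Hypotheses (oU : open U).
Hypothesis (He : forall x, U x -> forall (i : 'I_3) n, (n < 13)%N ->
  is_derive x (delta_mx 0 i) (e n) (teval e (kk_deriv i n) x)).
Hypothesis (HG : forall x, G x = \matrix_(i, j) teval e (kk_metric i j) x).
Hypothesis (e_a : forall x, U x -> 0 < e 0 x).
Hypothesis (e_c : forall x, U x -> 0 < e 1 x).
Hypothesis (e_k : forall x, U x -> e 4 x = e 1 x / e 0 x).

Definition kk_inv (x : 'rV[R]_3) (i j : nat) : R :=
  let a := e 0 x in let c := e 1 x in let A := e 2 x in let B := e 3 x in
  match i, j with
  | 0%N, 0%N | 1%N, 1%N => a^-1
  | 0%N, 1%N | 1%N, 0%N => 0
  | 0%N, _ | _, 0%N => - B / a
  | 1%N, _ | _, 1%N => - A / a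
  | _, _ => c^-1 + (A ^+ 2 + B ^+ 2) / a
  end.

Lemma kk_invmx (x : 'rV[R]_3) : U x -> invmx (G x) = \matrix_(i, j) kk_inv x i j.
Proof.
move=> Ux; have a0 := e_a Ux; have c0 := e_c Ux.
have H : G x *m (\matrix_(i, j) kk_inv x i j) = 1%:M.
  rewrite HG; apply/matrixP => i j; rewrite !mxE.
  rewrite !big_ord_recl big_ord0 !mxE /=.
  have a0' : e 0 x != 0 by rewrite gt_eqF.
  have c0' : e 1 x != 0 by rewrite gt_eqF.
  case: i => [[|[|[|//]]] ?]; case: j => [[|[|[|//]]] ?] /=; rewrite /kk_inv /=;
    field; rewrite ?a0' ?c0' //.
have [Gu _] := mulmx1_unit H.
by rewrite -[LHS]mulmx1 -H mulmxA mulVmx // mul1mx.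
Qed.

Lemma kk_christoffel (x : 'rV[R]_3) (l i j : 'I_3) : U x ->
  christoffel G l i j x = teval e (kk_gamma l i j) x.
Proof.
move=> Ux; have a0 := e_a Ux; have c0 := e_c Ux.
have a0' : e 0 x != 0 by rewrite gt_eqF.
have c0' : e 1 x != 0 by rewrite gt_eqF.
have dG (k m n : 'I_3) : partial k (fun y => G y m n) x
    = teval e (tderiv (kk_deriv k) (kk_metric m n)) x.
  rewrite /partial.
  have -> : (fun y => G y m n) = teval e (kk_metric m n).
    by apply/funext => y; rewrite HG mxE.
  have := @is_derive_teval _ _ e (kk_deriv k) 13 x (delta_mx 0 k) (He Ux k) (kk_metric m n).
  have -> : tatoms 13 (kk_metric m n).
    by case: m => [[|[|[|//]]] ?]; case: n => [[|[|[|//]]] ?].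
  by move=> /(_ isT) H; rewrite derive_val.
rewrite /christoffel kk_invmx // !big_ord_recl big_ord0 !dG !mxE.
have ek := e_k Ux.
case: l => [[|[|[|//]]] ?]; case: i => [[|[|[|//]]] ?]; case: j => [[|[|[|//]]] ?];
  rewrite /= /kk_inv /= ek; field; rewrite ?a0' ?c0' //.
Qed.

Lemma kk_partial_christoffel (x : 'rV[R]_3) (m l i j : 'I_3) : U x ->
  partial m (christoffel G l i j) x
  = teval e (tderiv (kk_deriv m) (kk_gamma l i j)) x.
Proof.
move=> Ux; rewrite /partial.
rewrite (@near_eq_derive _ _ _ (christoffel G l i j) (teval e (kk_gamma l i j))).
- have := @is_derive_teval _ _ e (kk_deriv m) 13 x (delta_mx 0 m) (He Ux m) (kk_gamma l i j).
  have -> : tatoms 13 (kk_gamma l i j).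
    by case: l => [[|[|[|//]]] ?]; case: i => [[|[|[|//]]] ?];
       case: j => [[|[|[|//]]] ?].
  by move=> /(_ isT) H; rewrite derive_val.
- have := open_nbhs_nbhs (conj oU Ux).
  by apply: filterS => y Uy; exact: kk_christoffel.
Qed.

(** [r] is the component along the Killing direction; [s1] and [s2] complete the mixed ones. The
    entries (0,1) and (1,0) fall into the default branch without being computed: the inverse metric
    vanishes there, so the trace does not see them. *)
Definition kk_ricci (x : 'rV[R]_3) (i j : nat) : R :=
  let k := e 4 x in let A := e 2 x in let B := e 3 x in
  let n1 := e 5 x in let n2 := e 6 x in let p1 := e 7 x in let p2 := e 8 x in
  let F := 2^-1 * (e 9 x - e 12 x) in
  let F1 := 2^-1 * (e 21 x - e 27 x) in let F2 := 2^-1 * (e 22 x - e 28 x) in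
  let r := 2 * k ^+ 2 * F ^+ 2 - k * (p1 ^+ 2 + p2 ^+ 2 + e 17 x + e 20 x) in
  let s2 := k * (F2 - 2 * F * n2 + 3 * F * p2) in
  let s1 := k * (2 * F * n1 - 3 * F * p1 - F1) in
  match i, j with
  | 0%N, 0%N => B ^+ 2 * r + 2 * B * s2 - 2 * k * F ^+ 2 + n1 * p1 - n2 * p2
      - e 13 x - e 16 x - p1 ^+ 2 - e 17 x
  | 1%N, 1%N => A ^+ 2 * r + 2 * A * s1 - 2 * k * F ^+ 2 - n1 * p1 + n2 * p2
      - e 13 x - e 16 x - p2 ^+ 2 - e 20 x
  | 0%N, 2%N | 2%N, 0%N => B * r + s2
  | 1%N, 2%N | 2%N, 1%N => A * r + s1
  | _, _ => r
  end.

Lemma kk_ricciE (x : 'rV[R]_3) (i j : 'I_3) : U x ->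
  (i, j) \notin [:: (0, 1); (1, 0)] -> ricci G i j x = kk_ricci x i j.
Proof.
move=> Ux; rewrite /ricci => ij.
have -> : \sum_k (partial k (christoffel G k i j) x - partial j (christoffel G k i k) x)
    = \sum_(k < 3) (teval e (tderiv (kk_deriv k) (kk_gamma k i j)) x
                 - teval e (tderiv (kk_deriv j) (kk_gamma k i k)) x).
  by apply: eq_bigr => k _; rewrite !kk_partial_christoffel.
have -> : \sum_k \sum_l (christoffel G k k l x * christoffel G l i j x
                   - christoffel G k j l x * christoffel G l i k x)
    = \sum_(k < 3) \sum_(l < 3)
       (teval e (kk_gamma k k l) x * teval e (kk_gamma l i j) x
        - teval e (kk_gamma k j l) x * teval e (kk_gamma l i k) x).
  by apply: eq_bigr => k _; apply: eq_bigr => l _; rewrite !kk_christoffel.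
rewrite !big_ord_recl !big_ord0.
case: i ij => [[|[|[|//]]] ?]; case: j => [[|[|[|//]]] ?] //= _; rewrite /kk_ricci;
  move: (e 2 x) (e 3 x) (e 4 x) (e 5 x) (e 6 x) (e 7 x) (e 8 x) (e 9 x) (e 12 x)
    (e 10 x) (e 11 x) => A B k n1 n2 p1 p2 A1 B2 A2 B1; by field.
Qed.

(** The Kaluza-Klein formula [- 2 e^(-2 nu) (Lap nu + Lap psi + |d psi|^2)] minus a multiple of the
    squared curvature of the connection form. The sign of that last term is what later eliminates A
    and B. *)
Lemma kk_scalar_curvature (x : 'rV[R]_3) : U x ->
  scalar_curvature G x =
  - 2 / e 0 x * (e 13 x + e 16 x + e 17 x + e 20 x + e 7 x ^+ 2 + e 8 x ^+ 2)
  - e 1 x / (2 * e 0 x ^+ 2) * (e 9 x - e 12 x) ^+ 2.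
Proof.
move=> Ux; have a0 := e_a Ux; have c0 := e_c Ux; have ek := e_k Ux.
have a0' : e 0 x != 0 by rewrite gt_eqF.
have c0' : e 1 x != 0 by rewrite gt_eqF.
have -> : scalar_curvature G x = \sum_(i < 3) \sum_(j < 3) kk_inv x i j * kk_ricci x i j.
  apply: eq_bigr => i _; apply: eq_bigr => j _; rewrite kk_invmx // mxE.
  have [|ij] := boolP ((i, j) \in [:: (0, 1); (1, 0)]); last by rewrite kk_ricciE.
  by rewrite !inE !xpair_eqE => /orP[] /andP[/eqP -> /eqP ->]; rewrite /= !mul0r.
rewrite !big_ord_recl !big_ord0 /= /kk_inv /kk_ricci /= ek.
by field; rewrite a0' c0'.
Qed.

End kaluza_klein.

(** * Directional derivatives and chain rules *)

Section chain_rules.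
Context {R : realType}.

(** A directional derivative is a one-variable derivative along a line; this transfers one-variable
    chain rules to arbitrary directions. *)
Lemma is_derive_line (V W : normedModType R) (F : V -> W) (x v : V) (d : W) :
  is_derive (0 : R) (1 : R) (fun h : R => F (h *: v + x)) d <-> is_derive x v F d.
Proof.
have E : (fun h : R => h^-1 *: (((fun h : R => F (h *: v + x)) \o shift 0) (h *: 1)
    - F (0 *: v + x))) = (fun h => h^-1 *: ((F \o shift x) (h *: v) - F x)).
  by apply/funext => h /=; rewrite addr0 scale0r add0r [h *: 1]mulr1.
by split=> -[df dF]; split; rewrite ?/derivable ?/derive ?E // -?E.
Qed.

Lemma is_derive_comp1 (V : normedModType R) (phi : R -> R) (f : V -> R) (x v : V)
    (dphi df : R) :
  is_derive (f x) 1 phi dphi -> is_derive x v f df ->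
  is_derive x v (fun y => phi (f y)) (dphi * df).
Proof.
move=> hp /is_derive_line hf; apply/is_derive_line.
have hp' : is_derive (f (0 *: v + x)) 1 phi dphi by rewrite scale0r add0r.
exact: (@is_derive1_comp _ phi (fun h : R => f (h *: v + x)) 0 _ _ hp' hf).
Qed.

Lemma diff_sum_partial (n : nat) (f : 'rV[R]_n.+1 -> R) (x w : 'rV[R]_n.+1) :
  differentiable f x -> 'd f x w = \sum_k partial k f x * w 0 k.
Proof.
move=> df; rewrite {1}(row_sum_delta w) linear_sum; apply: eq_bigr => k _.
by rewrite linearZ /= -deriveE // mulrC.
Qed.

Lemma is_derive_chain (n : nat) (V : normedModType R) (f : 'rV[R]_n.+1 -> R)
    (g : V -> 'rV[R]_n.+1) (x v : V) (dg : 'rV[R]_n.+1) :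
  differentiable f (g x) ->
  (forall k, is_derive x v (fun y => g y 0 k) (dg 0 k)) ->
  is_derive x v (fun y => f (g y)) (\sum_k partial k f (g x) * dg 0 k).
Proof.
move=> df hg; apply/is_derive_line.
set gam := fun h : R => g (h *: v + x).
have g0 : gam 0 = g x by rewrite /gam scale0r add0r.
have dgam : derivable gam 0 1.
  apply/derivable_mxP => i k; rewrite ord1.
  by have /is_derive_line[] := hg k.
have Dgam : 'D_1 gam 0 = dg.
  rewrite derive_mx //; apply/rowP => k; rewrite mxE.
  by have /is_derive_line[] := hg k.
have fgam : differentiable gam 0 by apply/derivable1_diffP.
have fd : differentiable f (gam 0) by rewrite g0.
have cd := differentiable_comp fgam fd.
split; first exact/derivable1_diffP.
have dE : 'd gam 0 1 = dg by rewrite -deriveE.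
by rewrite deriveE // diff_comp //= dE diff_sum_partial // /gam scale0r add0r.
Qed.

Lemma smooth_partials (n : nat) (f : 'rV[R]_n.+1 -> R) (s : seq 'I_n.+1) :
  smooth f -> smooth (partials s f).
Proof. by move=> sf t x; rewrite /partials -foldr_cat; exact: sf. Qed.

Lemma smooth_partial (n : nat) (f : 'rV[R]_n.+1 -> R) (i : 'I_n.+1) :
  smooth f -> smooth (partial i f).
Proof. exact: (@smooth_partials n f [:: i]). Qed.

Lemma smooth_differentiable (n : nat) (f : 'rV[R]_n.+1 -> R) x :
  smooth f -> differentiable f x.
Proof. by move=> /(_ [::] x). Qed.

Lemma smooth_continuous (n : nat) (f : 'rV[R]_n.+1 -> R) : smooth f -> continuous f.
Proof. by move=> sf x; apply: differentiable_continuous; exact: smooth_differentiable. Qed.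

End chain_rules.
#[global] Hint Resolve smooth_partials smooth_partial smooth_differentiable : core.

Lemma vec2E (R : realType) (a b : R) (j : 'I_2) : vec2 a b 0 j = [:: a; b]`_j.
Proof. by rewrite mxE. Qed.

Lemma vec3E (R : realType) (a b c : R) (j : 'I_3) : vec3 a b c 0 j = [:: a; b; c]`_j.
Proof. by rewrite mxE. Qed.

Section half_plane.
Context {R : realType}.

Lemma is_derive_coord (n : nat) (x v : 'rV[R]_n) (k : 'I_n) :
  is_derive x v (fun y : 'rV[R]_n => y 0 k) (v 0 k).
Proof.
apply/is_derive_line.
have -> : (fun h : R => (h *: v + x) 0 k) = (id * cst (v 0 k) + cst (x 0 k)).
  by apply/funext => h; rewrite !mxE.
by apply: is_derive_eq; rewrite scaler0 add0r addr0 [LHS]mulr1.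
Qed.

Lemma is_derive_half_plane (f : 'rV[R]_2 -> R) (q v : 'rV[R]_3) : smooth f ->
  is_derive q v (fun q => f (half_plane_part q))
   (partial 0 f (half_plane_part q) * v 0 0 + partial 1 f (half_plane_part q) * v 0 1).
Proof.
move=> sf.
have := @is_derive_chain R 1 _ f (@half_plane_part R) q v (vec2 (v 0 0) (v 0 1)).
rewrite !big_ord_recl big_ord0 addr0 !vec2E /=.
have -> : lift ord0 ord0 = 1 :> 'I_2 by apply/val_inj.
apply; first exact: smooth_differentiable.
case=> [[|[|//]]] ?; rewrite vec2E /=.
- under eq_fun do rewrite vec2E /=; exact: is_derive_coord.
- under eq_fun do rewrite vec2E /=; exact: is_derive_coord.
Qed.

End half_plane.

(** * Scalar curvature in cylindrical coordinates *)

Section cylindrical_curvature.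
Context {R : realType}.

Definition dhp (i : 'I_3) (f : 'rV[R]_2 -> R) (p : 'rV[R]_2) : R :=
  match val i with 0%N => partial 0 f p | 1%N => partial 1 f p | _ => 0 end.

Lemma is_derive_hp (f : 'rV[R]_2 -> R) (q : 'rV[R]_3) (i : 'I_3) : smooth f ->
  is_derive q (delta_mx 0 i) (fun q => f (half_plane_part q))
    (dhp i f (half_plane_part q)).
Proof.
move=> sf; apply: (is_derive_eq (is_derive_half_plane q _ sf)).
by rewrite !mxE /dhp; case: i => [[|[|[|//]]] ?] /=;
  rewrite ?mulr1 ?mulr0 ?addr0 ?add0r.
Qed.

Lemma is_derive_rho (q : 'rV[R]_3) (i : 'I_3) :
  is_derive q (delta_mx 0 i) (fun q => q 0 0) (i == 0)%:R.
Proof.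
apply: is_derive_eq; first exact: is_derive_coord.
by rewrite mxE eqxx /= eq_sym.
Qed.

Variable g : axisym_data R.
Hypothesis Hs : [/\ smooth (ax_u g), smooth (ax_alpha g), smooth (ax_A g)
        & smooth (ax_B g)].

(** The instance [nu = alpha - u], [psi = ln rho - u]: hence [c / a = rho^2 e^(-2 alpha)], and the
    terms [1 / rho], [- 1 / rho^2] in the derivatives of [psi]. *)
Definition cyl_atoms (n : nat) (q : 'rV[R]_3) : R :=
  let p := half_plane_part q in
  let u := ax_u g in let al := ax_alpha g in
  let A := ax_A g in let B := ax_B g in
  match n with
  | 0%N => expR (2 * al p - 2 * u p)
  | 1%N => q 0 0 ^+ 2 * expR (- (2 * u p))
  | 2%N => A p
  | 3%N => B p
  | 4%N => q 0 0 ^+ 2 * expR (- (2 * al p))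
  | 5%N => partial 0 al p - partial 0 u p
  | 6%N => partial 1 al p - partial 1 u p
  | 7%N => (q 0 0)^-1 - partial 0 u p
  | 8%N => - partial 1 u p
  | 9%N => partial 0 A p
  | 10%N => partial 1 A p
  | 11%N => partial 0 B p
  | 12%N => partial 1 B p
  | 13%N => partial 0 (partial 0 al) p - partial 0 (partial 0 u) p
  | 14%N => partial 1 (partial 0 al) p - partial 1 (partial 0 u) p
  | 15%N => partial 0 (partial 1 al) p - partial 0 (partial 1 u) p
  | 16%N => partial 1 (partial 1 al) p - partial 1 (partial 1 u) p
  | 17%N => - (q 0 0) ^- 2 - partial 0 (partial 0 u) p
  | 18%N => - partial 1 (partial 0 u) p
  | 19%N => - partial 0 (partial 1 u) p
  | 20%N => - partial 1 (partial 1 u) p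
  | 21%N => partial 0 (partial 0 A) p
  | 22%N => partial 1 (partial 0 A) p
  | 23%N => partial 0 (partial 1 A) p
  | 24%N => partial 1 (partial 1 A) p
  | 25%N => partial 0 (partial 0 B) p
  | 26%N => partial 1 (partial 0 B) p
  | 27%N => partial 0 (partial 1 B) p
  | _ => partial 1 (partial 1 B) p
  end.

Lemma cyl_atoms_derive (q : 'rV[R]_3) : 0 < q 0 0 -> forall (i : 'I_3) n, (n < 13)%N ->
  is_derive q (delta_mx 0 i) (cyl_atoms n) (teval cyl_atoms (kk_deriv i n) q).
Proof.
case: Hs => su sal sA sB q0 i.
have du := is_derive_hp q i su; have dal := is_derive_hp q i sal.
have dr := is_derive_rho q i.
have dE (f : 'rV[R]_3 -> R) (df : R) : is_derive q (delta_mx 0 i) f df ->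
    is_derive q (delta_mx 0 i) (fun q => expR (f q)) (expR (f q) * df).
  by move=> hf; apply: is_derive_comp1.
have d2 (f : 'rV[R]_3 -> R) (df : R) : is_derive q (delta_mx 0 i) f df ->
    is_derive q (delta_mx 0 i) (fun q => 2 * f q) (2 * df).
  by move=> hf; exact: (is_deriveZ 2 hf).
have dB' (f h : 'rV[R]_3 -> R) (df dh : R) : is_derive q (delta_mx 0 i) f df ->
    is_derive q (delta_mx 0 i) h dh ->
    is_derive q (delta_mx 0 i) (fun q => f q - h q) (df - dh).
  by move=> hf hh; exact: (is_deriveB hf hh).
have dN (f : 'rV[R]_3 -> R) (df : R) : is_derive q (delta_mx 0 i) f df ->
    is_derive q (delta_mx 0 i) (fun q => - f q) (- df).
  by move=> hf; exact: (is_deriveN hf).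
have dM (f h : 'rV[R]_3 -> R) (df dh : R) : is_derive q (delta_mx 0 i) f df ->
    is_derive q (delta_mx 0 i) h dh ->
    is_derive q (delta_mx 0 i) (fun q => f q * h q) (f q * dh + h q * df).
  by move=> hf hh; exact: (is_deriveM hf hh).
have dr2 : is_derive q (delta_mx 0 i) (fun q => q 0 0 ^+ 2) (2 * q 0 0 * (i == 0)%:R).
  by apply: (is_derive_eq (dM _ _ _ _ dr dr)); ring.
have dV : is_derive q (delta_mx 0 i) (fun q => (q 0 0)^-1) (- (q 0 0) ^- 2 * (i == 0)%:R).
  apply: (@is_derive_comp1 R _ GRing.inv (fun q : 'rV[R]_3 => q 0 0)) => //.
  have := @is_deriveV R id (q 0 0) 1 1; rewrite gt_eqF // => /(_ isT (is_derive_id _ _)).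
  by rewrite [_ *: 1]mulr1.
have q0' : q 0 0 != 0 by rewrite gt_eqF.
have H0 f (sf : smooth f) := is_derive_hp q i (smooth_partial 0 sf).
have H1 f (sf : smooth f) := is_derive_hp q i (smooth_partial 1 sf).
case=> [|[|[|[|[|[|[|[|[|[|[|[|[|n]]]]]]]]]]]]].
all: cycle 13.
  by [].
all: move=> _.
- apply: (is_derive_eq (dE _ _ (dB' _ _ _ _ (d2 _ _ dal) (d2 _ _ du)))); move: i {du dal dr dr2 dE d2 dB' dN dM dV H0 H1}.
  by case=> [[|[|[|//]]] ?]; rewrite /kk_deriv /dhp /=; ring.
- apply: (is_derive_eq (dM _ _ _ _ dr2 (dE _ _ (dN _ _ (d2 _ _ du))))); move: i {du dal dr dr2 dE d2 dB' dN dM dV H0 H1}.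
  by case=> [[|[|[|//]]] ?]; rewrite /kk_deriv /dhp /=; field.
- apply: (is_derive_eq (is_derive_hp q i sA)); move: i {du dal dr dr2 dE d2 dB' dN dM dV H0 H1}.
  by case=> [[|[|[|//]]] ?]; rewrite /kk_deriv /dhp /=; rewrite ?(mulr1, mulr0, sub0r, subr0, oppr0).
- apply: (is_derive_eq (is_derive_hp q i sB)); move: i {du dal dr dr2 dE d2 dB' dN dM dV H0 H1}.
  by case=> [[|[|[|//]]] ?]; rewrite /kk_deriv /dhp /=; rewrite ?(mulr1, mulr0, sub0r, subr0, oppr0).
- apply: (is_derive_eq (dM _ _ _ _ dr2 (dE _ _ (dN _ _ (d2 _ _ dal))))); move: i {du dal dr dr2 dE d2 dB' dN dM dV H0 H1}.
  by case=> [[|[|[|//]]] ?]; rewrite /kk_deriv /dhp /=; field.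
- apply: (is_derive_eq (dB' _ _ _ _ (H0 _ sal) (H0 _ su))); move: i {du dal dr dr2 dE d2 dB' dN dM dV H0 H1}.
  by case=> [[|[|[|//]]] ?]; rewrite /kk_deriv /dhp /=; rewrite ?(mulr1, mulr0, sub0r, subr0, oppr0).
- apply: (is_derive_eq (dB' _ _ _ _ (H1 _ sal) (H1 _ su))); move: i {du dal dr dr2 dE d2 dB' dN dM dV H0 H1}.
  by case=> [[|[|[|//]]] ?]; rewrite /kk_deriv /dhp /=; rewrite ?(mulr1, mulr0, sub0r, subr0, oppr0).
- apply: (is_derive_eq (dB' _ _ _ _ dV (H0 _ su))); move: i {du dal dr dr2 dE d2 dB' dN dM dV H0 H1}.
  by case=> [[|[|[|//]]] ?]; rewrite /kk_deriv /dhp /=; rewrite ?(mulr1, mulr0, sub0r, subr0, oppr0).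
- apply: (is_derive_eq (dN _ _ (H1 _ su))); move: i {du dal dr dr2 dE d2 dB' dN dM dV H0 H1}.
  by case=> [[|[|[|//]]] ?]; rewrite /kk_deriv /dhp /=; rewrite ?(mulr1, mulr0, sub0r, subr0, oppr0).
- apply: (is_derive_eq (H0 _ sA)); move: i {du dal dr dr2 dE d2 dB' dN dM dV H0 H1}.
  by case=> [[|[|[|//]]] ?]; rewrite /kk_deriv /dhp /=; rewrite ?(mulr1, mulr0, sub0r, subr0, oppr0).
- apply: (is_derive_eq (H1 _ sA)); move: i {du dal dr dr2 dE d2 dB' dN dM dV H0 H1}.
  by case=> [[|[|[|//]]] ?]; rewrite /kk_deriv /dhp /=; rewrite ?(mulr1, mulr0, sub0r, subr0, oppr0).
- apply: (is_derive_eq (H0 _ sB)); move: i {du dal dr dr2 dE d2 dB' dN dM dV H0 H1}.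
  by case=> [[|[|[|//]]] ?]; rewrite /kk_deriv /dhp /=; rewrite ?(mulr1, mulr0, sub0r, subr0, oppr0).
- apply: (is_derive_eq (H1 _ sB)); move: i {du dal dr dr2 dE d2 dB' dN dM dV H0 H1}.
  by case=> [[|[|[|//]]] ?]; rewrite /kk_deriv /dhp /=; rewrite ?(mulr1, mulr0, sub0r, subr0, oppr0).
Qed.

Lemma cyl_metricE (q : 'rV[R]_3) :
  cyl_metric g q = \matrix_(i, j) teval cyl_atoms (kk_metric i j) q.
Proof.
apply/matrixP => i j; rewrite !mxE !big_ord_recl !big_ord0 !mxE /=.
by case: i => [[|[|[|//]]] ?]; case: j => [[|[|[|//]]] ?] /=; ring.
Qed.

Lemma open_rho_gt0 : open [set q : 'rV[R]_3 | 0 < q 0 0].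
Proof.
have : continuous (fun q : 'rV[R]_3 => q 0 0) by exact: coord_continuous.
by move=> /continuousP /(_ [set x | 0 < x]) /(_ (@open_gt _ 0)).
Qed.

Lemma cyl_atoms_k (q : 'rV[R]_3) : cyl_atoms 4 q = cyl_atoms 1 q / cyl_atoms 0 q.
Proof.
rewrite /= -mulrA; congr (_ * _); rewrite -expRN -expRD; congr expR; ring.
Qed.

Lemma cyl_invmx (q : 'rV[R]_3) : 0 < q 0 0 ->
  invmx (cyl_metric g q) = \matrix_(i, j) kk_inv cyl_atoms q i j.
Proof.
move=> q0; apply: (@kk_invmx _ _ _ [set q | 0 < q 0 0]) => //.
- exact: cyl_metricE.
- by move=> x _; rewrite /= expR_gt0.
- by move=> x x0; rewrite /= mulr_gt0 ?exprn_gt0 // expR_gt0.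
Qed.

Definition lap2 (f : 'rV[R]_2 -> R) (p : 'rV[R]_2) : R :=
  partial 0 (partial 0 f) p + partial 1 (partial 1 f) p.

(** The squared curvature of the connection form enters the scalar curvature negatively and is
    dropped. In the rest, the term [- 1 / rho^2] of [Lap (ln rho)] cancels against the one in
    [(1 / rho - u_rho)^2]. *)
Lemma nonneg_scalar_curvature_lap (p : 'rV[R]_2) :
  nonneg_scalar_curvature g -> 0 < p 0 0 ->
  partial 0 (ax_u g) p ^+ 2 + partial 1 (ax_u g) p ^+ 2
  <= 2 * lap2 (ax_u g) p + 2 * partial 0 (ax_u g) p / p 0 0 - lap2 (ax_alpha g) p.
Proof.
move=> Hn p0; pose q : 'rV[R]_3 := vec3 (p 0 0) (p 0 1) 0.
have qp : half_plane_part q = p.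
  by apply/rowP; case=> [[|[|//]]] ?; rewrite vec2E /= vec3E /=; congr (p _ _); apply/val_inj.
have qr : q 0 0 = p 0 0 by rewrite vec3E.
have q0 : 0 < q 0 0 by rewrite qr.
have := Hn q q0.
have Hc (x : 'rV[R]_3) : 0 < x 0 0 -> 0 < cyl_atoms 1 x.
  by move=> x0; rewrite /= mulr_gt0 ?exprn_gt0 // expR_gt0.
rewrite (@kk_scalar_curvature _ cyl_atoms _ [set q : 'rV[R]_3 | 0 < q 0 0]
  open_rho_gt0 cyl_atoms_derive cyl_metricE (fun x _ => expR_gt0 _) Hc
  (fun x _ => cyl_atoms_k x) q q0) /=.
rewrite qp qr => Hq.
  set a := expR _ in Hq; set c := expR _ in Hq.
  have a0 : 0 < a by exact: expR_gt0.
  have c0 : 0 < c by exact: expR_gt0.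
  set S := (X in - 2 / a * X - _) in Hq.
  have {Hq} : S <= 0.
    rewrite leNgt; apply/negP => S0; move: Hq; apply/negP; rewrite -ltNge.
    rewrite subr_lt0; apply: (@lt_le_trans _ _ 0).
      by rewrite mulNr mulNr oppr_lt0 mulr_gt0 // divr_gt0.
    by rewrite mulr_ge0 ?sqr_ge0 // divr_ge0 ?mulr_ge0 ?sqr_ge0 // ltW.
  rewrite /S /lap2 => {a c a0 c0 S}.
  set u0 := partial 0 (ax_u g) p; set u1 := partial 1 (ax_u g) p => H.
  have p0' : p 0 0 != 0 by rewrite gt_eqF.
  rewrite -subr_ge0 -oppr_le0; apply: le_trans H; rewrite le_eqVlt; apply/orP; left.
  move: p0'; rewrite /u0 /u1 => {u0 u1}.
  move: (p 0 0) (partial 0 (ax_u g) p) (partial 1 (ax_u g) p) => r u0 u1.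
  move: (partial 0 (partial 0 (ax_u g)) p) (partial 1 (partial 1 (ax_u g)) p)
    (partial 0 (partial 0 (ax_alpha g)) p) (partial 1 (partial 1 (ax_alpha g)) p).
  by move=> u00 u11 a00 a11 r0; apply/eqP; field.
Qed.

End cylindrical_curvature.

(** * The radially monotone quantity *)

Section monotonicity.
Context {R : realType}.
Variable g : axisym_data R.
Hypothesis Hs : [/\ smooth (ax_u g), smooth (ax_alpha g), smooth (ax_A g)
        & smooth (ax_B g)].

Lemma sqrt_expR (x : R) : Num.sqrt (expR (2 * x)) = expR x.
Proof. by rewrite expRM_natl sqrtr_sqr gtr0_norm ?expR_gt0. Qed.

(** [|eta| = rho e^(-u)] and [|grad rho| = e^(u - alpha)], so the monotone quantity is the same
    exponential factor that governs areas. *)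
Lemma killing_gradient_ratio (q : 'rV[R]_3) : 0 < q 0 0 ->
  (q 0 0)^-1 * (vector_norm (cyl_metric g) (vec3 0 0 1) q
     / gradient_norm (cyl_metric g) (fun q => q 0 0) q)
  = expR (ax_alpha g (half_plane_part q) - 2 * ax_u g (half_plane_part q)).
Proof.
move=> q0.
have dr (i : 'I_3) : partial i (fun q : 'rV[R]_3 => q 0 0) q = (i == 0)%:R.
  by rewrite /partial; have := is_derive_rho q i => H; rewrite derive_val.
have -> : vector_norm (cyl_metric g) (vec3 0 0 1) q = Num.sqrt (cyl_atoms g 1 q).
  congr Num.sqrt; rewrite !big_ord_recl !big_ord0 !vec3E /=.
  by rewrite !(mulr0, addr0, add0r, mulr1) cyl_metricE mxE.
have -> : gradient_norm (cyl_metric g) (fun q => q 0 0) q = Num.sqrt (cyl_atoms g 0 q)^-1.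
  congr Num.sqrt; transitivity (\sum_(i < 3) \sum_(j < 3)
      invmx (cyl_metric g q) i j * (i == 0)%:R * (j == 0)%:R).
    by apply: eq_bigr => i _; apply: eq_bigr => j _; rewrite !dr.
  rewrite !big_ord_recl !big_ord0 /=.
  by rewrite !(mulr0, addr0, add0r, mulr1) cyl_invmx // mxE.
rewrite /= -expRN -mulrN sqrtrM ?sqr_ge0 // sqrtr_sqr gtr0_norm //.
move: (ax_u g _) (ax_alpha g _) => u al.
have -> : - (2 * al + 2 * - u) = 2 * (u - al) by ring.
rewrite !sqrt_expR -expRN -!mulrA mulKf ?gt_eqF // -expRD; congr expR; ring.
Qed.

Lemma radially_monotone_weight (M : set (axisym_data R)) (rho0 z : R) :
  0 < rho0 -> radially_monotone M rho0 -> M g ->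
  partial 0 (ax_alpha g) (vec2 rho0 z) - 2 * partial 0 (ax_u g) (vec2 rho0 z) <= 0.
Proof.
move=> r0 Hm Mg; have [su sal _ _] := Hs.
pose q : 'rV[R]_3 := vec3 rho0 z 0.
have qr : q 0 0 = rho0 by rewrite vec3E.
have qp : half_plane_part q = vec2 rho0 z by rewrite /half_plane_part !vec3E.
have := Hm g Mg q qr; rewrite /partial.
set w := fun q : 'rV[R]_3 =>
  expR (ax_alpha g (half_plane_part q) - 2 * ax_u g (half_plane_part q)).
rewrite (@near_eq_derive _ _ _ _ w); last first.
  have q0 : 0 < q 0 0 by rewrite qr.
  have := open_nbhs_nbhs (conj (@open_rho_gt0 R) q0).
  by apply: filterS => y y0; exact: killing_gradient_ratio.
have H : is_derive q (delta_mx 0 0) w (expR (ax_alpha g (vec2 rho0 z) - 2 * ax_u g (vec2 rho0 z))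
   * (partial 0 (ax_alpha g) (vec2 rho0 z) - 2 * partial 0 (ax_u g) (vec2 rho0 z))).
  rewrite -qp; apply: is_derive_comp1.
  have h1 := is_derive_hp q 0 sal; have h2 := is_derive_hp q 0 su.
  exact: (is_deriveB h1 (is_deriveZ 2 h2)).
by rewrite derive_val pmulr_rle0 ?expR_gt0.
Qed.

End monotonicity.

(** * Integrals over segments and rectangles *)

Section plane_integrals.
Context {R : realType}.
Notation mu := (@lebesgue_measure R).
Notation mu2 := (mu \x mu)%E.

Notation RT := (measurableTypeR R).
Notation R2 := (RT * RT)%type.

Definition int1 (a b : R) (f : R -> R) : R := \int[mu]_(x in `[a, b]) f x.
Definition int2 (D : set (R * R)) (f : R * R -> R) : R := \int[mu2]_(p in D) f p.
Definition rect (a b c d : R) : set (R * R) := `[a, b] `*` `[c, d].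

(** An open set is the union of the rational boxes that it contains, a countable family of
    measurable rectangles. *)
Lemma open_measurable2 (A : set (R * R)) : open A -> measurable (A : set R2).
Proof.
move=> oA.
pose I : Type := ((rat * rat) * (rat * rat))%type.
pose box (i : I) : set (R * R) :=
  `]ratr i.1.1, ratr i.1.2[%classic `*` `]ratr i.2.1, ratr i.2.2[%classic.
have -> : A = \bigcup_i (if `[< box i `<=` A >] then box i else set0).
  apply/seteqP; split => [[x y] Axy|[x y] [i _]]; last by case: ifPn => // /asboolP; exact.
  have : nbhs (x, y) A by exact: open_nbhs_nbhs.
  move=> /nbhs_ballP[e /= e0 eA].
  have lt1 t : t - e < t by rewrite ltrBlDr ltrDl.
  have lt2 t : t < t + e by rewrite ltrDl.
  have [p1 /[!in_itv]/= /andP[p1x xp1]] := rat_in_itvoo (lt1 x).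
  have [p2 /[!in_itv]/= /andP[p2x xp2]] := rat_in_itvoo (lt2 x).
  have [q1 /[!in_itv]/= /andP[q1y yq1]] := rat_in_itvoo (lt1 y).
  have [q2 /[!in_itv]/= /andP[q2y yq2]] := rat_in_itvoo (lt2 y).
  exists ((p1, p2), (q1, q2)) => //.
  rewrite ifT; first by split; rewrite /= in_itv /=; apply/andP.
  apply/asboolP => -[s t] [] /= /[!in_itv] /= /andP[s1 s2] /andP[t1 t2].
  apply: eA; split; rewrite /ball /= ltr_norml.
    by rewrite ltrBrDl ltrBlDr; apply/andP; split; lra.
  by rewrite ltrBrDl ltrBlDr; apply/andP; split; lra.
apply: countable_bigcupT_measurable; first exact: countableP.
move=> i; case: ifPn => // _; apply: measurableX; exact: measurable_itv.
Qed.

Lemma continuous_measurable_fun2 (f : R * R -> R) :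
  continuous f -> measurable_fun (setT : set R2) (f : R2 -> RT).
Proof.
move=> /continuousP cf; apply: (measurability _ (measurable_realfun.RGenOpens.measurableE R)).
move=> _ [_ [a [b ->] <-]]; rewrite setTI; apply: open_measurable2.
exact/cf/interval_open.
Qed.

Lemma closed_measurable2 (A : set (R * R)) : closed A -> measurable (A : set R2).
Proof.
move=> cA; rewrite -(setCK A); apply: measurableC; apply: open_measurable2.
exact: closed_openC.
Qed.

Lemma measurable_rect a b c d : measurable (rect a b c d : set R2).
Proof. by apply: measurableX; exact: measurable_itv. Qed.

Lemma compact_rect a b c d : compact (rect a b c d).
Proof. by apply: compact_setX; exact: segment_compact. Qed.

Lemma mu2_rect_lty a b c d : (mu2 (rect a b c d) < +oo)%E.
Proof.
have fin s t : (mu `[s, t]%classic < +oo)%E.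
  by rewrite lebesgue_measure_itv /=; case: ifPn => _; rewrite -?EFinB ltry.
have E : mu2 (rect a b c d) = (mu `[a, b]%classic * mu `[c, d]%classic)%E.
  by rewrite product_measure1E //; exact: measurable_itv.
rewrite E; apply: lte_mul_pinfty; [exact: measure_ge0| |exact: fin].
by rewrite ge0_fin_numE //; exact: fin.
Qed.

Lemma integrable_sub_rect (D : set (R * R)) a b c d f : measurable (D : set R2) ->
  D `<=` rect a b c d -> continuous f -> mu2.-integrable (D : set R2) (EFin \o f).
Proof.
move=> mD Dr cf.
apply: (integrableS (measurable_rect a b c d) mD Dr).
apply: measurable_bounded_integrable.
- exact: measurable_rect.
- exact: mu2_rect_lty.
- by apply: measurable_funTS; exact: continuous_measurable_fun2.
- have := @continuous_compact _ _ f (rect a b c d) (continuous_subspaceT cf)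
    (@compact_rect a b c d).
  move=> /compact_bounded[M [Mr MA]]; exists M; split => // x xM.
  by move=> p pr; apply: (MA x xM); exists p.
Qed.

Lemma integrable_seg a b (f : R -> R) : continuous f ->
  mu.-integrable `[a, b] (EFin \o f).
Proof.
move=> cf; apply: continuous_compact_integrable; first exact: segment_compact.
exact: continuous_subspaceT.
Qed.

Lemma ftc_seg (F f : R -> R) (a b : R) : a <= b -> continuous f ->
  (forall x : R, is_derive x (1 : R) F (f x)) -> int1 a b f = F b - F a.
Proof.
rewrite le_eqVlt => /predU1P[<-|ab] cf dF.
  by rewrite /int1 set_itv1 Rintegral_set1 subrr.
have cF : continuous F.
  by move=> x; apply: differentiable_continuous; apply/derivable1_diffP; case: (dF x).
rewrite /int1 /Rintegral (@continuous_FTC2 _ f F) //.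
- exact: continuous_subspaceT.
- split; first by move=> x _; case: (dF x).
  + by apply: cvg_at_right_filter; exact: cF.
  + by apply: cvg_at_left_filter; exact: cF.
- by move=> x _; rewrite derive1E; case: (dF x).
Qed.

Lemma integral_seg (a b : R) (f : R -> R) : continuous f ->
  (\int[mu]_(x in `[a, b]) (f x)%:E)%E = (int1 a b f)%:E.
Proof.
by move=> cf; rewrite fineK //; apply: integrable_fin_num => //; exact: integrable_seg.
Qed.

Lemma continuous_slice_x (f : R * R -> R) (y : R) : continuous f -> continuous (fun x => f (x, y)).
Proof.
move=> cf x; have H : (x', y) @[x' --> x] --> (x, y).
  have h1 : (fun x' : R => x') x' @[x' --> x] --> x by exact: cvg_id.
  have h2 : y @[_ --> x] --> y by exact: cvg_cst.
  have H := cvg_pair h1 h2; exact: H.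
exact: (cvg_comp _ _ H (cf (x, y))).
Qed.

Lemma continuous_slice_y (f : R * R -> R) (x : R) : continuous f -> continuous (fun y => f (x, y)).
Proof.
move=> cf y; have H : (x, y') @[y' --> y] --> (x, y).
  have h1 : (fun y' : R => y') y' @[y' --> y] --> y by exact: cvg_id.
  have h2 : x @[_ --> y] --> x by exact: cvg_cst.
  have H := cvg_pair h2 h1; exact: H.
exact: (cvg_comp _ _ H (cf (x, y))).
Qed.

(** Fubini for the extension of [f] by zero outside [D], whose horizontal slices are segments or
    empty. *)
Lemma int2_iter_x (D : set (R * R)) (f : R * R -> R) c d (phi psi : R -> R) :
  measurable (D : set R2) -> mu2.-integrable (D : set R2) (EFin \o f) -> continuous f ->
  (forall x y, D (x, y) <-> (c <= y <= d /\ phi y <= x <= psi y)) ->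
  int2 D f = int1 c d (fun y => int1 (phi y) (psi y) (fun x => f (x, y))).
Proof.
move=> mD iD cf DE; rewrite {1}/int2 /Rintegral integral_mkcond.
have iD' := proj1 (integrable_mkcond (mu := mu2) (EFin \o f) mD) iD.
rewrite -(integral21_prod_meas1 iD'); congr fine.
rewrite [RHS]integral_mkcond; apply: eq_integral => y _.
rewrite /fubini_G patchE; case: ifPn => [|] ycd.
- rewrite -integral_seg; last exact: continuous_slice_x.
  rewrite [RHS]integral_mkcond; apply: eq_integral => x _.
  rewrite !patchE; move: ycd; rewrite inE /= in_itv /= => ycd.
  have -> : ((x, y) \in D) = (x \in `[phi y, psi y]%classic); last by [].
  apply/idP/idP; rewrite !inE /= in_itv /= => H; first by move/DE: H => [].
  by apply/DE.
- rewrite integral0_eq // => x _; rewrite patchE ifF //; apply/negbTE/negP.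
  rewrite inE => /DE[yc _]; move/negP: ycd; apply; rewrite inE /= in_itv /=.
  exact: yc.
Qed.

Lemma int2_iter_y (D : set (R * R)) (f : R * R -> R) a b (phi psi : R -> R) :
  measurable (D : set R2) -> mu2.-integrable (D : set R2) (EFin \o f) -> continuous f ->
  (forall x y, D (x, y) <-> (a <= x <= b /\ phi x <= y <= psi x)) ->
  int2 D f = int1 a b (fun x => int1 (phi x) (psi x) (fun y => f (x, y))).
Proof.
move=> mD iD cf DE; rewrite {1}/int2 /Rintegral integral_mkcond.
have iD' := proj1 (integrable_mkcond (mu := mu2) (EFin \o f) mD) iD.
rewrite -(integral12_prod_meas1 iD'); congr fine.
rewrite [RHS]integral_mkcond; apply: eq_integral => x _.
rewrite /fubini_F patchE; case: ifPn => [|] xab.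
- rewrite -integral_seg; last exact: continuous_slice_y.
  rewrite [RHS]integral_mkcond; apply: eq_integral => y _.
  rewrite !patchE; move: xab; rewrite inE /= in_itv /= => xab.
  have -> : ((x, y) \in D) = (y \in `[phi x, psi x]%classic); last by [].
  apply/idP/idP; rewrite !inE /= in_itv /= => H; first by move/DE: H => [].
  by apply/DE.
- rewrite integral0_eq // => y _; rewrite patchE ifF //; apply/negbTE/negP.
  rewrite inE => /DE[yc _]; move/negP: xab; apply; rewrite inE /= in_itv /=.
  exact: yc.
Qed.

Lemma eq_int1 (a b : R) (f h : R -> R) : (forall x, a <= x <= b -> f x = h x) ->
  int1 a b f = int1 a b h.
Proof.
move=> fh; apply: eq_Rintegral => x; rewrite inE /= in_itv /=; exact: fh.
Qed.

(** One half of Gauss's theorem: Fubini, then the fundamental theorem of calculus on each slice. *)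
Lemma int2_dx (D : set (R * R)) (F F1 : R * R -> R) c d (phi psi : R -> R) :
  measurable (D : set R2) -> mu2.-integrable (D : set R2) (EFin \o F1) -> continuous F1 ->
  (forall x y, D (x, y) <-> (c <= y <= d /\ phi y <= x <= psi y)) ->
  (forall y, c <= y <= d -> phi y <= psi y) ->
  (forall x y : R, is_derive x (1 : R) (fun x => F (x, y)) (F1 (x, y))) ->
  int2 D F1 = int1 c d (fun y => F (psi y, y) - F (phi y, y)).
Proof.
move=> mD iD cF DE pp dF; rewrite (int2_iter_x mD iD cF DE).
apply: eq_int1 => y ycd.
rewrite (@ftc_seg (fun x => F (x, y)) (fun x => F1 (x, y))) //; first exact: pp.
exact: continuous_slice_x.
Qed.

Lemma int2_dy (D : set (R * R)) (F F1 : R * R -> R) a b (phi psi : R -> R) :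
  measurable (D : set R2) -> mu2.-integrable (D : set R2) (EFin \o F1) -> continuous F1 ->
  (forall x y, D (x, y) <-> (a <= x <= b /\ phi x <= y <= psi x)) ->
  (forall x, a <= x <= b -> phi x <= psi x) ->
  (forall x y : R, is_derive y (1 : R) (fun y => F (x, y)) (F1 (x, y))) ->
  int2 D F1 = int1 a b (fun x => F (x, psi x) - F (x, phi x)).
Proof.
move=> mD iD cF DE pp dF; rewrite (int2_iter_y mD iD cF DE).
apply: eq_int1 => x xab.
rewrite (@ftc_seg (fun y => F (x, y)) (fun y => F1 (x, y))) //; first exact: pp.
exact: continuous_slice_y.
Qed.

Lemma le_int1 (a b : R) (f h : R -> R) : continuous f -> continuous h ->
  (forall x, a <= x <= b -> f x <= h x) -> int1 a b f <= int1 a b h.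
Proof.
move=> cf ch fh; apply: le_Rintegral; [exact: measurable_itv|exact: integrable_seg..|].
by move=> x; rewrite /= in_itv /=; exact: fh.
Qed.

Lemma int1_cst (a b k : R) : a <= b -> int1 a b (cst k) = k * (b - a).
Proof.
move=> ab; have H (x : R) : is_derive x (1 : R) (fun x => k * x) (cst k x).
  have := is_deriveZ k (is_derive_id x (1 : R)).
  by rewrite [k *: 1]mulr1.
by rewrite (@ftc_seg (fun x => k * x) (cst k)) // ?mulrBr // => x; exact: cvg_cst.
Qed.

Lemma int1_le_cst (a b k : R) (f : R -> R) : a <= b -> continuous f ->
  (forall x, a <= x <= b -> f x <= k) -> int1 a b f <= k * (b - a).
Proof.
move=> ab cf fk; rewrite -int1_cst //; apply: le_int1 => //.
by move=> x; exact: cvg_cst.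
Qed.

Lemma int1D (a b : R) (f h : R -> R) : continuous f -> continuous h ->
  int1 a b (fun x => f x + h x) = int1 a b f + int1 a b h.
Proof. by move=> cf ch; apply: RintegralD; [exact: measurable_itv|exact: integrable_seg..]. Qed.

Lemma int1B (a b : R) (f h : R -> R) : continuous f -> continuous h ->
  int1 a b (fun x => f x - h x) = int1 a b f - int1 a b h.
Proof. by move=> cf ch; apply: RintegralB; [exact: measurable_itv|exact: integrable_seg..]. Qed.

Lemma int1Z (a b k : R) (f : R -> R) : continuous f ->
  int1 a b (fun x => k * f x) = k * int1 a b f.
Proof. by move=> cf; apply: RintegralZl; [exact: measurable_itv|exact: integrable_seg]. Qed.

Lemma integrable_rect a b c d (f : R * R -> R) : continuous f ->
  mu2.-integrable (rect a b c d : set R2) (EFin \o f).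
Proof.
move=> cf.
exact: (integrable_sub_rect (measurable_rect a b c d) (@subset_refl _ (rect a b c d)) cf).
Qed.

Lemma le_int2 a b c d (f h : R * R -> R) : continuous f -> continuous h ->
  (forall x y, a <= x <= b -> c <= y <= d -> f (x, y) <= h (x, y)) ->
  int2 (rect a b c d) f <= int2 (rect a b c d) h.
Proof.
move=> cf ch fh; apply: le_Rintegral; [exact: measurable_rect|exact: integrable_rect..|].
by move=> [x y] [] /=; rewrite !in_itv /=; exact: fh.
Qed.

Lemma int2D a b c d (f h : R * R -> R) : continuous f -> continuous h ->
  int2 (rect a b c d) (fun p => f p + h p) = int2 (rect a b c d) f + int2 (rect a b c d) h.
Proof. by move=> cf ch; apply: RintegralD; [exact: measurable_rect|exact: integrable_rect..]. Qed.

Lemma int2Z a b c d k (f : R * R -> R) : continuous f ->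
  int2 (rect a b c d) (fun p => k * f p) = k * int2 (rect a b c d) f.
Proof. by move=> cf; rewrite /int2 RintegralZl //; [exact: measurable_rect|exact: integrable_rect]. Qed.

Lemma rectE a b c d x y : rect a b c d (x, y) <-> (a <= x <= b /\ c <= y <= d).
Proof. by rewrite /rect /= !in_itv. Qed.

Lemma rect_dx a b c d (F F1 : R * R -> R) : a <= b -> continuous F1 ->
  (forall x y : R, is_derive x (1 : R) (fun x => F (x, y)) (F1 (x, y))) ->
  int2 (rect a b c d) F1 = int1 c d (fun y => F (b, y) - F (a, y)).
Proof.
move=> ab cF dF; apply: (@int2_dx _ F _ _ _ (cst a) (cst b)) => //.
- exact: measurable_rect.
- exact: integrable_rect.
- by move=> x y; rewrite rectE; split=> -[].
Qed.

Lemma rect_dy a b c d (F F1 : R * R -> R) : c <= d -> continuous F1 ->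
  (forall x y : R, is_derive y (1 : R) (fun y => F (x, y)) (F1 (x, y))) ->
  int2 (rect a b c d) F1 = int1 a b (fun x => F (x, d) - F (x, c)).
Proof.
move=> ab cF dF; apply: (@int2_dy _ F _ _ _ (cst c) (cst d)) => //.
- exact: measurable_rect.
- exact: integrable_rect.
Qed.

End plane_integrals.

(** * Continuity and derivatives of explicit expressions *)

Section pointwise_calculus.
Context {R : realType} {T : topologicalType} {V : normedModType R}.

Lemma cont_cst (k : R) : continuous (fun _ : T => k).
Proof. by move=> x; exact: cvg_cst. Qed.

Lemma cont_add (f h : T -> R) : continuous f -> continuous h ->
  continuous (fun x => f x + h x).
Proof. by move=> cf ch x; exact: (cvgD (cf x) (ch x)). Qed.

Lemma cont_opp (f : T -> R) : continuous f -> continuous (fun x => - f x).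
Proof. by move=> cf x; exact: (cvgN (cf x)). Qed.

Lemma cont_mul (f h : T -> R) : continuous f -> continuous h ->
  continuous (fun x => f x * h x).
Proof. by move=> cf ch x; exact: (cvgM (cf x) (ch x)). Qed.

Lemma cont_exp (f : T -> R) n : continuous f -> continuous (fun x => f x ^+ n).
Proof.
move=> cf; elim: n => [|n IH]; first exact: cont_cst.
by under eq_fun do rewrite exprS; exact: cont_mul.
Qed.

Lemma cont_comp (phi : R -> R) (f : T -> R) : continuous phi -> continuous f ->
  continuous (fun x => phi (f x)).
Proof. by move=> cp cf x; exact: (cvg_comp _ _ (cf x) (cp (f x))). Qed.

Lemma cont_norm (f : T -> R) : continuous f -> continuous (fun x => `|f x|).
Proof. by move=> cf x; exact: (cvg_norm (cf x)). Qed.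

Lemma cont_inv (f : T -> R) : (forall x, f x != 0) -> continuous f ->
  continuous (fun x => (f x)^-1).
Proof. by move=> f0 cf x; exact: (cvgV (f0 x) (cf x)). Qed.

Lemma is_derive_cstf (k : R) (x v : V) : is_derive x v (fun _ => k) 0.
Proof. exact: is_derive_cst. Qed.

Lemma is_derive_add (f h : V -> R) (x v : V) df dh :
  is_derive x v f df -> is_derive x v h dh -> is_derive x v (fun y => f y + h y) (df + dh).
Proof. by move=> hf hh; exact: (is_deriveD hf hh). Qed.

Lemma is_derive_sub (f h : V -> R) (x v : V) df dh :
  is_derive x v f df -> is_derive x v h dh -> is_derive x v (fun y => f y - h y) (df - dh).
Proof. by move=> hf hh; exact: (is_deriveB hf hh). Qed.

Lemma is_derive_opp (f : V -> R) (x v : V) df :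
  is_derive x v f df -> is_derive x v (fun y => - f y) (- df).
Proof. by move=> hf; exact: (is_deriveN hf). Qed.

Lemma is_derive_mul (f h : V -> R) (x v : V) df dh :
  is_derive x v f df -> is_derive x v h dh ->
  is_derive x v (fun y => f y * h y) (f x * dh + h x * df).
Proof. by move=> hf hh; exact: (is_deriveM hf hh). Qed.

Lemma is_derive_scale (k : R) (f : V -> R) (x v : V) df :
  is_derive x v f df -> is_derive x v (fun y => k * f y) (k * df).
Proof. by move=> hf; exact: (is_deriveZ k hf). Qed.

Lemma is_derive_sqr (f : V -> R) (x v : V) df :
  is_derive x v f df -> is_derive x v (fun y => f y ^+ 2) (2 * f x * df).
Proof.
by move=> hf; apply: (is_derive_eq (is_derive_mul hf hf)); ring.
Qed.

End pointwise_calculus.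

Ltac cont := repeat lazymatch goal with
  | |- continuous (fun _ => ?k) => exact: cont_cst
  | |- continuous (fun x => @?f x + @?h x) => apply: (@cont_add _ _ f h)
  | |- continuous (fun x => @?f x * @?h x) => apply: (@cont_mul _ _ f h)
  | |- continuous (fun x => - @?f x) => apply: (@cont_opp _ _ f)
  | |- continuous (fun x => @?f x ^+ ?n) => apply: (@cont_exp _ _ f n)
  | |- continuous (fun x => `| @?f x |) => apply: (@cont_norm _ _ f)
  | |- _ => assumption
  end.

Section plane_functions.
Context {R : realType}.

Lemma cont_fst : continuous (fun p : R * R => p.1).
Proof. by move=> p; exact: cvg_fst. Qed.

Lemma cont_snd : continuous (fun p : R * R => p.2).
Proof. by move=> p; exact: cvg_snd. Qed.

(** The product measure lives on pairs, the metric functions and their partial derivatives on row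
    vectors; [on2] passes from the latter to the former. *)
Definition on2 (f : 'rV[R]_2 -> R) (p : R * R) : R := f (vec2 p.1 p.2).

Lemma vec2_continuous : continuous (fun p : R * R => vec2 p.1 p.2).
Proof.
have -> : (fun p : R * R => vec2 p.1 p.2) = (fun p => p.1 *: vec2 1 0 + p.2 *: vec2 0 1).
  apply/funext => p; apply/rowP; case=> [[|[|//]]] ?; rewrite !mxE /=.
    by rewrite mulr1 mulr0 addr0.
  by rewrite mulr1 mulr0 add0r.
move=> p.
have h1 : (q.1 *: (vec2 1 0 : 'rV[R]_2)) @[q --> p] --> p.1 *: (vec2 1 0 : 'rV[R]_2).
  by apply: cvgZr_tmp; exact: cont_fst.
have h2 : (q.2 *: (vec2 0 1 : 'rV[R]_2)) @[q --> p] --> p.2 *: (vec2 0 1 : 'rV[R]_2).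
  by apply: cvgZr_tmp; exact: cont_snd.
exact: cvgD h1 h2.
Qed.

Lemma cont_on2 (f : 'rV[R]_2 -> R) : smooth f -> continuous (on2 f).
Proof.
move=> sf p.
have cf : continuous f by exact: smooth_continuous.
exact: continuous_comp (@vec2_continuous p) (cf (vec2 p.1 p.2)).
Qed.

Lemma is_derive_on2 (f : 'rV[R]_2 -> R) (x y : R) : smooth f ->
  is_derive x (1 : R) (fun x => on2 f (x, y)) (on2 (partial 0 f) (x, y)) /\
  is_derive y (1 : R) (fun y => on2 f (x, y)) (on2 (partial 1 f) (x, y)).
Proof.
move=> sf; rewrite /on2 /=; split.
- have := @is_derive_chain R 1 _ f (fun x => vec2 x y) x 1 (vec2 1 0) (smooth_differentiable _ sf).
  rewrite !big_ord_recl big_ord0 addr0 !vec2E /= mulr0 mulr1 addr0; apply.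
  case=> [[|[|//]]] ?; rewrite vec2E /=; under eq_fun do rewrite vec2E /=.
    exact: is_derive_id.
  exact: is_derive_cst.
- have := @is_derive_chain R 1 _ f (fun y => vec2 x y) y 1 (vec2 0 1) (smooth_differentiable _ sf).
  rewrite !big_ord_recl big_ord0 addr0 !vec2E /= mulr0 mulr1 add0r.
  have -> : lift ord0 ord0 = 1 :> 'I_2 by apply/val_inj.
  apply; case=> [[|[|//]]] ?; rewrite vec2E /=; under eq_fun do rewrite vec2E /=.
    exact: is_derive_cst.
  exact: is_derive_id.
Qed.

Lemma is_derive_on2x (f : 'rV[R]_2 -> R) (x y : R) : smooth f ->
  is_derive x (1 : R) (fun x => on2 f (x, y)) (on2 (partial 0 f) (x, y)).
Proof. by move=> /(is_derive_on2 x y)[]. Qed.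

Lemma is_derive_on2y (f : 'rV[R]_2 -> R) (x y : R) : smooth f ->
  is_derive y (1 : R) (fun y => on2 f (x, y)) (on2 (partial 1 f) (x, y)).
Proof. by move=> /(is_derive_on2 x y)[]. Qed.

End plane_functions.

(** * Substitution in one-variable integrals *)

Section substitution.
Context {R : realType}.
Notation mu := (@lebesgue_measure R).

Lemma is_derive_continuous (F f : R -> R) : (forall x : R, is_derive x (1 : R) F (f x)) ->
  continuous F.
Proof.
by move=> dF x; apply: differentiable_continuous; apply/derivable1_diffP; case: (dF x).
Qed.

(** The primitive starts at [c] and is shown to be differentiable to its right only; [c] is to be
    placed below the range of integration. *)
Lemma antiderivative (h : R -> R) (c : R) : continuous h ->
  exists H : R -> R, (forall a b, c < a -> a <= b -> int1 a b h = H b - H a) /\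
    (forall x : R, c < x -> is_derive x (1 : R) H (h x)).
Proof.
move=> ch; exists (fun x => int1 c x h).
have dH (x : R) : c < x -> is_derive x (1 : R) (fun x => int1 c x h) (h x).
  move=> cx; have xx : x < x + 1 by rewrite ltrDl.
  have [dx Dx] := @continuous_FTC1_closed R h c x (x + 1) xx
    (integrable_seg _ _ ch) cx (ch x).
  by split; [exact: dx|rewrite -derive1E; exact: Dx].
split=> // a b ca; rewrite le_eqVlt => /predU1P[<-|ab].
  by rewrite subrr /int1 set_itv1 Rintegral_set1.
rewrite /int1 [LHS]/Rintegral (@continuous_FTC2 _ h (fun x => int1 c x h)) //.
- exact: continuous_subspaceT.
- split.
  + by move=> x; rewrite in_itv /= => /andP[ax _]; case: (dH x (lt_trans ca ax)).
  + apply: cvg_at_right_filter; apply: differentiable_continuous; apply/derivable1_diffP.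
    by case: (dH a ca).
  + apply: cvg_at_left_filter; apply: differentiable_continuous; apply/derivable1_diffP.
    by case: (dH b (lt_trans ca ab)).
- move=> x; rewrite in_itv /= => /andP[ax _]; rewrite derive1E.
  by case: (dH x (lt_trans ca ax)).
Qed.

(** Both sides are increments of a primitive of [h], so [F] may be non-monotone between [a] and [b].
    There are two cases because [int1] integrates over a set and carries no orientation. *)
Lemma int1_subst (F f h : R -> R) (a b : R) : a <= b -> continuous f -> continuous h ->
  (forall x : R, is_derive x (1 : R) F (f x)) ->
  (F a <= F b -> int1 (F a) (F b) h = int1 a b (fun t => h (F t) * f t)) /\
  (F b <= F a -> int1 (F b) (F a) h = - int1 a b (fun t => h (F t) * f t)).
Proof.
move=> ab cf ch dF.
have cF := is_derive_continuous dF.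
(* The primitive is based one unit below the minimum of [F], so that all values of [F] on the
   segment lie where it is differentiable. *)
have [t0 t0ab Ft0] := @EVT_min R F a b ab (continuous_subspaceT cF).
have [H [HI dH]] := antiderivative (F t0 - 1) ch.
have cFt (t : R) : a <= t <= b -> F t0 - 1 < F t.
  move=> tab; apply: lt_le_trans (Ft0 t _); last by rewrite in_itv.
  by rewrite ltrBlDr ltrDl.
have Fa : F t0 - 1 < F a by apply: cFt; rewrite lexx.
have Fb : F t0 - 1 < F b by apply: cFt; rewrite ab lexx.
have E : int1 a b (fun t => h (F t) * f t) = H (F b) - H (F a).
  move: ab; rewrite le_eqVlt => /predU1P[<-|ab].
    by rewrite subrr /int1 set_itv1 Rintegral_set1.
  have dHF (x : R) : a <= x <= b -> is_derive x (1 : R) (H \o F) (h (F x) * f x).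
    by move=> /cFt xc; apply: is_derive1_comp; exact: dH.
  have ax : a <= a <= b by rewrite lexx ltW.
  have bx : a <= b <= b by rewrite lexx ltW.
  rewrite /int1 /Rintegral (@continuous_FTC2 _ (fun t => h (F t) * f t) (H \o F)) //.
  - by apply: continuous_subspaceT; apply: cont_mul => //; exact: cont_comp.
  - split.
    + move=> x; rewrite in_itv /= => /andP[ax' xb].
      by case: (dHF x); rewrite ?(ltW ax') ?(ltW xb).
    + apply: cvg_at_right_filter; apply: differentiable_continuous; apply/derivable1_diffP.
      by case: (dHF a ax).
    + apply: cvg_at_left_filter; apply: differentiable_continuous; apply/derivable1_diffP.
      by case: (dHF b bx).
  - move=> x; rewrite in_itv /= => /andP[ax' xb]; rewrite derive1E.
    by case: (dHF x); rewrite ?(ltW ax') ?(ltW xb).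
by split=> FF; rewrite E HI // opprB.
Qed.

Lemma int1_split (a b c : R) (f : R -> R) : a <= b -> b <= c -> continuous f ->
  int1 a c f = int1 a b f + int1 b c f.
Proof.
move=> ab bc cf; have [H [HI _]] := antiderivative (a - 1) cf.
have a1 : a - 1 < a by rewrite ltrBlDr ltrDl.
rewrite !HI ?(le_trans ab bc) // ?(lt_le_trans a1 ab) //; ring.
Qed.

End substitution.

(** * The divergence theorem on half discs *)

Section half_disc.
Context {R : realType}.
Notation mu := (@lebesgue_measure R).
Notation mu2 := (mu \x mu)%E.
Notation R2 := (measurableTypeR R * measurableTypeR R)%type.

Definition half_disc (r : R) : set (R * R) :=
  [set p | 0 <= p.1 /\ p.1 ^+ 2 + p.2 ^+ 2 <= r ^+ 2].

Lemma half_disc_closed r : closed (half_disc r).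
Proof.
have -> : half_disc r = [set p | 0 <= p.1] `&` [set p | p.1 ^+ 2 + p.2 ^+ 2 <= r ^+ 2] by [].
apply: closedI.
  exact: (closed_comp (fun x _ => @cont_fst R x) (@closed_ge _ 0)).
have cf : continuous (fun p : R * R => p.1 ^+ 2 + p.2 ^+ 2).
  by apply: cont_add; apply: cont_exp; [exact: cont_fst|exact: cont_snd].
exact: (closed_comp (fun x _ => cf x) (@closed_le _ (r ^+ 2))).
Qed.

Lemma measurable_half_disc r : measurable (half_disc r : set R2).
Proof. exact: (closed_measurable2 (@half_disc_closed r)). Qed.

Lemma half_disc_rect r : 0 <= r -> half_disc r `<=` rect 0 r (- r) r.
Proof.
move=> r0 [x y] [/= x0 xy]; apply/rectE; rewrite x0 -ler_norml /=; split.
  rewrite -(@ler_pXn2r _ 2) ?nnegrE //; apply: le_trans xy.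
  by rewrite lerDl sqr_ge0.
rewrite -(@ler_pXn2r _ 2) ?nnegrE // real_normK ?num_real //; apply: le_trans xy.
by rewrite lerDr sqr_ge0.
Qed.

Lemma sqr_le_sqr (x r : R) : 0 <= r -> (x ^+ 2 <= r ^+ 2) = (- r <= x <= r).
Proof.
by move=> r0; rewrite -ler_norml -(real_normK (num_real x)) ler_pXn2r ?nnegrE.
Qed.

Lemma half_discE_x r x y : 0 <= r ->
  half_disc r (x, y) <-> (- r <= y <= r /\ 0 <= x <= Num.sqrt (r ^+ 2 - y ^+ 2)).
Proof.
move=> r0; rewrite /half_disc /=; split=> [[x0 xy]|[yr /andP[x0 xs]]].
  have yr : y ^+ 2 <= r ^+ 2 by apply: le_trans xy; rewrite lerDr sqr_ge0.
  rewrite -sqr_le_sqr // yr x0 /= -(@ler_pXn2r _ 2) ?nnegrE ?sqrtr_ge0 //.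
  by rewrite sqr_sqrtr ?subr_ge0 // lerBrDr.
have yr2 : y ^+ 2 <= r ^+ 2 by rewrite sqr_le_sqr.
split=> //; move: xs; rewrite -(@ler_pXn2r _ 2) ?nnegrE ?sqrtr_ge0 //.
by rewrite sqr_sqrtr ?subr_ge0 // lerBrDr.
Qed.

Lemma half_discE_y r x y : 0 <= r ->
  half_disc r (x, y) <->
  (0 <= x <= r /\ - Num.sqrt (r ^+ 2 - x ^+ 2) <= y <= Num.sqrt (r ^+ 2 - x ^+ 2)).
Proof.
move=> r0; rewrite /half_disc /=; split=> [[x0 xy]|[/andP[x0 xr] ys]].
  have yr : x ^+ 2 <= r ^+ 2 by apply: le_trans xy; rewrite lerDl sqr_ge0.
  rewrite x0 /=; move: (yr); rewrite sqr_le_sqr // => /andP[_ ->].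
  by rewrite -sqr_le_sqr ?sqrtr_ge0 // sqr_sqrtr ?subr_ge0 // lerBrDl.
have yr : x ^+ 2 <= r ^+ 2 by rewrite sqr_le_sqr // xr andbT (le_trans _ x0) // oppr_le0.
split=> //; move: ys; rewrite -sqr_le_sqr ?sqrtr_ge0 // sqr_sqrtr ?subr_ge0 //.
by rewrite lerBrDl.
Qed.

Lemma cont_cos_arg r : continuous (fun t : R => r * cos t).
Proof. by apply: cont_mul; [exact: cont_cst|exact: continuous_cos]. Qed.

Lemma cont_sin_arg r : continuous (fun t : R => r * sin t).
Proof. by apply: cont_mul; [exact: cont_cst|exact: continuous_sin]. Qed.

Lemma sqrt_circle_sin (r t : R) : 0 <= r -> 0 <= sin t ->
  Num.sqrt (r ^+ 2 - (r * cos t) ^+ 2) = r * sin t.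
Proof.
move=> r0 s0; have -> : r ^+ 2 - (r * cos t) ^+ 2 = (r * sin t) ^+ 2.
  by rewrite !exprMn sin2cos2; ring.
by rewrite sqrtr_sqr ger0_norm // mulr_ge0.
Qed.

Lemma sqrt_circle_cos (r t : R) : 0 <= r ->
  Num.sqrt (r ^+ 2 - (r * sin t) ^+ 2) = `|r * cos t|.
Proof.
move=> r0; have -> : r ^+ 2 - (r * sin t) ^+ 2 = (r * cos t) ^+ 2.
  by rewrite !exprMn cos2sin2; ring.
by rewrite sqrtr_sqr.
Qed.

Lemma cont_pair (T : topologicalType) (F : R * R -> R) (f h : T -> R) : continuous F ->
  continuous f -> continuous h -> continuous (fun t => F (f t, h t)).
Proof.
move=> cF cf ch t; have H := cvg_pair (cf t) (ch t).
have cG : {for t, continuous (fun t => (f t, h t))} by exact: H.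
exact: (continuous_comp cG (cF _)).
Qed.

(* Green's theorem on the half disc, with the boundary arc parametrised by the
   angle from the axis. *)
Lemma half_disc_div (Wr Wz Wr1 Wz2 : R * R -> R) (r : R) : 0 <= r ->
  continuous Wr -> continuous Wz -> continuous Wr1 -> continuous Wz2 ->
  (forall x y : R, is_derive x (1 : R) (fun x => Wr (x, y)) (Wr1 (x, y))) ->
  (forall x y : R, is_derive y (1 : R) (fun y => Wz (x, y)) (Wz2 (x, y))) ->
  (forall y, Wr (0, y) = 0) ->
  int2 (half_disc r) (fun p => Wr1 p + Wz2 p) =
  int1 0 pi (fun t => Wr (r * sin t, r * cos t) * (r * sin t)
                      + Wz (r * sin t, r * cos t) * (r * cos t)).
Proof.
move=> r0 cWr cWz cWr1 cWz2 dWr dWz Wr0.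
have mD := measurable_half_disc r.
have iD F (cF : continuous F) := integrable_sub_rect mD (@half_disc_rect r r0) cF.
have pi0 := pi_gt0 R.
have -> : int2 (half_disc r) (fun p => Wr1 p + Wz2 p)
    = int2 (half_disc r) Wr1 + int2 (half_disc r) Wz2.
  by rewrite /int2 (RintegralD mD (iD _ cWr1) (iD _ cWz2)).
have cs : continuous (fun y : R => Num.sqrt (r ^+ 2 - y ^+ 2)).
  apply: (cont_comp (@sqrt_continuous R)).
  by apply: cont_add; [exact: cont_cst|apply: cont_opp; apply: cont_exp => x; exact: cvg_id].
have cid : continuous (fun x : R => x) by move=> x; exact: cvg_id.
have hx (y : R) : - r <= y <= r -> cst 0 y <= Num.sqrt (r ^+ 2 - y ^+ 2).
  by move=> _; exact: sqrtr_ge0.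
have hy (x : R) : 0 <= x <= r -> - Num.sqrt (r ^+ 2 - x ^+ 2) <= Num.sqrt (r ^+ 2 - x ^+ 2).
  by move=> _; rewrite ge0_cp // sqrtr_ge0.
rewrite (int2_dx mD (iD _ cWr1) cWr1 (fun x y => half_discE_x x y r0) hx dWr).
rewrite (int2_dy mD (iD _ cWz2) cWz2 (fun x y => half_discE_y x y r0) hy dWz).
have ccs := @cont_cos_arg r; have csn := @cont_sin_arg r.
have cWrt : continuous (fun t => Wr (r * sin t, r * cos t)) by exact: cont_pair.
have cWzt : continuous (fun t => Wz (r * sin t, r * cos t)) by exact: cont_pair.
have cWrt' := cont_mul cWrt csn; have cWzt' := cont_mul cWzt ccs.
rewrite (int1D _ _ cWrt' cWzt'); congr (_ + _).
- have dc (t : R) : is_derive t (1 : R) (fun t => r * cos t) (- (r * sin t)).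
    by apply: (is_derive_eq (is_derive_scale r (@is_derive_cos R t))); rewrite mulrN.
  have ch : continuous (fun y : R => Wr (Num.sqrt (r ^+ 2 - y ^+ 2), y)) by exact: cont_pair.
  (* [y = r cos t] runs downwards from [r] to [- r], hence the reversed orientation; the inner
     boundary drops out because [Wr] vanishes on the axis. *)
  have [_] := int1_subst (ltW pi0) (cont_opp csn) ch dc.
  rewrite cos0 cospi mulr1 mulrN1 => /(_ (ge0_cp r0).2) H.
  have -> : int1 (- r) r (fun y => Wr (Num.sqrt (r ^+ 2 - y ^+ 2), y) - Wr (cst 0 y, y))
     = int1 (- r) r (fun y => Wr (Num.sqrt (r ^+ 2 - y ^+ 2), y)).
    by apply: eq_int1 => y _; rewrite Wr0 subr0.
  rewrite H -[LHS]mulN1r -int1Z; last first.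
    by apply: cont_mul; [exact: (cont_comp ch ccs)|exact: cont_opp].
  apply: eq_int1 => t tpi; rewrite sqrt_circle_sin //; first by ring.
  exact: sin_ge0_pi.
- have p20 : 0 <= (pi : R) / 2 by rewrite divr_ge0 // ltW.
  have p2p : (pi : R) / 2 <= pi by rewrite ler_pdivrMr // ler_pMr // ler1n.
  have ds (t : R) : is_derive t (1 : R) (fun t => r * sin t) (r * cos t).
    exact: (is_derive_scale r (@is_derive_sin R t)).
  have cNs : continuous (fun x : R => - Num.sqrt (r ^+ 2 - x ^+ 2)) by apply: cont_opp.
  have ch1 : continuous (fun x : R => Wz (x, Num.sqrt (r ^+ 2 - x ^+ 2))) by exact: cont_pair.
  have ch2 : continuous (fun x : R => Wz (x, - Num.sqrt (r ^+ 2 - x ^+ 2))) by exact: cont_pair.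
  rewrite int1B // (int1_split p20 p2p); last exact: cWzt'.
  (* [x = r sin t] increases along the upper quarter of the arc and decreases along the lower one,
     where [cos t <= 0]: the reversed orientation there matches the minus sign of the lower boundary
     term. *)
  have [H1 _] := int1_subst p20 ccs ch1 ds.
  have [_ H2] := int1_subst p2p ccs ch2 ds.
  move: H1 H2; rewrite sin0 sinpi sin_pihalf mulr0 mulr1 => /(_ r0) -> /(_ r0) ->.
  rewrite opprK; congr (_ + _); apply: eq_int1 => t /andP[t1 t2].
    rewrite sqrt_circle_cos // ger0_norm // mulr_ge0 // cos_ge0_pihalf //.
    by rewrite t2 andbT (le_trans _ t1) // oppr_le0.
  rewrite sqrt_circle_cos // ler0_norm ?opprK // mulr_ge0_le0 //.
  rewrite -(subrK pi t) cosDpi oppr_le0 cos_ge0_pihalf //.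
  by apply/andP; split; lra.
Qed.

End half_disc.

(** * The ADM mass bound *)

Lemma sum_ord3 (V : nmodType) (F : 'I_3 -> V) : \sum_i F i = F 0 + F 1 + F 2.
Proof.
rewrite !big_ord_recl big_ord0 addr0 addrA.
by congr (F _ + F _ + F _); apply/val_inj.
Qed.

(** The ADM contraction is invariant under orthogonal changes of frame. [X l] are the Cartesian
    derivatives of the metric, and [T a] expresses them in the frame [N], both in the components and
    in the direction of differentiation. *)
Lemma frame_contraction (R : realType) (N : 'M[R]_3) (T X : 'I_3 -> 'M[R]_3) (y : 'rV[R]_3) :
  N *m N^T = 1%:M ->
  (forall l, X l = \sum_a N a l *: (N^T *m T a *m N)) ->
  \sum_i \sum_j (X j i j - X i j j) * (y *m N) 0 i
  = \sum_a ((y *m T a) 0 a - y 0 a * \tr (T a)).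
Proof.
move=> NN XE; set x := y *m N.
have -> : \sum_i \sum_j (X j i j - X i j j) * x 0 i
    = \sum_j (x *m X j) 0 j - \sum_i \tr (X i) * x 0 i.
  have -> : \sum_j (x *m X j) 0 j = \sum_i \sum_j X j i j * x 0 i.
    rewrite exchange_big /=; apply: eq_bigr => j _; rewrite mxE.
    by apply: eq_bigr => i _; rewrite mulrC.
  rewrite -sumrB; apply: eq_bigr => i _; rewrite /mxtrace mulr_suml -sumrB.
  by apply: eq_bigr => j _; rewrite mulrBl.
have -> : \sum_j (x *m X j) 0 j = \sum_a (y *m T a) 0 a.
  transitivity (\sum_j \sum_a N a j * (y *m T a *m N) 0 j).
    apply: eq_bigr => j _; rewrite XE mulmx_sumr summxE; apply: eq_bigr => a _.
    by rewrite -scalemxAr mxE /x !mulmxA -(mulmxA y N) NN mulmx1.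
  rewrite exchange_big /=; apply: eq_bigr => a _.
  transitivity ((y *m T a *m N *m N^T) 0 a); last by rewrite -mulmxA NN mulmx1.
  by rewrite [RHS]mxE; apply: eq_bigr => j _; rewrite [N^T _ _]mxE mulrC.
rewrite sumrB; congr (_ - _).
have trX i : \tr (X i) = \sum_a N a i * \tr (T a).
  rewrite XE raddf_sum; apply: eq_bigr => a _.
  by rewrite /= mxtraceZ mxtrace_mulC mulmxA NN mul1mx.
transitivity (\sum_i \sum_a N a i * \tr (T a) * x 0 i).
  by apply: eq_bigr => i _; rewrite trX mulr_suml.
rewrite exchange_big /=; apply: eq_bigr => a _.
have -> : y 0 a = (x *m N^T) 0 a by rewrite /x -mulmxA NN mulmx1.
rewrite [(x *m _) _ _]mxE mulr_suml; apply: eq_bigr => i _; rewrite [N^T _ _]mxE.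
by rewrite mulrC mulrA.
Qed.

(** * The ADM integrand in an orthonormal cylindrical frame *)

Section cartesian_components.
Context {R : realType}.
Notation tm := (@tm R).
Variable g : axisym_data R.
Hypothesis Hg : axisymmetric_metric g.

Let Hs : [/\ smooth (ax_u g), smooth (ax_alpha g), smooth (ax_A g) & smooth (ax_B g)].
Proof. by case: Hg. Qed.

(* Atoms, in order: cos phi, sin phi, a = e^(2alpha-2u), b = e^(-2u), 1/b,
   m = rho b B, n = rho b A, and then the rho- and z-derivatives of the last five. *)
Definition ca_a (p : 'rV[R]_2) : R := expR (2 * ax_alpha g p - 2 * ax_u g p).
Definition ca_b (p : 'rV[R]_2) : R := expR (- (2 * ax_u g p)).
Definition ca_bi (p : 'rV[R]_2) : R := expR (2 * ax_u g p).
Definition ca_m (p : 'rV[R]_2) : R := p 0 0 * (ca_b p * ax_B g p).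
Definition ca_n (p : 'rV[R]_2) : R := p 0 0 * (ca_b p * ax_A g p).
Definition ca_da (i : 'I_2) (p : 'rV[R]_2) : R :=
  ca_a p * (2 * partial i (ax_alpha g) p - 2 * partial i (ax_u g) p).
Definition ca_db (i : 'I_2) (p : 'rV[R]_2) : R := ca_b p * (- (2 * partial i (ax_u g) p)).
Definition ca_dbi (i : 'I_2) (p : 'rV[R]_2) : R := ca_bi p * (2 * partial i (ax_u g) p).
Definition ca_dm (i : 'I_2) (p : 'rV[R]_2) : R :=
  p 0 0 * (ca_b p * partial i (ax_B g) p + ax_B g p * ca_db i p)
  + (i == 0)%:R * (ca_b p * ax_B g p).
Definition ca_dn (i : 'I_2) (p : 'rV[R]_2) : R :=
  p 0 0 * (ca_b p * partial i (ax_A g) p + ax_A g p * ca_db i p)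
  + (i == 0)%:R * (ca_b p * ax_A g p).

Definition cart_atoms (n : nat) (q : 'rV[R]_3) : R :=
  let p := half_plane_part q in
  match n with
  | 0%N => cos (q 0 2)
  | 1%N => sin (q 0 2)
  | 2%N => ca_a p
  | 3%N => ca_b p
  | 4%N => ca_bi p
  | 5%N => ca_m p
  | 6%N => ca_n p
  | 7%N => ca_da 0 p
  | 8%N => ca_da 1 p
  | 9%N => ca_db 0 p
  | 10%N => ca_db 1 p
  | 11%N => ca_dbi 0 p
  | 12%N => ca_dbi 1 p
  | 13%N => ca_dm 0 p
  | 14%N => ca_dm 1 p
  | 15%N => ca_dn 0 p
  | _ => ca_dn 1 p
  end.

Definition cart_deriv (i : 'I_3) (n : nat) : tm :=
  match val i, n with
  | 2%N, 0%N => (- TA 1)%T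
  | 2%N, 1%N => TA 0
  | 2%N, _ => TK 0
  | _, 0%N | _, 1%N => TK 0
  | k, _ => TA (7 + (n - 2) * 2 + k)
  end.

Lemma cart_atoms_derive (q : 'rV[R]_3) (i : 'I_3) n : (n < 7)%N ->
  is_derive q (delta_mx 0 i) (cart_atoms n) (teval cart_atoms (cart_deriv i n) q).
Proof.
case: Hs => su sal sA sB.
have du := is_derive_hp q i su; have dal := is_derive_hp q i sal.
have dA := is_derive_hp q i sA; have dB := is_derive_hp q i sB.
have dr := is_derive_rho q i.
have dr' : is_derive q (delta_mx 0 i) (fun q => half_plane_part q 0 0) (i == 0)%:R.
  by under eq_fun do rewrite vec2E /=.
have dph : is_derive q (delta_mx 0 i) (fun q : 'rV[R]_3 => q 0 2) (i == 2)%:R.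
  by apply: (is_derive_eq (is_derive_coord q _ 2)); rewrite mxE eqxx /= eq_sym.
have da := is_derive_comp1 (is_derive_expR _) (is_derive_sub (is_derive_scale 2 dal) (is_derive_scale 2 du)).
have db := is_derive_comp1 (is_derive_expR _) (is_derive_opp (is_derive_scale 2 du)).
have dbi := is_derive_comp1 (is_derive_expR _) (is_derive_scale 2 du).
have dm := is_derive_mul dr' (is_derive_mul db dB).
have dn := is_derive_mul dr' (is_derive_mul db dA).
have dc := is_derive_comp1 (is_derive_cos _) dph.
have ds := is_derive_comp1 (is_derive_sin _) dph.
have hr : half_plane_part q 0 0 = q 0 0 by rewrite vec2E.
case: n => [|[|[|[|[|[|[|n]]]]]]].
all: cycle 7.
  by [].
all: move=> _.
- apply: (is_derive_eq dc); move: i {du dal dA dB dr dr' dph da db dbi dm dn dc ds}.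
  by case=> [[|[|[|//]]] ?]; rewrite /cart_deriv /=; ring.
- apply: (is_derive_eq ds); move: i {du dal dA dB dr dr' dph da db dbi dm dn dc ds}.
  by case=> [[|[|[|//]]] ?]; rewrite /cart_deriv /=; ring.
- apply: (is_derive_eq da); move: i {du dal dA dB dr dr' dph da db dbi dm dn dc ds}.
  by case=> [[|[|[|//]]] ?]; rewrite /cart_deriv /dhp //= !mulr0 subr0 mulr0.
- apply: (is_derive_eq db); move: i {du dal dA dB dr dr' dph da db dbi dm dn dc ds}.
  by case=> [[|[|[|//]]] ?]; rewrite /cart_deriv /dhp //= !mulr0 oppr0 mulr0.
- apply: (is_derive_eq dbi); move: i {du dal dA dB dr dr' dph da db dbi dm dn dc ds}.
  by case=> [[|[|[|//]]] ?]; rewrite /cart_deriv /dhp //= !mulr0.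
- apply: (is_derive_eq dm); move: i {du dal dA dB dr dr' dph da db dbi dm dn dc ds}.
  by case=> [[|[|[|//]]] ?]; rewrite /cart_deriv /dhp /= /ca_dm /ca_db /ca_b /= ?(mulr0, mul0r, mulr1, mul1r, oppr0, addr0).
- apply: (is_derive_eq dn); move: i {du dal dA dB dr dr' dph da db dbi dm dn dc ds}.
  by case=> [[|[|[|//]]] ?]; rewrite /cart_deriv /dhp /= /ca_dn /ca_db /ca_b /= ?(mulr0, mul0r, mulr1, mul1r, oppr0, addr0).
Qed.

Definition frame_t (a i : nat) : tm :=
  match a, i with
  | 0%N, 0%N => TA 0 | 0%N, 1%N => TA 1
  | 1%N, 2%N => TK 1
  | 2%N, 0%N => (- TA 1)%T | 2%N, 1%N => TA 0
  | _, _ => TK 0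
  end.

(** Components in the Euclidean orthonormal frame [d/drho], [d/dz], [(1/rho) d/dphi]. The entry
    [a + rho^2 b B^2] is written [a + m^2 / b], so that everything is expressed by the off-diagonal
    components [m] and [n], whose decay is controlled. *)
Definition framed_t (a b : nat) : tm :=
  match a, b with
  | 0%N, 0%N => (TA 2 + TA 5 * TA 5 * TA 4)%T
  | 0%N, 1%N | 1%N, 0%N => (TA 5 * TA 6 * TA 4)%T
  | 1%N, 1%N => (TA 2 + TA 6 * TA 6 * TA 4)%T
  | 0%N, _ | _, 0%N => TA 5
  | 1%N, _ | _, 1%N => TA 6
  | _, _ => TA 3
  end.

Definition cart_t (i j : nat) : tm :=
  let f b c := (frame_t b i * frame_t c j * framed_t b c)%T in
  (f 0%N 0%N + f 0%N 1%N + f 0%N 2%N + f 1%N 0%N + f 1%N 1%N + f 1%N 2%N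
   + f 2%N 0%N + f 2%N 1%N + f 2%N 2%N)%T.

Definition frame (q : 'rV[R]_3) : 'M[R]_3 := \matrix_(a, i) teval cart_atoms (frame_t a i) q.
Definition framed (q : 'rV[R]_3) : 'M[R]_3 := \matrix_(a, b) teval cart_atoms (framed_t a b) q.

Lemma frame_orthogonal (q : 'rV[R]_3) : frame q *m (frame q)^T = 1%:M.
Proof.
have H := cos2Dsin2 (q 0 2).
apply/matrixP => a b; rewrite !mxE sum_ord3 !mxE /=.
case: a => [[|[|[|//]]] ?]; case: b => [[|[|[|//]]] ?] /=; rewrite ?mulr0n ?mulr1n;
  move: H; move: (cos _) (sin _) => c s H; lra.
Qed.

Lemma frame_orthogonal' (q : 'rV[R]_3) : (frame q)^T *m frame q = 1%:M.
Proof. exact: mulmx1C (frame_orthogonal q). Qed.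

Definition lame (q : 'rV[R]_3) : 'rV[R]_3 := vec3 1 1 (q 0 0).

Lemma cyl_jacobian (q : 'rV[R]_3) (a i : 'I_3) :
  partial a (fun q' => cyl_to_cart q' 0 i) q = lame q 0 a * frame q a i.
Proof.
have dr := is_derive_rho q a.
have dz := is_derive_coord q (delta_mx 0 a) 1.
have dph := is_derive_coord q (delta_mx 0 a) 2.
have dc := is_derive_mul dr (is_derive_comp1 (is_derive_cos _) dph).
have ds := is_derive_mul dr (is_derive_comp1 (is_derive_sin _) dph).
rewrite /partial /lame /frame vec3E !mxE.
case: i => [[|[|[|//]]] ?]; under eq_fun do rewrite vec3E /=.
- rewrite derive_val mxE eqxx /= {dr dz dph dc ds}.
  by case: a => [[|[|[|//]]] ?]; rewrite /=; ring.
- rewrite derive_val mxE eqxx /= {dr dz dph dc ds}.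
  by case: a => [[|[|[|//]]] ?]; rewrite /=; ring.
- rewrite derive_val mxE eqxx /= {dr dz dph dc ds}.
  by case: a => [[|[|[|//]]] ?]; rewrite /= ?mulr1 ?mulr0.
Qed.

Lemma cyl_metric_framed (q : 'rV[R]_3) (i j : 'I_3) : 0 < q 0 0 ->
  cyl_metric g q i j = lame q 0 i * framed q i j * lame q 0 j.
Proof.
move=> q0; have hr : half_plane_part q 0 0 = q 0 0 by rewrite vec2E.
have bb : ca_b (half_plane_part q) * ca_bi (half_plane_part q) = 1.
  by rewrite /ca_b /ca_bi -expRD addNr expR0.
rewrite cyl_metricE /framed /lame !mxE.
case: i => [[|[|[|//]]] ?]; case: j => [[|[|[|//]]] ?];
  rewrite /= -/(ca_b _) -/(ca_a _) /ca_m /ca_n; move: (half_plane_part q) hr bb => p hr bb; rewrite ?hr.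
- transitivity (ca_a p + ca_b p * ca_bi p * q 0 0 ^+ 2 * ca_b p * ax_B g p ^+ 2); last by ring.
  by rewrite bb; ring.
- transitivity (ca_b p * ca_bi p * q 0 0 ^+ 2 * ca_b p * ax_A g p * ax_B g p); last by ring.
  by rewrite bb; ring.
- by ring.
- transitivity (ca_b p * ca_bi p * q 0 0 ^+ 2 * ca_b p * ax_A g p * ax_B g p); last by ring.
  by rewrite bb; ring.
- transitivity (ca_a p + ca_b p * ca_bi p * q 0 0 ^+ 2 * ca_b p * ax_A g p ^+ 2); last by ring.
  by rewrite bb; ring.
- by ring.
- by ring.
- by ring.
- by ring.
Qed.

(** The Jacobian of cylindrical coordinates is the diagonal matrix of the scale factors times the
    frame: dividing by the former and undoing the rotation inverts the pullback. *)
Lemma cart_metric_frame (q : 'rV[R]_3) : 0 < q 0 0 ->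
  ax_cart g (cyl_to_cart q) = (frame q)^T *m framed q *m frame q.
Proof.
move=> q0; have [_ _ /(_ q q0) H _] := Hg.
set N := frame q; set h := ax_cart g (cyl_to_cart q).
suff NhN : N *m h *m N^T = framed q.
  by rewrite -NhN !mulmxA frame_orthogonal' mul1mx -mulmxA frame_orthogonal' mulmx1.
apply/matrixP => a b.
have l0 i : lame q 0 i != 0.
  by rewrite vec3E; case: i => [[|[|[|//]]] ?]; rewrite /= ?oner_eq0 // gt_eqF.
apply: (mulIf (l0 b)); apply: (mulfI (l0 a)).
rewrite [RHS]mulrA -cyl_metric_framed // -H /pullback -/h.
have -> : \matrix_(c, i) partial c (fun q' => cyl_to_cart q' 0 i) q = diag_mx (lame q) *m N.
  by apply/matrixP => c i; rewrite mxE cyl_jacobian mul_diag_mx [RHS]mxE.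
rewrite trmx_mul tr_diag_mx !mulmxA mul_mx_diag [RHS]mxE mulrA.
by rewrite -!(mulmxA (diag_mx _)) mul_diag_mx [in RHS]mxE.
Qed.

Lemma cart_metric_t (q : 'rV[R]_3) (i j : 'I_3) : 0 < q 0 0 ->
  ax_cart g (cyl_to_cart q) i j = teval cart_atoms (cart_t i j) q.
Proof.
move=> q0; rewrite cart_metric_frame // mxE sum_ord3.
rewrite ![(_^T *m _) _ _]mxE !sum_ord3 ![(frame q)^T _ _]mxE ![frame q _ _]mxE ![framed q _ _]mxE.
rewrite /cart_t; cbn [teval].
ring.
Qed.

(** Frame components of the derivative of the metric along the [k]-th frame vector. In the angular
    direction the components are constant but the frame turns, which leaves the commutator with the
    rotation generator, divided by [rho]. *)
Definition framed_d (k : 'I_3) (q : 'rV[R]_3) : 'M[R]_3 :=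
  let r := q 0 0 in
  \matrix_(a, b) if k == 2 then
    match val a, val b with
    | 0%N, 0%N => - (2 * ca_m (half_plane_part q)) / r
    | 0%N, 1%N | 1%N, 0%N => - ca_n (half_plane_part q) / r
    | 0%N, _ | _, 0%N =>
      (teval cart_atoms (framed_t 0 0) q - teval cart_atoms (framed_t 2 2) q) / r
    | 1%N, 1%N => 0
    | 1%N, _ | _, 1%N => teval cart_atoms (framed_t 0 1) q / r
    | _, _ => 2 * ca_m (half_plane_part q) / r
    end
  else teval cart_atoms (tderiv (cart_deriv k) (framed_t a b)) q.

Lemma cart_deriv_frame (q : 'rV[R]_3) (k i j : 'I_3) : 0 < q 0 0 ->
  teval cart_atoms (tderiv (cart_deriv k) (cart_t i j)) q
  = lame q 0 k * ((frame q)^T *m framed_d k q *m frame q) i j.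
Proof.
move=> q0; have r0 : q 0 0 != 0 by rewrite gt_eqF.
rewrite [X in _ = _ * X]mxE sum_ord3.
rewrite ![(_^T *m _) _ _]mxE !sum_ord3 ![(frame q)^T _ _]mxE ![frame q _ _]mxE ![framed_d k q _ _]mxE.
rewrite /lame vec3E.
case: k => [[|[|[|//]]] ?]; case: i => [[|[|[|//]]] ?]; case: j => [[|[|[|//]]] ?];
  rewrite /=; move: (half_plane_part q) => p; by field.
Qed.

Lemma enorm_cyl (q : 'rV[R]_3) :
  enorm (cyl_to_cart q) = Num.sqrt (q 0 0 ^+ 2 + q 0 1 ^+ 2).
Proof.
rewrite /enorm sum_ord3 /cyl_to_cart !vec3E /=; congr Num.sqrt.
have H := cos2Dsin2 (q 0 2); rewrite !exprMn -mulrDr H; ring.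
Qed.

(** [rho |x|] times the ADM integrand. The factor clears the denominators of the rotating frame and
    of the unit normal, and on a sphere of radius [r] it is the density [r^2 sin theta] of the
    area. *)
Definition adm_form (p : 'rV[R]_2) : R :=
  let r := p 0 0 in let z := p 0 1 in
  let m := ca_m p in let n := ca_n p in let bi := ca_bi p in
  r ^+ 2 * ((ca_dm 1 p * n + m * ca_dn 1 p) * bi + m * n * ca_dbi 1 p
     - (ca_da 0 p + 2 * n * ca_dn 0 p * bi + n ^+ 2 * ca_dbi 0 p) - ca_db 0 p)
  + r * (ca_a p + m ^+ 2 * bi - ca_b p)
  + z * r * ((ca_dm 0 p * n + m * ca_dn 0 p) * bi + m * n * ca_dbi 0 p
     - (ca_da 1 p + 2 * m * ca_dm 1 p * bi + m ^+ 2 * ca_dbi 1 p) - ca_db 1 p)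
  + z * (m * n * bi).

Lemma cart_deriv_chain (q : 'rV[R]_3) (k i j : 'I_3) : 0 < q 0 0 ->
  teval cart_atoms (tderiv (cart_deriv k) (cart_t i j)) q
  = \sum_l partial l (fun y => ax_cart g y i j) (cyl_to_cart q) * (lame q 0 k * frame q k l).
Proof.
move=> q0; have [[sh _ _] _ _ _] := Hg.
have HD : 'D_(delta_mx 0 k) (fun q' => ax_cart g (cyl_to_cart q') i j) q
    = teval cart_atoms (tderiv (cart_deriv k) (cart_t i j)) q.
  rewrite (@near_eq_derive _ _ _ _ (teval cart_atoms (cart_t i j))); last first.
    have := open_nbhs_nbhs (conj (@open_rho_gt0 R) q0).
    by apply: filterS => y y0; exact: cart_metric_t.
  have := @is_derive_teval _ _ cart_atoms (cart_deriv k) 7 q (delta_mx 0 k)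
    (fun n => @cart_atoms_derive q k n) (cart_t i j).
  have -> : tatoms 7 (cart_t i j).
    by case: i => [[|[|[|//]]] ?]; case: j => [[|[|[|//]]] ?].
  by move=> /(_ isT) H; rewrite derive_val.
rewrite -HD.
have dP (l : 'I_3) : is_derive q (delta_mx 0 k) (fun y => cyl_to_cart y 0 l)
    ((\row_l (lame q 0 k * frame q k l)) 0 l).
  rewrite mxE -cyl_jacobian; apply: derivableP.
  have dr := is_derive_rho q k.
  have dz := is_derive_coord q (delta_mx 0 k) 1.
  have dph := is_derive_coord q (delta_mx 0 k) 2.
  have dc := is_derive_mul dr (is_derive_comp1 (is_derive_cos _) dph).
  have ds := is_derive_mul dr (is_derive_comp1 (is_derive_sin _) dph).
  by case: l => [[|[|[|//]]] ?]; under eq_fun do rewrite vec3E /=; apply: ex_derive.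
have := is_derive_chain (smooth_differentiable (cyl_to_cart q) (sh i j)) dP.
by move=> H; rewrite derive_val; apply: eq_bigr => l _; rewrite [(\row_(_ < _) _) 0 l]mxE.
Qed.

Lemma adm_integrand_cyl (q : 'rV[R]_3) : 0 < q 0 0 ->
  q 0 0 * enorm (cyl_to_cart q) * adm_integrand (ax_cart g) (cyl_to_cart q)
  = adm_form (half_plane_part q).
Proof.
move=> q0; have r0 : q 0 0 != 0 by rewrite gt_eqF.
set x := cyl_to_cart q; set N := frame q.
have e0 : enorm x != 0.
  rewrite enorm_cyl sqrtr_eq0 -ltNge ltr_pwDl ?sqr_ge0 // exprn_gt0 //.
pose X (l : 'I_3) : 'M[R]_3 := \matrix_(i, j) partial l (fun y => ax_cart g y i j) x.
have DX k : \sum_l (lame q 0 k * N k l) *: X l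
    = lame q 0 k *: (N^T *m framed_d k q *m N).
  apply/matrixP => i j; rewrite [RHS]mxE -cart_deriv_frame // summxE.
  rewrite cart_deriv_chain //; apply: eq_bigr => l _.
  by rewrite mxE [X l i j]mxE mulrC.
(* Orthogonality of the frame inverts the chain rule and recovers the Cartesian derivatives from
   those along the frame. *)
have XE l : X l = \sum_a N a l *: (N^T *m framed_d a q *m N).
  transitivity (\sum_a N a l *: \sum_m N a m *: X m); last first.
    apply: eq_bigr => a _; congr (_ *: _).
    have la : lame q 0 a != 0.
      by rewrite vec3E; case: a => [[|[|[|//]]] ?]; rewrite /= ?oner_eq0.
    apply: (scalerI la); rewrite -DX scaler_sumr; apply: eq_bigr => m _.
    by rewrite scalerA.
  under eq_bigr do rewrite scaler_sumr.
  rewrite exchange_big /=.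
  have NN m : \sum_a N a l * N a m = (l == m)%:R.
    have /matrixP /(_ l m) := frame_orthogonal' q; rewrite [1%:M _ _]mxE mxE => <-.
    by apply: eq_bigr => a _; rewrite [(frame q)^T _ _]mxE.
  transitivity (\sum_m (l == m)%:R *: X m).
    rewrite (bigD1 l) //= eqxx scale1r big1 ?addr0 // => m; rewrite eq_sym => /negbTE ->.
    by rewrite scale0r.
  apply: eq_bigr => m _; rewrite -NN scaler_suml; apply: eq_bigr => a _.
  by rewrite scalerA.
pose y : 'rV[R]_3 := vec3 (q 0 0) (q 0 1) 0.
have xE : x = y *m N.
  apply/rowP => i; rewrite [RHS]mxE sum_ord3 /y !vec3E /N /frame !mxE /=.
  by case: i => [[|[|[|//]]] ?] /=; ring.
have := frame_contraction y (frame_orthogonal q) XE.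
rewrite -/N -xE => FC.
have -> : adm_integrand (ax_cart g) x
    = (enorm x)^-1 * \sum_i \sum_j (X j i j - X i j j) * x 0 i.
  rewrite /adm_integrand mulr_sumr; apply: eq_bigr => i _; rewrite mulr_sumr.
  apply: eq_bigr => j _; by rewrite ![X _ _ _]mxE [RHS]mulrC mulrA.
rewrite FC sum_ord3 -!mulrA mulVKf // /mxtrace !sum_ord3 ![(y *m _) _ _]mxE !sum_ord3 /y !vec3E.
rewrite ![framed_d _ q _ _]mxE /= /adm_form.
have [-> ->] : half_plane_part q 0 0 = q 0 0 /\ half_plane_part q 0 1 = q 0 1.
  by rewrite !vec2E.
move: (half_plane_part q) => p.
move: (ca_a p) (ca_b p) (ca_bi p) (ca_m p) (ca_n p) (q 0 0) (q 0 1) r0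
  (ca_da 0 p) (ca_da 1 p) (ca_db 0 p) (ca_db 1 p) (ca_dbi 0 p) (ca_dbi 1 p)
  (ca_dm 0 p) (ca_dm 1 p) (ca_dn 0 p) (ca_dn 1 p).
by move=> a b bi m n r z r0 a0 a1 b0 b1 bi0 bi1 m0 m1 n0 n1; field.
Qed.

End cartesian_components.

(** * The ADM integrand up to second-order errors *)

Section norm_bounds.
Context {R : realType}.

Lemma nleD (a b A B : R) : `|a| <= A -> `|b| <= B -> `|a + b| <= A + B.
Proof. by move=> hA hB; apply: (le_trans (ler_normD _ _)); exact: lerD. Qed.

Lemma nleN (a A : R) : `|a| <= A -> `|- a| <= A.
Proof. by rewrite normrN. Qed.

Lemma nleM (a b A B : R) : `|a| <= A -> `|b| <= B -> `|a * b| <= A * B.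
Proof. by move=> hA hB; rewrite normrM; exact: ler_pM. Qed.

Lemma nleX (a A : R) : `|a| <= A -> `|a ^+ 2| <= A * A.
Proof. by rewrite expr2; move=> h; exact: nleM. Qed.

Lemma nle2 : `|2 : R| <= 2.
Proof. by rewrite normr_nat. Qed.

(** The upper bound comes from [e^t (1 - t) <= e^t e^(-t) = 1]. *)
Lemma expR_bounds (t : R) : `|t| <= 2^-1 -> 0 <= expR t - 1 - t <= 2 * t ^+ 2.
Proof.
move=> th; have : - 2^-1 <= t <= 2^-1 by rewrite -ler_norml.
move=> /andP[t1 t2]; have h1 := expR_ge1Dx t; have h2 := expR_ge1Dx (- t).
have e0 := expR_gt0 t.
have h3 : expR t * (1 - t) <= 1.
  have : expR t * (1 + - t) <= expR t * expR (- t) by rewrite ler_pM2l.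
  by rewrite -expRD subrr expR0.
by apply/andP; split; nra.
Qed.

Lemma expR_sub1_bound (t : R) : `|t| <= 2^-1 -> `|expR t - 1| <= 2 * `|t|.
Proof.
move=> th; have /andP[h1 h2] := expR_bounds th.
have -> : expR t - 1 = (expR t - 1 - t) + t by ring.
apply: (le_trans (ler_normD _ _)); rewrite (ger0_norm h1).
have : 2 * t ^+ 2 <= `|t|.
  rewrite -(real_normK (num_real t)); have := normr_ge0 t; nra.
by move=> h; lra.
Qed.

End norm_bounds.

(** When the bound is an unknown, it is built from the shape of the expression. *)
Ltac nle := repeat first
  [ eassumption | exact: nle2 | eapply nleD | eapply nleN | eapply nleX | eapply nleM ].

Section adm_error.
Context {R : realType}.

(* [t] stands for [1/sqrt r]: the off-diagonal components decay like [eta/sqrt r]. *)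
Lemma adm_error (r t C eta x z u al u0 u1 al0 al1 m n m0 m1 n0 n1 : R) :
  0 < r -> 0 <= C -> 8 * C <= r -> 0 <= t -> r * t ^+ 2 = 1 -> 0 <= eta ->
  `|x| <= r -> `|z| <= r ->
  `|u| <= C / r -> `|al| <= C / r ->
  `|u0| <= C / r ^+ 2 -> `|u1| <= C / r ^+ 2 ->
  `|al0| <= C / r ^+ 2 -> `|al1| <= C / r ^+ 2 ->
  `|m| <= eta * t -> `|n| <= eta * t ->
  `|m0| <= eta * t / r -> `|m1| <= eta * t / r ->
  `|n0| <= eta * t / r -> `|n1| <= eta * t / r ->
  let a := expR (2 * al - 2 * u) in let b := expR (- (2 * u)) in let bi := expR (2 * u) in
  let a0 := a * (2 * al0 - 2 * u0) in let a1 := a * (2 * al1 - 2 * u1) in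
  let b0 := b * (- (2 * u0)) in let b1 := b * (- (2 * u1)) in
  let bi0 := bi * (2 * u0) in let bi1 := bi * (2 * u1) in
  `| (x ^+ 2 * ((m1 * n + m * n1) * bi + m * n * bi1
     - (a0 + 2 * n * n0 * bi + n ^+ 2 * bi0) - b0)
     + x * (a + m ^+ 2 * bi - b)
     + z * x * ((m0 * n + m * n0) * bi + m * n * bi0
     - (a1 + 2 * m * m1 * bi + m ^+ 2 * bi1) - b1)
     + z * (m * n * bi))
    - ((x * (4 * u0 - 2 * al0) + 2 * al) * x + x * (4 * u1 - 2 * al1) * z) |
  <= 120 * C ^+ 2 / r + 36 * eta ^+ 2.
Proof.
move=> r0 C0 Cr t0 rt e0 hx hz hu hal hu0 hu1 hal0 hal1 hm hn hm0 hm1 hn0 hn1 /=.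
have r0' : r != 0 by rewrite gt_eqF.
set d := C / r; have d0 : 0 <= d by rewrite /d divr_ge0 // ltW.
have d8 : d <= 8^-1 by rewrite /d ler_pdivrMr //; lra.
have C2d : C / r ^+ 2 = d / r by rewrite /d; field.
rewrite C2d in hu0 hu1 hal0 hal1; rewrite -/d in hu hal.
have hau : `|2 * al - 2 * u| <= 4 * d.
  have : `|2 * al - 2 * u| <= 2 * d + 2 * d by nle.
  by move=> h; lra.
have hbu : `|- (2 * u)| <= 2 * d by nle.
have hbu' : `|2 * u| <= 2 * d by nle.
have ha2 : `|2 * al - 2 * u| <= 2^-1 by lra.
have hb2 : `|- (2 * u)| <= 2^-1 by lra.
have hb2' : `|2 * u| <= 2^-1 by lra.
have ha1 := expR_sub1_bound ha2; have hb1 := expR_sub1_bound hb2.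
have hbi1 := expR_sub1_bound hb2'.
have /andP[ea1 ea2] := expR_bounds ha2; have /andP[eb1 eb2] := expR_bounds hb2.
set a := expR (2 * al - 2 * u) in ha1 ea1 ea2 *; set b := expR (- (2 * u)) in hb1 eb1 eb2 *.
set bi := expR (2 * u) in hbi1 *.
have {}ha1 : `|a - 1| <= 8 * d by lra.
have {}hb1 : `|b - 1| <= 4 * d by lra.
have hbi : `|bi| <= 2.
  rewrite -(subrK 1 bi); apply: (le_trans (ler_normD _ _)); rewrite normr1; lra.
have hab : `|a - b - 2 * al| <= 40 * d ^+ 2.
  have h1 : (2 * al - 2 * u) ^+ 2 <= (4 * d) ^+ 2.
    by rewrite -(real_normK (num_real (2 * al - 2 * u))) ler_pXn2r ?nnegrE // mulr_ge0.
  have h2 : (- (2 * u)) ^+ 2 <= (2 * d) ^+ 2.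
    by rewrite -(real_normK (num_real (- (2 * u)))) ler_pXn2r ?nnegrE // mulr_ge0.
  by rewrite ler_norml; apply/andP; split; nra.
have hbi0 : `|bi * (2 * u0)| <= 4 * (d / r).
  have h : `|bi * (2 * u0)| <= 2 * (2 * (d / r)) by nle.
  by lra.
have hbi1' : `|bi * (2 * u1)| <= 4 * (d / r).
  have h : `|bi * (2 * u1)| <= 2 * (2 * (d / r)) by nle.
  by lra.
move: hbi0 hbi1'; move: (bi * (2 * u0)) (bi * (2 * u1)) => bi0 bi1' hbi0 hbi1'.
(* Replacing the exponentials by their first-order parts leaves the flux of W. The first group of
   errors is quadratic in [d = C / r], and each of its three terms is at most [40 C^2 / r]; the
   second group is quadratic in the off-diagonal components. *)
pose G0 := - (a - 1) * (2 * al0 - 2 * u0) + (b - 1) * (2 * u0).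
pose G1 := - (a - 1) * (2 * al1 - 2 * u1) + (b - 1) * (2 * u1).
set S := (X in `|X| <= _).
have -> : S = (x ^+ 2 * G0 + x * (a - b - 2 * al) + z * x * G1)
  + (x ^+ 2 * ((m1 * n + m * n1) * bi + m * n * bi1' - (2 * n * n0 * bi + n ^+ 2 * bi0))
   + x * (m ^+ 2 * bi)
   + z * x * ((m0 * n + m * n0) * bi + m * n * bi0 - (2 * m * m1 * bi + m ^+ 2 * bi1'))
   + z * (m * n * bi)) by rewrite /S /G0 /G1; ring.
have hG0 : `|G0| <= 40 * d * (d / r).
  have h : `|G0| <= 8 * d * (2 * (d / r) + 2 * (d / r)) + 4 * d * (2 * (d / r)) by rewrite /G0; nle.
  by apply: (le_trans h); rewrite le_eqVlt; apply/orP; left; apply/eqP; ring.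
have hG1 : `|G1| <= 40 * d * (d / r).
  have h : `|G1| <= 8 * d * (2 * (d / r) + 2 * (d / r)) + 4 * d * (2 * (d / r)) by rewrite /G1; nle.
  by apply: (le_trans h); rewrite le_eqVlt; apply/orP; left; apply/eqP; ring.
apply: nleD.
  eapply le_trans; first by nle.
  by rewrite le_eqVlt; apply/orP; left; apply/eqP; rewrite /d; field.
eapply le_trans; first by nle.
(* Here [r t^2 = 1], and [d <= 1/8] gives [20 + 16 d <= 36]. *)
apply: (@le_trans _ _ (r * t ^+ 2 * eta ^+ 2 * (20 + 16 * d))).
  by rewrite le_eqVlt; apply/orP; left; apply/eqP; rewrite /d; field.
rewrite rt mul1r mulrC; apply: ler_wpM2r; first exact: sqr_ge0.
by lra.
Qed.

End adm_error.

(** * Regularity at the axis and off-diagonal Cartesian components *)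

Section mass.
Context {R : realType}.
Notation mu := (@lebesgue_measure R).
Variable g : axisym_data R.
Hypothesis Hg : axisymmetric_metric g.

Let Hs : [/\ smooth (ax_u g), smooth (ax_alpha g), smooth (ax_A g) & smooth (ax_B g)].
Proof. by case: Hg. Qed.

Let smooth_cart i j : smooth (fun x => ax_cart g x i j).
Proof. by case: Hg => -[]. Qed.

Lemma vec3_continuous (T : topologicalType) (f1 f2 f3 : T -> R) :
  continuous f1 -> continuous f2 -> continuous f3 ->
  continuous (fun t => vec3 (f1 t) (f2 t) (f3 t)).
Proof.
move=> c1 c2 c3.
have -> : (fun t => vec3 (f1 t) (f2 t) (f3 t)) = (fun t => f1 t *: (vec3 1 0 0 : 'rV[R]_3)
   + f2 t *: (vec3 0 1 0 : 'rV[R]_3) + f3 t *: (vec3 0 0 1 : 'rV[R]_3)).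
  apply/funext => p; apply/rowP; case=> [[|[|[|//]]] ?]; rewrite !mxE /=; ring.
move=> p; have h1 : f1 t *: (vec3 1 0 0 : 'rV[R]_3) @[t --> p] --> f1 p *: (vec3 1 0 0 : 'rV[R]_3).
  by apply: cvgZr_tmp; exact: c1.
have h2 : f2 t *: (vec3 0 1 0 : 'rV[R]_3) @[t --> p] --> f2 p *: (vec3 0 1 0 : 'rV[R]_3).
  by apply: cvgZr_tmp; exact: c2.
have h3 : f3 t *: (vec3 0 0 1 : 'rV[R]_3) @[t --> p] --> f3 p *: (vec3 0 0 1 : 'rV[R]_3).
  by apply: cvgZr_tmp; exact: c3.
exact: cvgD (cvgD h1 h2) h3.
Qed.

Lemma cont_cart (T : topologicalType) (f1 f2 f3 : T -> R) i j :
  continuous f1 -> continuous f2 -> continuous f3 ->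
  continuous (fun t => ax_cart g (vec3 (f1 t) (f2 t) (f3 t)) i j).
Proof.
move=> c1 c2 c3 t; have cv := vec3_continuous c1 c2 c3.
have cf : continuous (fun x => ax_cart g x i j) by exact: smooth_continuous.
exact: continuous_comp (cv t) (cf _).
Qed.

Lemma continuous_ge0_right (d : R -> R) : continuous d -> (forall x, 0 < x -> 0 <= d x) -> 0 <= d 0.
Proof.
move=> cd d0; rewrite leNgt; apply/negP => d00.
have e0 : 0 < - d 0 by rewrite oppr_gt0.
have /cvgrPdist_lt /(_ _ e0) := cd 0.
move=> /nbhs_ballP[del /= del0 H].
have d2 : 0 < del / 2 by rewrite divr_gt0.
have : ball 0 del (del / 2).
  by rewrite /ball /= sub0r normrN gtr0_norm // ltr_pdivrMr // ltr_pMr // ltr1n.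
move=> /H; rewrite ltr_norml => /andP[h _].
have := d0 _ d2; lra.
Qed.

Lemma continuous_eq0_right (d : R -> R) : continuous d -> (forall x, 0 < x -> d x = 0) -> d 0 = 0.
Proof.
move=> cd d0; apply/eqP; rewrite eq_le; apply/andP; split.
  rewrite -oppr_ge0; apply: (@continuous_ge0_right (fun x => - d x)).
    exact: cont_opp.
  by move=> x /d0 ->; rewrite oppr0.
by apply: continuous_ge0_right => // x /d0 ->.
Qed.

Lemma cont_expR (T : topologicalType) (f : T -> R) : continuous f ->
  continuous (fun x => expR (f x)).
Proof. by apply: cont_comp; exact: continuous_expR. Qed.

Lemma cont_id : continuous (fun x : R => x).
Proof. by move=> x; exact: cvg_id. Qed.

(** Absence of a conical singularity. The (0,0) component of the Cartesian metric is the radial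
    [a + m^2 / b] at angle 0 and the angular [b] at angle [pi / 2]; both tend to its value on the
    axis, where [m = 0], so [a = b] there. *)
Lemma alpha_axis z : ax_alpha g (vec2 0 z) = 0.
Proof.
have [su sal sA sB] := Hs.
pose d (x : R) := (ca_a g (vec2 x z) + ca_m g (vec2 x z) ^+ 2 * ca_bi g (vec2 x z)
  - ca_b g (vec2 x z)) - (ax_cart g (vec3 x 0 z) 0 0 - ax_cart g (vec3 0 x z) 0 0).
have d0 x : 0 < x -> d x = 0.
  move=> x0.
  pose q1 : 'rV[R]_3 := vec3 x z 0; pose q2 : 'rV[R]_3 := vec3 x z (pi / 2).
  have hq1 : half_plane_part q1 = vec2 x z by rewrite /half_plane_part !vec3E.
  have hq2 : half_plane_part q2 = vec2 x z by rewrite /half_plane_part !vec3E.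
  have e1 : cyl_to_cart q1 = vec3 x 0 z.
    by rewrite /cyl_to_cart !vec3E /= cos0 sin0 mulr1 mulr0.
  have e2 : cyl_to_cart q2 = vec3 0 x z.
    by rewrite /cyl_to_cart !vec3E /= cos_pihalf sin_pihalf mulr1 mulr0.
  have q10 : 0 < q1 0 0 by rewrite vec3E.
  have q20 : 0 < q2 0 0 by rewrite vec3E.
  rewrite /d -e1 -e2 !(cart_metric_t Hg) // /cart_t; cbn [teval nat_of_ord frame_t framed_t cart_atoms].
  rewrite /= hq1 hq2 !vec3E /= cos0 sin0 cos_pihalf sin_pihalf.
  move: (vec2 x z) => p; ring.
have cu : continuous (fun x => on2 (ax_u g) (x, z)).
  by apply: continuous_slice_x; exact: cont_on2.
have cal : continuous (fun x => on2 (ax_alpha g) (x, z)).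
  by apply: continuous_slice_x; exact: cont_on2.
have cB : continuous (fun x => on2 (ax_B g) (x, z)).
  by apply: continuous_slice_x; exact: cont_on2.
have c2u := cont_mul (@cont_cst R R 2) cu; have c2al := cont_mul (@cont_cst R R 2) cal.
have cb := cont_expR (cont_opp c2u); have cbi := cont_expR c2u.
have ca := cont_expR (cont_add c2al (cont_opp c2u)).
have cm := cont_mul cont_id (cont_mul cb cB).
have cd : continuous d.
  rewrite /d; apply: cont_add; last first.
    apply: cont_opp; apply: cont_add; first by apply: cont_cart; [exact: cont_id|exact: cont_cst..].
    by apply: cont_opp; apply: cont_cart; [exact: cont_cst|exact: cont_id|exact: cont_cst].
  apply: cont_add; last exact: cont_opp.
  apply: cont_add; first exact: ca.
  apply: cont_mul; last exact: cbi.
  under eq_fun do rewrite /ca_m vec2E /=.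
  exact: cont_exp.
have := continuous_eq0_right cd d0.
rewrite /d subrr subr0 /ca_m vec2E /= mul0r expr0n /= mul0r addr0 => /eqP.
rewrite subr_eq0 => /eqP /expR_inj => H; lra.
Qed.

(** At angle 0 the frame is the Cartesian one up to order, so [m], [n] and their derivatives are
    those of Cartesian components, to which asymptotic flatness applies. *)
Lemma cart_off_diag (x z : R) : 0 < x ->
  [/\ ax_cart g (vec3 x 0 z) 0 1 = ca_m g (vec2 x z),
      ax_cart g (vec3 x 0 z) 1 2 = ca_n g (vec2 x z),
      partial 0 (fun y => ax_cart g y 0 1) (vec3 x 0 z) = ca_dm g 0 (vec2 x z) /\
      partial 2 (fun y => ax_cart g y 0 1) (vec3 x 0 z) = ca_dm g 1 (vec2 x z) &
      partial 0 (fun y => ax_cart g y 1 2) (vec3 x 0 z) = ca_dn g 0 (vec2 x z) /\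
      partial 2 (fun y => ax_cart g y 1 2) (vec3 x 0 z) = ca_dn g 1 (vec2 x z)].
Proof.
move=> x0; pose q1 : 'rV[R]_3 := vec3 x z 0.
have hq1 : half_plane_part q1 = vec2 x z by rewrite /half_plane_part !vec3E.
have e1 : cyl_to_cart q1 = vec3 x 0 z.
  by rewrite /cyl_to_cart !vec3E /= cos0 sin0 mulr1 mulr0.
have q10 : 0 < q1 0 0 by rewrite vec3E.
have D (k i j : 'I_3) := cart_deriv_chain Hg k i j q10.
have fE (a i : 'I_3) : frame g q1 a i = (nth [::] [:: [:: 1; 0; 0]; [:: 0; 0; 1]; [:: 0; 1; 0]] a)`_i.
  rewrite mxE; case: a => [[|[|[|//]]] ?]; case: i => [[|[|[|//]]] ?];
    by rewrite /= ?vec3E /= ?cos0 ?sin0 ?mulr0.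
have {}D (k l i j : 'I_3) : (k == 0) && (l == 0) || (k == 1) && (l == 2) ->
    partial l (fun y => ax_cart g y i j) (vec3 x 0 z) =
    teval (cart_atoms g) (tderiv (cart_deriv k) (cart_t i j)) q1.
  rewrite D e1 sum_ord3 !fE /lame !vec3E.
  by case/orP => /andP[/eqP -> /eqP ->] /=; rewrite !(mulr0, mulr1, addr0, add0r).
split.
- rewrite -e1 (cart_metric_t Hg) // /cart_t /= hq1 !vec3E /= cos0 sin0; ring.
- rewrite -e1 (cart_metric_t Hg) // /cart_t /= hq1 !vec3E /= cos0 sin0; ring.
- by split; rewrite ?(D 0 0) ?(D 1 2) // /cart_t /= hq1 !vec3E /= cos0 sin0; ring.
- by split; rewrite ?(D 0 0) ?(D 1 2) // /cart_t /= hq1 !vec3E /= cos0 sin0; ring.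
Qed.

End mass.

(** * The flux field and its comparison with the ADM integrand *)

Section flux.
Context {R : realType}.
Notation mu := (@lebesgue_measure R).

(** A rate above 1/2 eventually beats [eta / sqrt r] for every [eta]; products of two such
    quantities are then at most [eta^2 / r], small against the area of the sphere times the size of
    a derivative. *)
Lemma powR_decay (tau C eta : R) : 2^-1 < tau -> 0 < eta ->
  exists r1 : R, 0 < r1 /\ forall r, r1 <= r ->
   C / r `^ tau <= eta * (Num.sqrt r)^-1 /\
   C / r `^ (tau + 1) <= eta * (Num.sqrt r)^-1 / r.
Proof.
move=> tau2 eta0; pose k := tau - 2^-1; have k0 : 0 < k by rewrite subr_gt0.
pose K := `|C| / eta + 1.
have K0 : 0 < K by rewrite ltr_wpDl // divr_ge0 // ltW.
exists (K `^ (k^-1)); split; first exact: powR_gt0.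
move=> r hr; have r0 : 0 < r by apply: lt_le_trans hr; exact: powR_gt0.
have hK : K <= r `^ k.
  have -> : K = (K `^ k^-1) `^ k by rewrite -powRrM mulVf ?gt_eqF // powRr1 // ltW.
  by apply: ge0_ler_powR => //; rewrite ?nnegrE ltW // powR_gt0.
have s0 : 0 < Num.sqrt r by rewrite sqrtr_gt0.
have E : r `^ tau = r `^ k * Num.sqrt r.
  rewrite -powR12_sqrt ?ltW // -powRD; last by apply/implyP => _; rewrite gt_eqF.
  by congr (_ `^ _); rewrite /k subrK.
have rk0 : 0 < r `^ k by exact: powR_gt0.
have h : C / r `^ tau <= eta * (Num.sqrt r)^-1.
  rewrite E invfM mulrA; apply: ler_wpM2r; first by rewrite invr_ge0 ltW.
  rewrite ler_pdivrMr //; apply: (le_trans (ler_norm C)).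
  apply: (@le_trans _ _ (eta * K)); last by rewrite ler_pM2l.
  by rewrite /K mulrDr mulr1 mulrC divfK ?gt_eqF // lerDl ltW.
split=> //; rewrite powRD; last by apply/implyP => _; rewrite gt_eqF.
rewrite powRr1; last exact: ltW.
rewrite invfM [leLHS]mulrA; apply: ler_wpM2r => //; by rewrite invr_ge0 ltW.
Qed.

(** W is [rho grad (4 u - 2 alpha)] with the radial correction [2 alpha], which cancels the
    first-order term [- 2 alpha_rho] of the divergence. *)
Definition Wr (g : axisym_data R) (p : R * R) : R :=
  p.1 * (4 * on2 (partial 0 (ax_u g)) p - 2 * on2 (partial 0 (ax_alpha g)) p)
  + 2 * on2 (ax_alpha g) p.
Definition Wz (g : axisym_data R) (p : R * R) : R :=
  p.1 * (4 * on2 (partial 1 (ax_u g)) p - 2 * on2 (partial 1 (ax_alpha g)) p).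
Definition Wr1 (g : axisym_data R) (p : R * R) : R :=
  p.1 * (4 * on2 (partial 0 (partial 0 (ax_u g))) p
         - 2 * on2 (partial 0 (partial 0 (ax_alpha g))) p)
  + 4 * on2 (partial 0 (ax_u g)) p.
Definition Wz2 (g : axisym_data R) (p : R * R) : R :=
  p.1 * (4 * on2 (partial 1 (partial 1 (ax_u g))) p
         - 2 * on2 (partial 1 (partial 1 (ax_alpha g))) p).
Definition energy (g : axisym_data R) (p : R * R) : R := Wr1 g p + Wz2 g p.

Definition radius (x z : R) : R := Num.sqrt (x ^+ 2 + z ^+ 2).

Lemma radius_sqr x z : radius x z ^+ 2 = x ^+ 2 + z ^+ 2.
Proof. by rewrite sqr_sqrtr // addr_ge0 ?sqr_ge0. Qed.

Lemma radius_ge0 x z : 0 <= radius x z.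
Proof. exact: sqrtr_ge0. Qed.

Lemma le_radius x z : `|x| <= radius x z /\ `|z| <= radius x z.
Proof.
split; rewrite -(@ler_pXn2r _ 2) ?nnegrE ?radius_ge0 // radius_sqr real_normK ?num_real //.
  by rewrite lerDl sqr_ge0.
by rewrite lerDr sqr_ge0.
Qed.

Lemma enorm_vec2 (x z : R) : enorm (vec2 x z) = radius x z.
Proof. by rewrite /enorm !big_ord_recl big_ord0 addr0 !vec2E. Qed.

Lemma uaf_bounds (M : set (axisym_data R)) (R0 : R) :
  uniformly_asymptotically_flat M R0 ->
  exists C : R, 0 <= C /\ forall g, M g -> forall x z, 0 <= x -> 0 < radius x z ->
   R0 <= radius x z ->
   [/\ `|on2 (ax_u g) (x, z)| <= C / radius x z,
       `|on2 (ax_alpha g) (x, z)| <= C / radius x z,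
       forall i, `|on2 (partial i (ax_u g)) (x, z)| <= C / radius x z ^+ 2 &
       forall i, `|on2 (partial i (ax_alpha g)) (x, z)| <= C / radius x z ^+ 2].
Proof.
move=> [C HC]; exists `|C|; split=> // g Mg x z x0 r0 Rr.
have le1 (y : R) n : y <= C / radius x z ^+ n -> y <= `|C| / radius x z ^+ n.
  move=> h; apply: (le_trans h); apply: ler_wpM2r; last exact: ler_norm.
  by rewrite invr_ge0 exprn_ge0 // ltW.
have H (s : seq 'I_2) := HC g Mg (vec2 x z) s.
rewrite vec2E /= enorm_vec2 in H.
have [h1 h2 _ _] := H [::] x0 r0 Rr isT.
split.
- by have := le1 _ _ h1; rewrite /= addn0 expr1.
- by have := le1 _ _ h2; rewrite /= addn0 expr1.
- by move=> i; have [h _ _ _] := H [:: i] x0 r0 Rr isT; exact: le1 h.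
- by move=> i; have [_ h _ _] := H [:: i] x0 r0 Rr isT; exact: le1 h.
Qed.

Variable g : axisym_data R.
Hypothesis Hg : axisymmetric_metric g.

Let Hs : [/\ smooth (ax_u g), smooth (ax_alpha g), smooth (ax_A g) & smooth (ax_B g)].
Proof. by case: Hg. Qed.

(** The decay is taken from the Cartesian metric, as [|A|, |B| <= C / r] only bounds [rho A] and
    [rho B]. The radius [r1] depends on the metric; this is harmless because it serves a limit
    [r --> +oo] for that metric alone. *)
Lemma off_diag_decay (eta : R) : 0 < eta -> exists r1 : R, 0 < r1 /\
  forall x z, 0 < x -> r1 <= radius x z ->
   let r := radius x z in let t := (Num.sqrt r)^-1 in
   [/\ `|ca_m g (vec2 x z)| <= eta * t, `|ca_n g (vec2 x z)| <= eta * t,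
       forall i, `|ca_dm g i (vec2 x z)| <= eta * t / r
     & forall i, `|ca_dn g i (vec2 x z)| <= eta * t / r].
Proof.
move=> eta0; have [_ _ _ [tau [C [r0 [tau2 r00 H]]]]] := Hg.
have [r1 [r10 Hr]] := powR_decay C tau2 eta0.
exists (Num.max r0 r1); split; first by rewrite lt_max r00.
move=> x z x0; rewrite ge_max => /andP[rr0 rr1] r t.
have [p1 p2] := Hr _ rr1.
have en : enorm (vec3 x 0 z) = radius x z.
  by rewrite /enorm sum_ord3 !vec3E /= expr0n /= addr0.
have H01 (i j : 'I_3) (s : seq 'I_3) : (i == j) = false -> (size s <= 2)%N ->
    `|partials s (fun y => ax_cart g y i j) (vec3 x 0 z)|
    <= C / (radius x z `^ (tau + (size s)%:R)).
  move=> ij ss; have := H i j s (vec3 x 0 z) ss; rewrite en ij => /(_ rr0).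
  by under [fun y => _ - _]funext do rewrite subr0.
have [e1 e2 [e3 e4] [e5 e6]] := cart_off_diag Hg z x0.
split.
- rewrite -e1; apply: le_trans p1; have := H01 0 1 [::] erefl isT.
  by rewrite /= addr0.
- rewrite -e2; apply: le_trans p1; have := H01 1 2 [::] erefl isT.
  by rewrite /= addr0.
- case=> [[|[|//]]] ?; apply: le_trans p2.
    rewrite [Ordinal _](_ : _ = 0); last exact/val_inj.
    by rewrite -e3; exact: (H01 0 1 [:: 0] erefl isT).
  rewrite [Ordinal _](_ : _ = 1); last exact/val_inj.
  by rewrite -e4; exact: (H01 0 1 [:: 2] erefl isT).
- case=> [[|[|//]]] ?; apply: le_trans p2.
    rewrite [Ordinal _](_ : _ = 0); last exact/val_inj.
    by rewrite -e5; exact: (H01 1 2 [:: 0] erefl isT).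
  rewrite [Ordinal _](_ : _ = 1); last exact/val_inj.
  by rewrite -e6; exact: (H01 1 2 [:: 2] erefl isT).
Qed.

Lemma adm_form_axis z : adm_form g (vec2 0 z) = 0.
Proof. by rewrite /adm_form /ca_m /ca_n !vec2E /=; ring. Qed.

Lemma adm_form_bound (C R0 eta : R) : 0 <= C ->
  (forall x z, 0 <= x -> 0 < radius x z -> R0 <= radius x z ->
   [/\ `|on2 (ax_u g) (x, z)| <= C / radius x z,
       `|on2 (ax_alpha g) (x, z)| <= C / radius x z,
       forall i, `|on2 (partial i (ax_u g)) (x, z)| <= C / radius x z ^+ 2 &
       forall i, `|on2 (partial i (ax_alpha g)) (x, z)| <= C / radius x z ^+ 2]) ->
  0 < eta -> exists r1 : R, 0 < r1 /\ forall x z, 0 <= x -> r1 <= radius x z ->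
   `|adm_form g (vec2 x z) - (Wr g (x, z) * x + Wz g (x, z) * z)| <= eta.
Proof.
move=> C0 HC eta0.
(* [e <= 1] and [e <= eta / 72] give [36 e^2 <= eta / 2]; the entry [240 C^2 / eta] of the radius
   below gives [120 C^2 / r <= eta / 2]. *)
pose e := Num.min 1 (eta / 72).
have e0 : 0 < e by rewrite lt_min ltr01 divr_gt0.
have [r1 [r10 Hr]] := off_diag_decay e0.
pose r2 := Num.max (Num.max r1 R0) (Num.max (8 * C) (240 * C ^+ 2 / eta)).
exists r2; split; first by rewrite !lt_max r10.
move=> x z; rewrite le_eqVlt => /predU1P[<-|x0].
  move=> _; rewrite adm_form_axis /Wr /Wz /= !mul0r mulr0.
  by rewrite addr0 subr0 normr0 ltW.
rewrite /r2 !ge_max => /andP[/andP[rr1 rR] /andP[r8 rC]].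
have r0 : 0 < radius x z by exact: lt_le_trans rr1.
have [h1 h2 h3 h4] := Hr x z x0 rr1.
have [k1 k2 k3 k4] := HC x z (ltW x0) r0 rR.
have [lx lz] := le_radius x z.
have s0 : 0 < Num.sqrt (radius x z) by rewrite sqrtr_gt0.
have rt : radius x z * (Num.sqrt (radius x z))^-1 ^+ 2 = 1.
  by rewrite exprVn sqr_sqrtr ?ltW // divff // gt_eqF.
have t0 : 0 <= (Num.sqrt (radius x z))^-1 by rewrite invr_ge0 ltW.
have AE := adm_error r0 C0 r8 t0 rt (ltW e0) lx lz k1 k2 (k3 0) (k3 1) (k4 0) (k4 1)
  h1 h2 (h3 0) (h3 1) (h4 0) (h4 1).
have {}AE : `|adm_form g (vec2 x z) - (Wr g (x, z) * x + Wz g (x, z) * z)|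
    <= 120 * C ^+ 2 / radius x z + 36 * e ^+ 2.
  by move: AE; rewrite /adm_form !vec2E.
apply: (le_trans AE).
apply: (@le_trans _ _ (eta / 2 + eta / 2)); last by rewrite -splitr.
apply: lerD.
  rewrite ler_pdivrMr // -ler_pdivrMl ?divr_gt0 //.
  apply: le_trans rC; rewrite le_eqVlt; apply/orP; left; apply/eqP; field.
  by rewrite gt_eqF.
apply: (@le_trans _ _ (36 * e)).
  rewrite ler_pM2l // expr2 ger_pMl //; last by rewrite /e ge_min lexx.
apply: (@le_trans _ _ (36 * (eta / 72))).
  by rewrite ler_pM2l // /e ge_min lexx orbT.
by rewrite le_eqVlt; apply/orP; left; apply/eqP; field.
Qed.

End flux.

(** * Nonnegativity of the energy and its bound by the mass *)

Section mass_bound.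
Context {R : realType}.
Notation mu := (@lebesgue_measure R).
Notation mu2 := (mu \x mu)%E.

Lemma int1_norm_le (a b k : R) (f : R -> R) : a <= b -> continuous f ->
  (forall x, a <= x <= b -> `|f x| <= k) -> `|int1 a b f| <= k * (b - a).
Proof.
move=> ab cf fk; rewrite ler_norml -mulNr; apply/andP; split; last first.
  by apply: int1_le_cst => // x /fk; exact: (le_trans (ler_norm _)).
rewrite -(int1_cst _ ab); apply: le_int1 => //; first by move=> x; exact: cvg_cst.
by move=> x /fk; rewrite ler_norml => /andP[].
Qed.

Variable g : axisym_data R.
Hypothesis Hg : axisymmetric_metric g.

Let Hs : [/\ smooth (ax_u g), smooth (ax_alpha g), smooth (ax_A g) & smooth (ax_B g)].
Proof. by case: Hg. Qed.

Lemma cont_adm_form : continuous (on2 (adm_form g)).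
Proof.
have [su sal sA sB] := Hs.
have cu := cont_on2 su; have cal := cont_on2 sal.
have cA := cont_on2 sA; have cB := cont_on2 sB.
have cdu i := cont_on2 (smooth_partial i su); have cdal i := cont_on2 (smooth_partial i sal).
have cdA i := cont_on2 (smooth_partial i sA); have cdB i := cont_on2 (smooth_partial i sB).
have c1 := @cont_fst R; have c2 := @cont_snd R.
have k2 := @cont_cst R (R * R)%type 2.
have ca : continuous (on2 (ca_a g)).
  exact: (cont_expR (cont_add (cont_mul k2 cal) (cont_opp (cont_mul k2 cu)))).
have cb : continuous (on2 (ca_b g)) by exact: (cont_expR (cont_opp (cont_mul k2 cu))).
have cbi : continuous (on2 (ca_bi g)) by exact: (cont_expR (cont_mul k2 cu)).
have cm : continuous (on2 (ca_m g)).
  rewrite /on2 /ca_m; under eq_fun do rewrite vec2E /=.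
  exact: (cont_mul c1 (cont_mul cb cB)).
have cn : continuous (on2 (ca_n g)).
  rewrite /on2 /ca_n; under eq_fun do rewrite vec2E /=.
  exact: (cont_mul c1 (cont_mul cb cA)).
have cda i : continuous (on2 (ca_da g i)).
  exact: (cont_mul ca (cont_add (cont_mul k2 (cdal i)) (cont_opp (cont_mul k2 (cdu i))))).
have cdb i : continuous (on2 (ca_db g i)).
  exact: (cont_mul cb (cont_opp (cont_mul k2 (cdu i)))).
have cdbi i : continuous (on2 (ca_dbi g i)).
  exact: (cont_mul cbi (cont_mul k2 (cdu i))).
have cdm i : continuous (on2 (ca_dm g i)).
  rewrite /on2 /ca_dm; under eq_fun do rewrite vec2E /=.
  apply: cont_add; last exact: (cont_mul (@cont_cst _ _ _) (cont_mul cb cB)).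
  exact: (cont_mul c1 (cont_add (cont_mul cb (cdB i)) (cont_mul cB (cdb i)))).
have cdn i : continuous (on2 (ca_dn g i)).
  rewrite /on2 /ca_dn; under eq_fun do rewrite vec2E /=.
  apply: cont_add; last exact: (cont_mul (@cont_cst _ _ _) (cont_mul cb cA)).
  exact: (cont_mul c1 (cont_add (cont_mul cb (cdA i)) (cont_mul cA (cdb i)))).
have -> : on2 (adm_form g) = (fun p : R * R =>
  p.1 ^+ 2 * ((on2 (ca_dm g 1) p * on2 (ca_n g) p + on2 (ca_m g) p * on2 (ca_dn g 1) p)
       * on2 (ca_bi g) p + on2 (ca_m g) p * on2 (ca_n g) p * on2 (ca_dbi g 1) p
     - (on2 (ca_da g 0) p + 2 * on2 (ca_n g) p * on2 (ca_dn g 0) p * on2 (ca_bi g) p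
        + on2 (ca_n g) p ^+ 2 * on2 (ca_dbi g 0) p) - on2 (ca_db g 0) p)
  + p.1 * (on2 (ca_a g) p + on2 (ca_m g) p ^+ 2 * on2 (ca_bi g) p - on2 (ca_b g) p)
  + p.2 * p.1 * ((on2 (ca_dm g 0) p * on2 (ca_n g) p + on2 (ca_m g) p * on2 (ca_dn g 0) p)
       * on2 (ca_bi g) p + on2 (ca_m g) p * on2 (ca_n g) p * on2 (ca_dbi g 0) p
     - (on2 (ca_da g 1) p + 2 * on2 (ca_m g) p * on2 (ca_dm g 1) p * on2 (ca_bi g) p
        + on2 (ca_m g) p ^+ 2 * on2 (ca_dbi g 1) p) - on2 (ca_db g 1) p)
  + p.2 * (on2 (ca_m g) p * on2 (ca_n g) p * on2 (ca_bi g) p)).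
  by apply/funext => p; rewrite /on2 /adm_form !vec2E.
have := (cda 0, cda 1, (cdb 0, cdb 1), (cdbi 0, cdbi 1), (cdm 0, cdm 1), (cdn 0, cdn 1)).
clear cu cal cA cB cdu cdal cdA cdB k2 cda cdb cdbi cdm cdn; revert ca cb cbi cm cn.
generalize (on2 (ca_a g)) (on2 (ca_b g)) (on2 (ca_bi g)) (on2 (ca_m g)) (on2 (ca_n g)).
generalize (on2 (ca_da g 0)) (on2 (ca_da g 1)) (on2 (ca_db g 0)) (on2 (ca_db g 1))
  (on2 (ca_dbi g 0)) (on2 (ca_dbi g 1)) (on2 (ca_dm g 0)) (on2 (ca_dm g 1))
  (on2 (ca_dn g 0)) (on2 (ca_dn g 1)).
move=> a0 a1 b0 b1 bi0 bi1 m0 m1 n0 n1 a b bi m n ca cb cbi cm cn.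
move=> [[[[[ca0 ca1] [cb0 cb1]] [cbi0 cbi1]] [cm0 cm1]] [cn0 cn1]].
by cont.
Qed.

Lemma sphere_point_cyl (r t p : R) :
  sphere_point r t p = cyl_to_cart (vec3 (r * sin t) (r * cos t) p).
Proof. by rewrite /sphere_point /cyl_to_cart !vec3E. Qed.

Lemma radius_polar (r t : R) : 0 <= r -> radius (r * sin t) (r * cos t) = r.
Proof.
move=> r0; rewrite /radius !exprMn -mulrDr addrC cos2Dsin2 mulr1 sqrtr_sqr ger0_norm //.
Qed.

(** The integrand does not depend on the longitude, which contributes the factor [2 pi]. *)
Lemma adm_flux_form (r : R) : 0 < r -> adm_flux (ax_cart g) r
  = (16 * pi)^-1 * int1 0 pi (fun t => 2 * pi * on2 (adm_form g) (r * sin t, r * cos t)).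
Proof.
move=> r0; congr (_ * _); apply: eq_int1 => t tpi.
transitivity (int1 0 (2 * pi) (cst (on2 (adm_form g) (r * sin t, r * cos t)))); last first.
  have p0 := pi_gt0 R.
  by rewrite int1_cst ?mulr_ge0 ?ltW // subr0 mulrC.
apply: eq_int1 => p _; rewrite /= sphere_point_cyl.
(* At the poles the area density vanishes, and so does [adm_form] on the axis. *)
have := sin_ge0_pi tpi; rewrite le_eqVlt => /predU1P[s0|s0].
  by rewrite -s0 !mulr0 /on2 /= adm_form_axis.
have q0 : 0 < (vec3 (r * sin t) (r * cos t) p : 'rV[R]_3) 0 0 by rewrite vec3E mulr_gt0.
have := adm_integrand_cyl Hg q0; rewrite enorm_cyl !vec3E /= -/(radius _ _).
rewrite radius_polar ?ltW // /half_plane_part !vec3E /= /on2 /= => <-.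
ring.
Qed.

Lemma cont_W : [/\ continuous (Wr g), continuous (Wz g), continuous (Wr1 g) & continuous (Wz2 g)].
Proof.
have [su sal sA sB] := Hs.
have cal := cont_on2 sal.
have cdu i := cont_on2 (smooth_partial i su); have cdal i := cont_on2 (smooth_partial i sal).
have cddu i j := cont_on2 (smooth_partial i (smooth_partial j su)).
have cddal i j := cont_on2 (smooth_partial i (smooth_partial j sal)).
have c1 := @cont_fst R.
by rewrite /Wr /Wz /Wr1 /Wz2; split; cont.
Qed.

Lemma cont_energy : continuous (energy g).
Proof. by have [_ _ c1 c2] := cont_W; exact: cont_add. Qed.

(** The flux through the axis vanishes because [Wr] reduces there to [2 alpha], which is zero by
    [alpha_axis]. *)
Lemma half_disc_energy (r : R) : 0 <= r -> int2 (half_disc r) (energy g) =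
  int1 0 pi (fun t => Wr g (r * sin t, r * cos t) * (r * sin t)
                      + Wz g (r * sin t, r * cos t) * (r * cos t)).
Proof.
move=> r0; have [c1 c2 c3 c4] := cont_W; have [su sal _ _] := Hs.
apply: (half_disc_div r0 c1 c2 c3 c4).
- move=> x y; rewrite /Wr /Wr1 /=.
  have d0 := is_derive_on2x x y (smooth_partial 0 su).
  have d1 := is_derive_on2x x y (smooth_partial 0 sal).
  have d2 := is_derive_on2x x y sal.
  have dx := is_derive_id x (1 : R).
  apply: (is_derive_eq (is_derive_add (is_derive_mul dx
    (is_derive_sub (is_derive_scale 4 d0) (is_derive_scale 2 d1))) (is_derive_scale 2 d2))).
  rewrite /=; generalize (on2 (partial 0 (partial 0 (ax_u g))) (x, y))
    (on2 (partial 0 (partial 0 (ax_alpha g))) (x, y))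
    (on2 (partial 0 (ax_u g)) (x, y)) (on2 (partial 0 (ax_alpha g)) (x, y)) => a b c d.
  by rewrite [_ * 1]mulr1; ring.
- move=> x y; rewrite /Wz /Wz2 /=.
  have d0 := is_derive_on2y x y (smooth_partial 1 su).
  have d1 := is_derive_on2y x y (smooth_partial 1 sal).
  exact: (is_derive_scale x (is_derive_sub (is_derive_scale 4 d0) (is_derive_scale 2 d1))).
- by move=> y; rewrite /Wr /= mul0r add0r /on2 /= (alpha_axis Hg) mulr0.
Qed.

Hypothesis Hn : nonneg_scalar_curvature g.

Lemma energy_ge (x y : R) : 0 < x ->
  2 * x * (on2 (partial 0 (ax_u g)) (x, y) ^+ 2 + on2 (partial 1 (ax_u g)) (x, y) ^+ 2)
  <= energy g (x, y).
Proof.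
move=> t0; have p0 : 0 < (vec2 x y : 'rV[R]_2) 0 0 by rewrite vec2E.
have := nonneg_scalar_curvature_lap Hs Hn p0; rewrite /lap2 /energy /Wr1 /Wz2 /on2 vec2E /=.
move: (partial 0 (ax_u g) _) (partial 1 (ax_u g) _) (partial 0 (partial 0 (ax_u g)) _)
  (partial 1 (partial 1 (ax_u g)) _) (partial 0 (partial 0 (ax_alpha g)) _)
  (partial 1 (partial 1 (ax_alpha g)) _).
move=> a b c d e f h.
have {}h : 2 * x * (a ^+ 2 + b ^+ 2) <= 2 * x * (2 * (c + d) + 2 * a / x - (e + f)).
  by rewrite ler_pM2l ?mulr_gt0.
apply: (le_trans h); rewrite le_eqVlt; apply/orP; left; apply/eqP; field.
by rewrite gt_eqF.
Qed.

Lemma energy_ge0 (x y : R) : 0 <= x -> 0 <= energy g (x, y).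
Proof.
have H (t : R) : 0 < t -> 0 <= energy g (t, y).
  move=> t0; apply: le_trans (energy_ge y t0).
  by rewrite mulr_ge0 ?addr_ge0 ?sqr_ge0 // mulr_ge0 // ltW.
rewrite le_eqVlt => /predU1P[<-|]; last exact: H.
have cs : continuous (fun x => energy g (x, y)) by exact: (continuous_slice_x (@cont_energy)).
exact: (@continuous_ge0_right R (fun x => energy g (x, y)) cs H).
Qed.

(* The flux identity on half discs exhausts the half plane, and the flux through
   large spheres tends to the mass. *)
Lemma mass_bound (Ms : set (axisym_data R)) (R0 m a b c d : R) :
  uniformly_asymptotically_flat Ms R0 -> Ms g -> is_adm_mass g m -> 0 <= a ->
  int2 (rect a b c d) (energy g) <= 8 * m.
Proof.
move=> /uaf_bounds[C [C0 HC]] Mg Hm a0.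
have p0 := pi_gt0 R; have p0' : (pi : R) != 0 by rewrite gt_eqF.
suff H : forall e : R, 0 < e -> int2 (rect a b c d) (energy g) <= 8 * m + e.
  by apply/ler_addgt0Pr => e; exact: H.
(* The flux of W is integrated over an angle of length [pi], and the ADM flux is one eighth of the
   integral of [adm_form]: the tolerances [e / (2 pi)] and [e / 16] cost [e / 2] each. *)
move=> e e0; pose eta := e / (2 * pi).
have eta0 : 0 < eta by rewrite divr_gt0 // mulr_gt0.
have [r1 [r10 Hr1]] := adm_form_bound Hg C0 (HC g Mg) eta0.
have e16 : 0 < e / 16 by rewrite divr_gt0.
move/cvgrPdist_lt : Hm => /(_ _ e16) [r2 [_ Hr2]].
(* Beyond both thresholds, and large enough for the half disc to contain the rectangle through
   [x + |y| <= r]. *)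
pose r := r1 + `|r2| + 1 + `|a| + `|b| + `|c| + `|d|.
have n (v : R) := normr_ge0 v.
have rr1 : r1 <= r by rewrite /r -!addrA lerDl !addr_ge0.
have r0 : 0 < r by exact: lt_le_trans rr1.
have rr2 : r2 < r.
  apply: (le_lt_trans (ler_norm r2)); rewrite /r.
  have := n a; have := n b; have := n c; have := n d; lra.
have Fl := Hr2 _ rr2; rewrite adm_flux_form // in Fl.
have cs := @cont_sin_arg R r; have cc := @cont_cos_arg R r.
have cE : continuous (fun t => on2 (adm_form g) (r * sin t, r * cos t)).
  exact: (cont_pair (@cont_adm_form) cs cc).
have [cWr cWz _ _] := cont_W.
have cT : continuous (fun t => Wr g (r * sin t, r * cos t) * (r * sin t)
                      + Wz g (r * sin t, r * cos t) * (r * cos t)).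
  by apply: cont_add; apply: cont_mul => //; exact: cont_pair.
rewrite int1Z // in Fl.
have D : `|int1 0 pi (fun t => on2 (adm_form g) (r * sin t, r * cos t))
    - int2 (half_disc r) (energy g)| <= eta * pi.
  rewrite (half_disc_energy (ltW r0)) -int1B // -[X in _ <= eta * X]subr0.
  have cF := cont_add cE (cont_opp cT).
  apply: (int1_norm_le (ltW p0) cF) => t tpi.
  apply: Hr1; first by apply: mulr_ge0; [exact: ltW|exact: sin_ge0_pi].
  by rewrite (radius_polar _ (ltW r0)).
have Q : int2 (rect a b c d) (energy g) <=
  int2 (half_disc r) (energy g).
  have iD := integrable_sub_rect (@measurable_half_disc R r) (@half_disc_rect R r (ltW r0)) (@cont_energy).
  have iR := @integrable_rect R a b c d _ (@cont_energy).
  rewrite /int2 /Rintegral; apply: fine_le.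
  - exact: (integrable_fin_num (measurable_rect a b c d) iR).
  - exact: (integrable_fin_num (@measurable_half_disc R r) iD).
  apply: ge0_subset_integral.
  - exact: measurable_rect.
  - exact: measurable_half_disc.
  - by case/integrableP: iD.
  - by move=> [x y] [/= x0 _]; rewrite lee_fin energy_ge0.
  - move=> [x y] /rectE[/andP[ax xb] /andP[cy yd]]; split=> /=; first exact: le_trans ax.
    have x0 : 0 <= x by exact: le_trans ax.
    have hx : x <= `|b| by exact: (le_trans xb (ler_norm b)).
    have hy : `|y| <= `|c| + `|d|.
      rewrite ler_norml; apply/andP; split.
        have := ler_norm (- c); rewrite normrN; have := n d; lra.
      have := ler_norm d; have := n c; lra.
    rewrite -(real_normK (num_real y)).
    have : x + `|y| <= r by rewrite /r; have := n a; have := n r2; lra.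
    have := n y; nra.
apply: (le_trans Q).
move: Fl D; set I := int1 _ _ _; set J := int2 _ _ => Fl D.
have {}Fl : I <= 8 * m + e / 2.
  move: Fl; have piE (p v : R) : p != 0 -> (16 * p)^-1 * (2 * p * v) = v / 8 by move=> ?; field.
  rewrite piE //.
  rewrite ltr_norml => /andP[h1 h2]; lra.
have {}D : eta * pi = e / 2 /\ `|I - J| <= eta * pi.
  split=> //.
  have piE (p v : R) : p != 0 -> v / (2 * p) * p = v / 2 by move=> ?; field.
  by rewrite /eta piE.
move: D => [-> ]; rewrite ler_norml => /andP[h1 h2]; lra.
Qed.

End mass_bound.

(** * The potential estimate *)

Section green.
Context {R : realType}.

(** Only the pure second derivatives are recorded, those of the Laplacian. *)
Record C2 (f fx fy fxx fyy : R * R -> R) : Prop := MkC2 {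
  C2_c : continuous f;
  C2_cx : continuous fx;
  C2_cy : continuous fy;
  C2_cxx : continuous fxx;
  C2_cyy : continuous fyy;
  C2_x : forall x y : R, is_derive x (1 : R) (fun x => f (x, y)) (fx (x, y));
  C2_y : forall x y : R, is_derive y (1 : R) (fun y => f (x, y)) (fy (x, y));
  C2_xx : forall x y : R, is_derive x (1 : R) (fun x => fx (x, y)) (fxx (x, y));
  C2_yy : forall x y : R, is_derive y (1 : R) (fun y => fy (x, y)) (fyy (x, y)) }.

Lemma C2_add f fx fy fxx fyy h hx hy hxx hyy : C2 f fx fy fxx fyy -> C2 h hx hy hxx hyy ->
  C2 (fun p => f p + h p) (fun p => fx p + hx p) (fun p => fy p + hy p)
     (fun p => fxx p + hxx p) (fun p => fyy p + hyy p).
Proof.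
case=> c1 c2 c3 c4 c5 d1 d2 d3 d4 [] e1 e2 e3 e4 e5 b1 b2 b3 b4.
by split; try exact: cont_add; move=> x y; exact: is_derive_add.
Qed.

Lemma C2_cst (k : R) : C2 (fun _ => k) (fun _ => 0) (fun _ => 0) (fun _ => 0) (fun _ => 0).
Proof. by split; try exact: cont_cst; move=> x y; exact: is_derive_cstf. Qed.

Definition bflux (a b c d : R) (X Y : R * R -> R) : R :=
  int1 c d (fun y => X (b, y) - X (a, y)) + int1 a b (fun x => Y (x, d) - Y (x, c)).

Lemma green a b c d f fx fy fxx fyy h hx hy hxx hyy : a <= b -> c <= d ->
  C2 f fx fy fxx fyy -> C2 h hx hy hxx hyy ->
  int2 (rect a b c d) (fun p => h p * (fxx p + fyy p) - f p * (hxx p + hyy p))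
  = bflux a b c d (fun p => h p * fx p - f p * hx p) (fun p => h p * fy p - f p * hy p).
Proof.
move=> ab cd [c1 c2 c3 c4 c5 d1 d2 d3 d4] [e1 e2 e3 e4 e5 b1 b2 b3 b4].
have cX : continuous (fun p => h p * fxx p - f p * hxx p) by cont.
have cY : continuous (fun p => h p * fyy p - f p * hyy p) by cont.
have -> : (fun p => h p * (fxx p + fyy p) - f p * (hxx p + hyy p))
   = (fun p => (h p * fxx p - f p * hxx p) + (h p * fyy p - f p * hyy p)).
  by apply/funext => p; ring.
rewrite int2D // /bflux; congr (_ + _).
- have H (x y : R) : is_derive x (1 : R) (fun x => h (x, y) * fx (x, y) - f (x, y) * hx (x, y))
      (h (x, y) * fxx (x, y) - f (x, y) * hxx (x, y)).
    have H := is_derive_sub (is_derive_mul (b1 x y) (d3 x y)) (is_derive_mul (d1 x y) (b3 x y)).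
    by apply: (is_derive_eq H); ring.
  exact: (@rect_dx R a b c d (fun p => h p * fx p - f p * hx p) _ ab cX H).
- have H (x y : R) : is_derive y (1 : R) (fun y => h (x, y) * fy (x, y) - f (x, y) * hy (x, y))
      (h (x, y) * fyy (x, y) - f (x, y) * hyy (x, y)).
    have H := is_derive_sub (is_derive_mul (b2 x y) (d4 x y)) (is_derive_mul (d2 x y) (b4 x y)).
    by apply: (is_derive_eq H); ring.
  exact: (@rect_dy R a b c d (fun p => h p * fy p - f p * hy p) _ cd cY H).
Qed.

End green.

(** * The mollified logarithm *)

Section log_kernel.
Context {R : realType}.
Variables (D x1 x2 eps : R).
Hypothesis eps0 : 0 < eps.

Definition sq (p : R * R) : R := (p.1 - x1) ^+ 2 + (p.2 - x2) ^+ 2 + eps ^+ 2.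

Lemma sq_gt0 p : 0 < sq p.
Proof. by rewrite /sq ltr_wpDl ?exprn_gt0 // addr_ge0 ?sqr_ge0. Qed.

(** [ln (D / |p - x|)] with the squared distance mollified to [sq p]; the scale [D] serves to make
    it nonnegative on a given rectangle. *)
Definition LK (p : R * R) : R := 2^-1 * (ln (D ^+ 2) - ln (sq p)).
Definition LKx (p : R * R) : R := - ((p.1 - x1) / sq p).
Definition LKy (p : R * R) : R := - ((p.2 - x2) / sq p).
Definition LKxx (p : R * R) : R := - (sq p)^-1 + 2 * (p.1 - x1) ^+ 2 / sq p ^+ 2.
Definition LKyy (p : R * R) : R := - (sq p)^-1 + 2 * (p.2 - x2) ^+ 2 / sq p ^+ 2.

(** An approximation of [- 2 pi] times the point mass at the pole. *)
Lemma LK_laplacian p : LKxx p + LKyy p = - (2 * eps ^+ 2 / sq p ^+ 2).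
Proof.
have h : sq p != 0 by rewrite gt_eqF // sq_gt0.
have -> : eps ^+ 2 = sq p - (p.1 - x1) ^+ 2 - (p.2 - x2) ^+ 2 by rewrite /sq; ring.
by rewrite /LKxx /LKyy; field.
Qed.

Lemma cont_sq : continuous sq.
Proof.
have c1 := @cont_fst R; have c2 := @cont_snd R.
by rewrite /sq; cont.
Qed.

Lemma cont_ln_sq : continuous (fun p => ln (sq p)).
Proof.
move=> p; have cln : {for sq p, continuous (@ln R)} by apply: continuous_ln; exact: sq_gt0.
exact: continuous_comp (@cont_sq p) cln.
Qed.

Lemma cont_sq_inv : continuous (fun p => (sq p)^-1).
Proof. by apply: cont_inv; [move=> p; rewrite gt_eqF // sq_gt0|exact: cont_sq]. Qed.

Lemma is_derive_inv (f : R -> R) (x df : R) : f x != 0 -> is_derive x (1 : R) f df ->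
  is_derive x (1 : R) (fun y => (f y)^-1) (- df / f x ^+ 2).
Proof.
move=> f0 hf; apply: (is_derive_eq (is_deriveV f0 hf)).
by rewrite [LHS]/GRing.scale /= mulrC mulrN mulNr.
Qed.

Lemma is_derive_ln_comp (f : R -> R) (x df : R) : 0 < f x -> is_derive x (1 : R) f df ->
  is_derive x (1 : R) (fun y => ln (f y)) (df / f x).
Proof.
move=> f0 hf; apply: (is_derive_eq (is_derive_comp1 (is_derive1_ln f0) hf)).
by rewrite mulrC.
Qed.

Lemma LK_C2 : C2 LK LKx LKy LKxx LKyy.
Proof.
have c1 := @cont_fst R; have c2 := @cont_snd R.
have ci := cont_sq_inv; have cl := cont_ln_sq.
have sq0 p : sq p != 0 by rewrite gt_eqF // sq_gt0.
have ci2 : continuous (fun p => (sq p ^+ 2)^-1).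
  by under eq_fun do rewrite -exprVn; exact: cont_exp.
have dx (x y : R) : is_derive x (1 : R) (fun x => sq (x, y)) (2 * (x - x1)).
  have H := is_derive_add (is_derive_add (is_derive_sqr (is_derive_sub
    (is_derive_id x (1 : R)) (is_derive_cstf x1 x 1)))
    (is_derive_cstf ((y - x2) ^+ 2) x 1)) (is_derive_cstf (eps ^+ 2) x 1).
  by apply: (is_derive_eq H); ring.
have dy (x y : R) : is_derive y (1 : R) (fun y => sq (x, y)) (2 * (y - x2)).
  have H := is_derive_add (is_derive_add (is_derive_cstf ((x - x1) ^+ 2) y 1)
    (is_derive_sqr (is_derive_sub (is_derive_id y (1 : R)) (is_derive_cstf x2 y 1))))
    (is_derive_cstf (eps ^+ 2) y 1).
  by apply: (is_derive_eq H); ring.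
split.
- by rewrite /LK; cont.
- by rewrite /LKx; cont.
- by rewrite /LKy; cont.
- by rewrite /LKxx; cont.
- by rewrite /LKyy; cont.
- move=> x y; have H := is_derive_scale 2^-1 (is_derive_sub
    (is_derive_cstf (ln (D ^+ 2)) x 1) (@is_derive_ln_comp (fun x => sq (x, y)) x _ (sq_gt0 (x, y)) (dx x y))).
  by apply: (is_derive_eq H); rewrite /LKx /=; have := sq0 (x, y); move: (sq (x, y)) => q q0; field.
- move=> x y; have H := is_derive_scale 2^-1 (is_derive_sub
    (is_derive_cstf (ln (D ^+ 2)) y 1) (@is_derive_ln_comp (fun y => sq (x, y)) y _ (sq_gt0 (x, y)) (dy x y))).
  by apply: (is_derive_eq H); rewrite /LKy /=; have := sq0 (x, y); move: (sq (x, y)) => q q0; field.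
- move=> x y; have H := is_derive_opp (is_derive_mul (is_derive_sub (is_derive_id x (1 : R))
    (is_derive_cstf x1 x 1)) (@is_derive_inv (fun x => sq (x, y)) x _ (sq0 (x, y)) (dx x y))).
  by apply: (is_derive_eq H); rewrite /LKxx /=; have := sq0 (x, y); move: (sq (x, y)) => q q0; field.
- move=> x y; have H := is_derive_opp (is_derive_mul (is_derive_sub (is_derive_id y (1 : R))
    (is_derive_cstf x2 y 1)) (@is_derive_inv (fun y => sq (x, y)) y _ (sq0 (x, y)) (dy x y))).
  by apply: (is_derive_eq H); rewrite /LKyy /=; have := sq0 (x, y); move: (sq (x, y)) => q q0; field.
Qed.

End log_kernel.

(** * Integrals of the inverse square root of a distance *)

Section weight.
Context {R : realType}.

(* [wgt y = y^(-1/4)] for [y > 0]. *)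
Definition wgt (y : R) : R := expR (- (ln y / 4)).

Lemma wgt_gt0 y : 0 < wgt y.
Proof. exact: expR_gt0. Qed.

Lemma wgt_le x y : 0 < x -> x <= y -> wgt y <= wgt x.
Proof.
move=> x0 xy; rewrite /wgt ler_expR lerN2 ler_pM2r ?invr_gt0 //.
by rewrite ler_ln // posrE // (lt_le_trans x0).
Qed.

(** With squared distances as arguments this bounds [|p|^(-1)] by [|p_1|^(-1/2) |p_2|^(-1/2)], a
    product of integrable functions of one variable. *)
Lemma wgt_sqr_le x y z : 0 < x -> 0 < y -> x <= z -> y <= z -> wgt z ^+ 2 <= wgt x * wgt y.
Proof.
move=> x0 y0 xz yz; by rewrite expr2; apply: ler_pM; [exact: expR_ge0|exact: expR_ge0|exact: wgt_le|exact: wgt_le].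
Qed.

Variable eps : R.
Hypothesis eps0 : 0 < eps.

Lemma sqr_eps_gt0 (s : R) : 0 < s ^+ 2 + eps ^+ 2.
Proof. by rewrite ltr_wpDl ?sqr_ge0 // exprn_gt0. Qed.

(** A mollified [sign s |s|^(1/2)]. Its derivative is at least half the weight, so it replaces a
    primitive, with bounds that do not degenerate as [eps] tends to 0. *)
Definition wH (s : R) : R := s * wgt (s ^+ 2 + eps ^+ 2).

Lemma wH_bound s : `|wH s| <= 1 + s ^+ 2 + eps ^+ 2.
Proof.
have y0 := sqr_eps_gt0 s; set y := s ^+ 2 + eps ^+ 2 in y0 *.
have hs : `|s| <= expR (ln y / 2).
  rewrite -(@ler_pXn2r _ 2) ?nnegrE ?expR_ge0 // real_normK ?num_real //.
  rewrite -expRM_natl mulrC divfK ?pnatr_eq0 // lnK // /y lerDl sqr_ge0 //.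
rewrite /wH normrM (gtr0_norm (wgt_gt0 _)) -/y.
apply: (@le_trans _ _ (expR (ln y / 2) * wgt y)); first by rewrite ler_pM2r ?wgt_gt0.
rewrite /wgt -expRD.
have -> : ln y / 2 - ln y / 4 = ln y / 4 by field.
rewrite -addrA -/y; have [y1|y1] := leP y 1.
  apply: (@le_trans _ _ 1); last by rewrite lerDl ltW.
  by rewrite -expR0 ler_expR pmulr_lle0 // ln_le0.
apply: (@le_trans _ _ y); last by rewrite lerDr.
rewrite -{2}(lnK y0) ler_expR ler_pdivrMr //.
by apply: ler_peMr; [apply: ln_ge0; exact: ltW|rewrite ler1n].
Qed.

Definition wdH (s : R) : R :=
  wgt (s ^+ 2 + eps ^+ 2) * (1 - s ^+ 2 / (2 * (s ^+ 2 + eps ^+ 2))).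

Lemma wdH_ge s : wgt (s ^+ 2 + eps ^+ 2) <= 2 * wdH s.
Proof.
have y0 := sqr_eps_gt0 s; have w0 := wgt_gt0 (s ^+ 2 + eps ^+ 2).
rewrite /wdH mulrCA -[leLHS]mulr1; rewrite ler_pM2l // mulrBr mulr1.
have : s ^+ 2 / (2 * (s ^+ 2 + eps ^+ 2)) <= 2^-1.
  rewrite ler_pdivrMr ?mulr_gt0 //.
  by rewrite mulKf ?pnatr_eq0 // lerDl sqr_ge0.
lra.
Qed.

Lemma is_derive_wH (c : R -> R) (t dc : R) : is_derive t (1 : R) c dc ->
  is_derive t (1 : R) (fun t => wH (c t)) (wdH (c t) * dc).
Proof.
move=> hc; have y0 := sqr_eps_gt0 (c t).
have hy := is_derive_add (is_derive_sqr hc) (is_derive_cstf (eps ^+ 2) t 1).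
have hl := @is_derive_ln_comp _ (fun t => c t ^+ 2 + eps ^+ 2) t _ y0 hy.
have hw := is_derive_comp1 (is_derive_expR _) (is_derive_opp (is_derive_mul hl (is_derive_cstf 4^-1 t 1))).
apply: (is_derive_eq (is_derive_mul hc hw)).
rewrite /wdH /wgt /=; set w := expR _; move: w y0 => w; move: (c t) => s y0.
have y0' : s ^+ 2 + eps ^+ 2 != 0 by rewrite gt_eqF.
by field.
Qed.

Lemma cont_wgt (T : topologicalType) (f : T -> R) : (forall t, 0 < f t) -> continuous f ->
  continuous (fun t => wgt (f t)).
Proof.
move=> f0 cf; rewrite /wgt; apply: cont_comp; first exact: continuous_expR.
apply: cont_opp; apply: cont_mul; last exact: cont_cst.
move=> t; have cln : {for f t, continuous (@ln R)} by apply: continuous_ln; exact: f0.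
exact: continuous_comp (cf t) cln.
Qed.

(** Where [|c'| >= lam], with constant sign, the weight is at most [2 / lam] times the derivative of
    [wH (c t - y)] up to sign, and the integral telescopes. The result is uniform in the pole [y] as
    long as [|c t - y| <= M]. *)
Lemma int1_wgt (a b lam M y : R) (c dc : R -> R) : a <= b -> 0 < lam ->
  continuous dc -> (forall t : R, is_derive t (1 : R) c (dc t)) ->
  (forall t, a <= t <= b -> `|c t - y| <= M) ->
  (forall t, a <= t <= b -> lam <= dc t) \/ (forall t, a <= t <= b -> dc t <= - lam) ->
  int1 a b (fun t => wgt ((c t - y) ^+ 2 + eps ^+ 2)) <= 4 / lam * (1 + M ^+ 2 + eps ^+ 2).
Proof.
move=> ab lam0 cdc Hc HM Hlam.
have cc := is_derive_continuous Hc.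
have cs : continuous (fun t => c t - y) by apply: cont_add; [exact: cc|exact: cont_cst].
have csq : continuous (fun t => (c t - y) ^+ 2 + eps ^+ 2) by cont.
have sq0 t := sqr_eps_gt0 (c t - y).
have cw := cont_wgt sq0 csq.
have cdH : continuous (fun t => wdH (c t - y)).
  rewrite /wdH; apply: cont_mul => //; apply: cont_add; first exact: cont_cst.
  apply: cont_opp; apply: cont_mul; first by cont.
  apply: cont_inv; first by move=> t; rewrite mulf_neq0 // gt_eqF.
  by apply: cont_mul => //; exact: cont_cst.
have dH (t : R) : is_derive t (1 : R) (fun t => wH (c t - y)) (wdH (c t - y) * dc t).
  apply: is_derive_wH.
  by apply: (is_derive_eq (is_derive_sub (Hc t) (is_derive_cstf y t 1))); rewrite subr0.
have cK : continuous (fun t => wdH (c t - y) * dc t) by exact: cont_mul.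
have HH : `|wH (c b - y) - wH (c a - y)| <= 2 * (1 + M ^+ 2 + eps ^+ 2).
  have hb t : a <= t <= b -> `|wH (c t - y)| <= 1 + M ^+ 2 + eps ^+ 2.
    move=> tab; apply: (le_trans (wH_bound _)); rewrite lerD2r lerD2l.
    rewrite -(real_normK (num_real (c t - y))) ler_pXn2r ?nnegrE //; first exact: HM.
    exact: (le_trans (normr_ge0 _) (HM t tab)).
  apply: (le_trans (ler_normB _ _)); rewrite mulr2n mulrDl mul1r.
  by apply: lerD; apply: hb; rewrite ?lexx ?ab.
have I := @ftc_seg R (fun t => wH (c t - y)) _ a b ab cK dH.
have w0 t : 0 <= wdH (c t - y).
  by have := wdH_ge (c t - y); have := wgt_gt0 ((c t - y) ^+ 2 + eps ^+ 2); lra.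
case: Hlam => Hl.
- apply: (@le_trans _ _ (int1 a b (fun t => 2 / lam * (wdH (c t - y) * dc t)))).
    apply: le_int1 => //; first by apply: cont_mul => //; exact: cont_cst.
    move=> t tab; apply: (le_trans (wdH_ge _)).
    have -> : 2 / lam * (wdH (c t - y) * dc t) = wdH (c t - y) * (2 * dc t / lam) by ring.
    rewrite mulrC; apply: ler_wpM2l => //.
    by rewrite ler_pdivlMr // ler_pM2l //; exact: Hl.
  rewrite int1Z // I.
  apply: (@le_trans _ _ (2 / lam * `|wH (c b - y) - wH (c a - y)|)).
    by rewrite ler_pM2l ?divr_gt0 // ler_norm.
  apply: (@le_trans _ _ (2 / lam * (2 * (1 + M ^+ 2 + eps ^+ 2)))).
    by rewrite ler_pM2l ?divr_gt0.
  by rewrite le_eqVlt; apply/orP; left; apply/eqP; field; rewrite gt_eqF.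
- apply: (@le_trans _ _ (int1 a b (fun t => - (2 / lam) * (wdH (c t - y) * dc t)))).
    apply: le_int1 => //; first by apply: cont_mul => //; exact: cont_cst.
    move=> t tab; apply: (le_trans (wdH_ge _)).
    have -> : - (2 / lam) * (wdH (c t - y) * dc t) = wdH (c t - y) * (2 * - dc t / lam) by ring.
    rewrite mulrC; apply: ler_wpM2l => //.
    by rewrite ler_pdivlMr // ler_pM2l // lerNr; exact: Hl.
  rewrite int1Z // I.
  apply: (@le_trans _ _ (2 / lam * `|wH (c b - y) - wH (c a - y)|)).
    rewrite mulNr -mulrN ler_pM2l ?divr_gt0 //.
    by rewrite -normrN ler_norm.
  apply: (@le_trans _ _ (2 / lam * (2 * (1 + M ^+ 2 + eps ^+ 2)))).
    by rewrite ler_pM2l ?divr_gt0.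
  by rewrite le_eqVlt; apply/orP; left; apply/eqP; field; rewrite gt_eqF.
Qed.

Lemma int1_wgt_id (a b M y : R) : a <= b -> `|a - y| <= M -> `|b - y| <= M ->
  int1 a b (fun t => wgt ((t - y) ^+ 2 + eps ^+ 2)) <= 4 * (1 + M ^+ 2 + eps ^+ 2).
Proof.
move=> ab; rewrite !ler_norml => /andP[a1 a2] /andP[b1 b2].
have H := @int1_wgt a b 1 M y id (cst 1) ab ltr01 (@cont_cst _ _ 1)
  (fun t => is_derive_id t (1 : R)).
rewrite divr1 in H; apply: H.
  by move=> t /andP[at_ tb]; rewrite ler_norml; apply/andP; split; lra.
by left.
Qed.

End weight.

(** * The kernel reflected in rho = r0 *)

Section reflected_kernel.
Context {R : realType}.
Variables (r0 sg r1 L x1 x2 eps : R).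
Hypotheses (r0_gt0 : 0 < r0) (sg_gt0 : 0 < sg) (r01 : r0 < r1) (r1L : 2 * r1 <= L).
Hypotheses (x1_ge : r0 + sg <= x1) (x1_le : x1 <= r1) (x2_le : `|x2| <= r1 / 2).
Hypotheses (eps0 : 0 < eps) (epsL : eps <= L).

Notation x1' := (2 * r0 - x1).
Notation D := (8 * L).

Ltac geo := pose proof r0_gt0; pose proof sg_gt0; pose proof r01; pose proof r1L;
  pose proof x1_ge; pose proof x1_le; pose proof eps0; pose proof epsL.

Lemma L_gt0 : 0 < L. Proof. geo; lra. Qed.
Let L0 := L_gt0.

Notation s := (sq x1 x2 eps).
Notation s' := (sq x1' x2 eps).

(* The reflection in [rho = r0] makes the normal derivative vanish there. *)
Definition GK (p : R * R) := LK D x1 x2 eps p + LK D x1' x2 eps p.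
Definition GKx (p : R * R) := LKx x1 x2 eps p + LKx x1' x2 eps p.
Definition GKy (p : R * R) := LKy x1 x2 eps p + LKy x1' x2 eps p.
Definition GKxx (p : R * R) := LKxx x1 x2 eps p + LKxx x1' x2 eps p.
Definition GKyy (p : R * R) := LKyy x1 x2 eps p + LKyy x1' x2 eps p.

Lemma GK_C2 : C2 GK GKx GKy GKxx GKyy.
Proof. by apply: C2_add; exact: LK_C2. Qed.

Definition KK (p : R * R) : R := 2 * eps ^+ 2 / s p ^+ 2 + 2 * eps ^+ 2 / s' p ^+ 2.

Lemma KKE p : GKxx p + GKyy p = - KK p.
Proof.
have h1 := LK_laplacian x1 x2 eps0 p; have h2 := LK_laplacian x1' x2 eps0 p.
by rewrite /GKxx /GKyy addrACA h1 h2 /KK opprD.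
Qed.

Lemma KK_ge0 p : 0 <= KK p.
Proof.
by rewrite /KK addr_ge0 // divr_ge0 ?sqr_ge0 // mulr_ge0 ?sqr_ge0.
Qed.

Let x2b : - (L / 4) <= x2 <= L / 4.
Proof. geo; by rewrite -ler_norml; apply: (le_trans x2_le); lra. Qed.

Lemma s_le_s' y1 y2 : r0 <= y1 -> s (y1, y2) <= s' (y1, y2).
Proof.
geo.
move=> hy; rewrite /sq /= !lerD2r.
have -> : (y1 - x1') ^+ 2 = (y1 - x1) ^+ 2 + 4 * ((y1 - r0) * (x1 - r0)) by ring.
by rewrite lerDl mulr_ge0 // mulr_ge0 //; lra.
Qed.

Lemma s'_le y1 y2 : r0 <= y1 <= L -> - L <= y2 <= L -> s' (y1, y2) <= 5 * L ^+ 2.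
Proof.
geo.
move=> /andP[h1 h2] /andP[h3 h4]; rewrite /sq /=.
have /andP[b1 b2] := x2b.
have e1 : (y1 - x1') ^+ 2 <= (3 / 2 * L) ^+ 2.
  by rewrite ler_pXn2r ?nnegrE //; lra.
have e2 : (y2 - x2) ^+ 2 <= (5 / 4 * L) ^+ 2.
  rewrite -(real_normK (num_real (y2 - x2))) ler_pXn2r ?nnegrE //; first by rewrite ler_norml; apply/andP; split; lra.
  lra.
have e3 : eps ^+ 2 <= L ^+ 2 by rewrite ler_pXn2r ?nnegrE //; lra.
have := sqr_ge0 L; nra.
Qed.

(** [8 L] exceeds the mollified distance from any point of the rectangle to either pole, and the
    reflected pole is the farther one. *)
Lemma LK_bounds y1 y2 : r0 <= y1 <= L -> - L <= y2 <= L ->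
  0 <= LK D x1' x2 eps (y1, y2) <= LK D x1 x2 eps (y1, y2).
Proof.
geo.
move=> hy1 hy2; have hs := s'_le hy1 hy2; have /andP[hy1' _] := hy1.
have hs' := s_le_s' y2 hy1'.
have p1 := sq_gt0 x1 x2 eps0 (y1, y2); have p2 := sq_gt0 x1' x2 eps0 (y1, y2).
have D0 : 0 < D ^+ 2 by rewrite exprn_gt0 // mulr_gt0.
rewrite /LK; apply/andP; split.
  rewrite mulr_ge0 ?invr_ge0 // subr_ge0 ler_ln ?posrE //.
  apply: (le_trans hs); rewrite exprMn; apply: ler_wpM2r; first exact: sqr_ge0.
  by rewrite -natrX ler_nat.
by rewrite ler_pM2l ?invr_gt0 // lerD2l lerN2 ler_ln ?posrE.
Qed.

Lemma GK_bounds y1 y2 : r0 <= y1 <= L -> - L <= y2 <= L ->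
  0 <= GK (y1, y2) <= 2 * LK D x1 x2 eps (y1, y2).
Proof.
geo.
move=> hy1 hy2; have /andP[h1 h2] := LK_bounds hy1 hy2.
rewrite /GK; apply/andP; split; lra.
Qed.

Lemma GK_axis y : GKx (r0, y) = 0.
Proof.
rewrite /GKx /LKx.
have -> : s' (r0, y) = s (r0, y) by rewrite /sq /=; ring.
by rewrite /= -opprD -mulrDl -[X in X / _]/(_) (_ : _ + _ = 0) ?mul0r ?oppr0 //; ring.
Qed.

(** [ln q <= q] at [q = sqrt (D / t)]. For fixed [t] the bound grows like [sqrt L], which the decay
    [1 / L] of the boundary data still beats. *)
Lemma LK_le t p : 0 < t -> t ^+ 2 <= s p -> LK D x1 x2 eps p <= 2 * Num.sqrt (D / t).
Proof.
move=> t0 ts; have p1 := sq_gt0 x1 x2 eps0 p.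
have D0 : 0 < D by rewrite mulr_gt0.
have q0 : 0 < Num.sqrt (D / t) by rewrite sqrtr_gt0 divr_gt0.
have -> : 2 * Num.sqrt (D / t) = 2^-1 * (4 * Num.sqrt (D / t)) by field.
rewrite /LK ler_pM2l ?invr_gt0 //.
apply: (@le_trans _ _ (ln (D ^+ 2) - ln (t ^+ 2))).
  by rewrite lerD2l lerN2 ler_ln ?posrE // exprn_gt0.
rewrite -ln_div ?posrE ?exprn_gt0 // -expr_div_n.
have -> : (D / t) ^+ 2 = Num.sqrt (D / t) ^+ 4.
  by rewrite (exprM _ 2 2) sqr_sqrtr // divr_ge0 // ltW.
rewrite lnXn // -[leLHS]mulr_natl ler_pM2l //.
have := @ln_sublinear R _ q0; lra.
Qed.

Lemma sq_outer y1 y2 : r0 <= y1 <= L -> - L <= y2 <= L -> y1 = L \/ `|y2| = L ->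
  (L / 2) ^+ 2 <= s (y1, y2).
Proof.
geo.
move=> /andP[h1 h2] /andP[h3 h4] ho; rewrite /sq /=.
have /andP[b1 b2] := x2b; have L20 : 0 <= L / 2 by lra.
case: ho => [->|ho].
  have : (L / 2) ^+ 2 <= (L - x1) ^+ 2 by rewrite ler_pXn2r ?nnegrE //; lra.
  by have := sqr_ge0 (y2 - x2); have := sqr_ge0 eps; lra.
have : (L / 2) ^+ 2 <= (y2 - x2) ^+ 2.
  rewrite -(real_normK (num_real (y2 - x2))) ler_pXn2r ?nnegrE //.
  apply: (@le_trans _ _ (`|y2| - `|x2|)); last exact: lerB_dist.
  have hx : `|x2| <= L / 4 by rewrite ler_norml.
  by rewrite ho; lra.
by have := sqr_ge0 (y1 - x1); have := sqr_ge0 eps; lra.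
Qed.

(** The outer sides stay at distance [L / 2] from both poles: 16 is [4 sqrt (8 L / (L / 2))], and
    [12 / L] is twice [(3 L / 2) / (L / 2)^2]. *)
Lemma GK_outer y1 y2 : r0 <= y1 <= L -> - L <= y2 <= L -> y1 = L \/ `|y2| = L ->
  [/\ `|GK (y1, y2)| <= 16, `|GKx (y1, y2)| <= 12 / L & `|GKy (y1, y2)| <= 12 / L].
Proof.
geo.
move=> hy1 hy2 ho; have so := sq_outer hy1 hy2 ho.
have /andP[g0 g1] := GK_bounds hy1 hy2.
have /andP[hy1' hy1''] := hy1; have /andP[hy2' hy2''] := hy2.
have so' := le_trans so (s_le_s' y2 hy1').
have L20 : 0 < L / 2 by lra.
have /andP[b1 b2] := x2b.
have frac (t q : R) : `|t| <= 3 / 2 * L -> (L / 2) ^+ 2 <= q -> `|- (t / q)| <= 6 / L.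
  move=> ht hq; have q0 : 0 < q by apply: lt_le_trans hq; rewrite exprn_gt0.
  rewrite normrN normrM normfV (gtr0_norm q0) ler_pdivrMr //.
  apply: (le_trans ht); apply: (@le_trans _ _ (6 / L * (L / 2) ^+ 2)).
    by rewrite le_eqVlt; apply/orP; left; apply/eqP; field; rewrite gt_eqF.
  by rewrite ler_pM2l // divr_gt0.
have e12 : 12 / L = 6 / L + 6 / L by rewrite -mulrDl -natrD.
split.
- rewrite ger0_norm //; apply: (le_trans g1).
  have := LK_le L20 so.
  have -> : D / (L / 2) = 4 ^+ 2 by field; rewrite gt_eqF.
  rewrite sqrtr_sqr ger0_norm //; lra.
- rewrite e12; apply: nleD; apply: frac => //=; rewrite ler_norml; apply/andP; split; lra.
- rewrite e12; apply: nleD; apply: frac => //=; rewrite ler_norml; apply/andP; split; lra.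
Qed.

(** The total charge of [KK] in the rectangle, in place of the [2 pi] of an unmollified kernel. *)
Definition cflux : R := bflux r0 L (- L) L (fun p => - GKx p) (fun p => - GKy p).

Lemma cfluxE : int2 (rect r0 L (- L) L) KK = cflux.
Proof.
geo.
have rL : r0 <= L by lra.
have LL : - L <= L by lra.
have := green rL LL (C2_cst 1) GK_C2.
rewrite /cflux; have -> : (fun p => GK p * (0 + 0) - 1 * (GKxx p + GKyy p)) = KK.
  by apply/funext => p; rewrite KKE; ring.
have -> : (fun p => GK p * 0 - 1 * GKx p) = (fun p => - GKx p).
  by apply/funext => p; ring.
have -> // : (fun p => GK p * 0 - 1 * GKy p) = (fun p => - GKy p).
by apply/funext => p; ring.
Qed.

(** Below: on the side rho = L the true pole contributes a density of at least [(L / 2) / (5 L^2)]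
    over the length [2 L], and nothing else is negative. Above: the density is at most [12 / L] on
    outer sides of total length at most [4 L]. Both bounds are uniform in the pole and in [eps]. *)
Lemma cflux_bounds : 5^-1 <= cflux <= 48.
Proof.
geo.
have [c1 c2 c3 c4 c5 _ _ _ _] := GK_C2.
have rL : r0 <= L by lra.
have LL : - L <= L by lra.
have cx : continuous (fun y => - GKx (L, y) - - GKx (r0, y)).
  have h1 := @continuous_slice_y _ _ L c2; have h2 := @continuous_slice_y _ _ r0 c2; cont.
have cy : continuous (fun x => - GKy (x, L) - - GKy (x, - L)).
  have h1 := @continuous_slice_x _ _ L c3; have h2 := @continuous_slice_x _ _ (- L) c3; cont.
have hrL : r0 <= L <= L by rewrite rL lexx.
have hL1 : - L <= L <= L by rewrite LL lexx.
have hL2 : - L <= - L <= L by rewrite LL lexx.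
have nL : `|L| = L by rewrite gtr0_norm.
have nNL : `|- L| = L by rewrite normrN gtr0_norm.
have /andP[b1 b2] := x2b.
have Lv0 : 0 < L^-1 by rewrite invr_gt0.
rewrite /cflux /bflux; apply/andP; split.
- apply: (@le_trans _ _ (int1 (- L) L (cst (10 * L)^-1) + int1 r0 L (cst 0))).
    rewrite !int1_cst // mul0r addr0 le_eqVlt; apply/orP; left; apply/eqP; field.
    by rewrite gt_eqF.
  apply: lerD; apply: le_int1 => //; try (by move=> t; exact: cvg_cst).
    move=> y hy; rewrite GK_axis oppr0 subr0 /GKx /LKx opprD !opprK /=.
    have h2 := s'_le hrL hy; have h1 := le_trans (s_le_s' y rL) h2.
    have p1 := sq_gt0 x1 x2 eps0 (L, y); have p2 := sq_gt0 x1' x2 eps0 (L, y).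
    apply: ler_wpDr; first by rewrite divr_ge0 ?ltW //; lra.
    rewrite ler_pdivlMr // invfM -mulrA ler_pdivrMl //.
    rewrite ler_pdivrMl //; have := sqr_ge0 L; nra.
  move=> x /andP[hx1 hx2]; rewrite opprK /= /GKy /LKy /=.
  have p1 := sq_gt0 x1 x2 eps0 (x, L); have p2 := sq_gt0 x1' x2 eps0 (x, L).
  have p3 := sq_gt0 x1 x2 eps0 (x, - L); have p4 := sq_gt0 x1' x2 eps0 (x, - L).
  rewrite opprD !opprK -!mulNr.
  by rewrite !addr_ge0 // divr_ge0 ?ltW //; lra.
- apply: (@le_trans _ _ (12 / L * (L - - L) + 24 / L * (L - r0))).
    apply: lerD; apply: int1_le_cst => //.
      move=> y hy; rewrite GK_axis oppr0 subr0.
      have [_ h _] := GK_outer hrL hy (or_introl erefl).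
      by apply: le_trans h; rewrite -normrN ler_norm.
    move=> x hx; rewrite opprK.
    have [_ _ h1] := GK_outer hx hL1 (or_intror nL).
    have [_ _ h2] := GK_outer hx hL2 (or_intror nNL).
    have -> : 24 / L = 12 / L + 12 / L by rewrite -mulrDl -natrD.
    apply: lerD; last exact: le_trans (ler_norm _) h2.
    by apply: le_trans h1; rewrite -normrN ler_norm.
  apply: (@le_trans _ _ (12 / L * (L - - L) + 24 / L * L)).
    by rewrite lerD2l; apply: ler_wpM2l; [rewrite divr_ge0 // ltW|lra].
  rewrite le_eqVlt; apply/orP; left; apply/eqP; field; by rewrite gt_eqF.
Qed.

End reflected_kernel.

(** * Pointwise bounds from Green's representation *)

Section potential.
Context {R : realType}.
Variables (r0 sg r1 L C lam M : R).
Variables (w wx wy wxx wyy v e : R * R -> R).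
Hypotheses (r0_gt0 : 0 < r0) (sg_gt0 : 0 < sg) (r01 : r0 < r1) (r1L : 2 * r1 <= L).
Hypotheses (C_ge0 : 0 <= C) (lam_gt0 : 0 < lam).
Hypothesis w2 : C2 w wx wy wxx wyy.
Hypotheses (ce : continuous e).
Hypothesis Hpde : forall x y, r0 <= x ->
  wxx (x, y) + wyy (x, y) = 2 * v (x, y) / x - e (x, y) / (2 * x).
Hypothesis Hv : forall x y, r0 <= x -> v (x, y) ^+ 2 <= e (x, y) / (2 * x).
Hypothesis Hmono : forall y, wx (r0, y) <= 0.
Hypothesis Hout : forall x y, r0 <= x <= L -> - L <= y <= L -> x = L \/ `|y| = L ->
  [/\ `|w (x, y)| <= 3 * C / L, `|wx (x, y)| <= 3 * C / L ^+ 2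
    & `|wy (x, y)| <= 3 * C / L ^+ 2].
Hypothesis Hmass : int2 (rect r0 L (- L) L) e <= M.

Ltac geo := pose proof r0_gt0 as geo1; pose proof sg_gt0 as geo2; pose proof r01 as geo3;
  pose proof r1L as geo4; pose proof C_ge0 as geo5; pose proof lam_gt0 as geo6.

Notation Q := (rect r0 L (- L) L).
(* [k0 e] dominates the part of [2 v / x] left over after absorbing [lam]. *)
Definition k0 : R := (2 * lam * r0 ^+ 3)^-1.

Let L0 : 0 < L. Proof. geo; lra. Qed.
Let rL : r0 <= L. Proof. geo; lra. Qed.
Let LL : - L <= L. Proof. pose proof L0; lra. Qed.
Let k0_ge0 : 0 <= k0.
Proof. by rewrite /k0 invr_ge0 mulr_ge0 ?exprn_ge0 // ltW // mulr_gt0. Qed.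

Lemma e_ge0 x y : r0 <= x -> 0 <= e (x, y).
Proof.
geo; move=> rx; have x0 : 0 < x by lra.
have := le_trans (sqr_ge0 _) (Hv y rx).
by rewrite pmulr_lge0 // invr_gt0 mulr_gt0.
Qed.

(** Young's inequality for [2 k (v / x)], with [(v / x)^2 <= e / (2 r0^3) = lam k0 e]. *)
Lemma absorb x y k : r0 <= x -> `|k * (2 * v (x, y) / x)| <= lam * k ^+ 2 + k0 * e (x, y).
Proof.
geo; move=> rx; have x0 : 0 < x by lra.
set t := v (x, y) / x.
have -> : k * (2 * v (x, y) / x) = 2 * (k * t) by rewrite /t; ring.
have ht : t ^+ 2 <= lam * (k0 * e (x, y)).
  have := Hv y rx; have := e_ge0 y rx; rewrite /t; move: (e _) (v _) => E V E0 hV.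
  rewrite expr_div_n ler_pdivrMr ?exprn_gt0 //; apply: (le_trans hV).
  have -> : E / (2 * x) = lam * ((2 * lam * x ^+ 3)^-1 * E) * x ^+ 2.
    by field; rewrite !gt_eqF.
  apply: ler_wpM2r; first exact: sqr_ge0.
  rewrite ler_pM2l //; apply: ler_wpM2r => //.
  rewrite /k0 lef_pV2 ?posrE ?mulr_gt0 ?exprn_gt0 //.
  by rewrite ler_pM2l ?mulr_gt0 // ler_pXn2r ?nnegrE // ltW.
have kt : (k * t) ^+ 2 <= (k ^+ 2 * lam) * (k0 * e (x, y)).
  rewrite exprMn -mulrA; apply: ler_wpM2l => //; exact: sqr_ge0.
have a0 : 0 <= lam * k ^+ 2 by rewrite mulr_ge0 ?sqr_ge0 // ltW.
have b0 : 0 <= k0 * e (x, y) by rewrite mulr_ge0 // e_ge0.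
rewrite -(@ler_pXn2r _ 2) ?nnegrE ?addr_ge0 // real_normK ?num_real //.
move: kt a0 b0; rewrite (mulrC (k ^+ 2)); move: (lam * _) (k0 * _) (k * t) => a b c h a0 b0.
have := sqr_ge0 (a - b); nra.
Qed.

Lemma int2_e_le k : 0 <= k -> int2 Q (fun p => k * e p) <= k * M.
Proof. by move=> kk; rewrite int2Z //; apply: ler_wpM2l. Qed.

Lemma int2_cst k : int2 Q (fun _ => k) = k * ((L - - L) * (L - r0)).
Proof.
rewrite (@int2_iter_x _ Q (fun _ => k) (- L) L (fun _ => r0) (fun _ => L)).
- rewrite (_ : (fun y => _) = cst (k * (L - r0))); last first.
    by apply/funext => y; exact: int1_cst.
  by rewrite int1_cst // mulrAC mulrA mulrAC.
- exact: measurable_rect.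
- by apply: integrable_rect; exact: cont_cst.
- exact: cont_cst.
- by move=> x y; rewrite rectE; split=> -[].
Qed.

(** Adding back the side rho = r0 leaves the three outer sides, of total length at most [4 L]. *)
Lemma side_flux (X Y : R * R -> R) (k : R) : continuous X -> continuous Y ->
  (forall x y, r0 <= x <= L -> - L <= y <= L -> x = L \/ `|y| = L ->
    `|X (x, y)| <= k /\ `|Y (x, y)| <= k) ->
  `|bflux r0 L (- L) L X Y + int1 (- L) L (fun y => X (r0, y))| <= 4 * k * L.
Proof.
geo; pose proof L0 as geo7; pose proof rL as geo8; pose proof LL as geo9; move=> cX cY H.
have cXL : continuous (fun y => X (L, y)) by exact: continuous_slice_y.
have cXr : continuous (fun y => X (r0, y)) by exact: continuous_slice_y.
have cY1 : continuous (fun x => Y (x, L)) by exact: continuous_slice_x.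
have cY2 : continuous (fun x => Y (x, - L)) by exact: continuous_slice_x.
rewrite /bflux int1B //.
have -> : int1 (- L) L (fun y => X (L, y)) - int1 (- L) L (fun y => X (r0, y))
    + int1 r0 L (fun x => Y (x, L) - Y (x, - L)) + int1 (- L) L (fun y => X (r0, y))
  = int1 (- L) L (fun y => X (L, y)) + int1 r0 L (fun x => Y (x, L) - Y (x, - L)) by ring.
have hL : r0 <= L <= L by rewrite rL lexx.
have h1 : - L <= L <= L by rewrite LL lexx.
have h2 : - L <= - L <= L by rewrite LL lexx.
have nL : `|L| = L by rewrite gtr0_norm.
have nNL : `|- L| = L by rewrite normrN gtr0_norm.
have k_ge0 : 0 <= k.
  by have [h _] := H L L hL h1 (or_introl erefl); apply: le_trans h.
have b1 : `|int1 (- L) L (fun y => X (L, y))| <= k * (L - - L).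
  apply: int1_norm_le => // y hy.
  by have [] := H L y hL hy (or_introl erefl).
have b2 : `|int1 r0 L (fun x => Y (x, L) - Y (x, - L))| <= (k + k) * (L - r0).
  apply: int1_norm_le => //; first by apply: cont_add => //; exact: cont_opp.
  move=> x hx; apply: nleD; first by have [] := H x L hx h1 (or_intror nL).
  by apply: nleN; have [] := H x (- L) hx h2 (or_intror nNL).
apply: (le_trans (nleD b1 b2)).
have : 0 <= k * r0 by rewrite mulr_ge0 // ltW.
by lra.
Qed.

(** As [wx <= 0] on rho = r0, this is the L1 norm of the Neumann datum; it controls the boundary
    term of the representation wherever the kernel is bounded. *)
Definition beta : R := int1 (- L) L (fun y => - wx (r0, y)).

(** Green's identity with the test function 1; the term [- e / (2 x)] of the Laplacian has the
    favourable sign. *)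
Lemma beta_le : beta <= 12 * C / L + 2 * lam * L ^+ 2 + k0 * M.
Proof.
geo; pose proof L0 as geo7; pose proof rL as geo8; pose proof LL as geo9.
have [c1 c2 c3 c4 c5 _ _ _ _] := w2.
have G := green rL LL w2 (C2_cst 1).
have E1 : (fun p => 1 * (wxx p + wyy p) - w p * (0 + 0)) = (fun p => wxx p + wyy p).
  by apply/funext => p; ring.
have E2 : (fun p => 1 * wx p - w p * 0) = wx by apply/funext => p; ring.
have E3 : (fun p => 1 * wy p - w p * 0) = wy by apply/funext => p; ring.
rewrite E1 E2 E3 in G.
have Hs (x y : R) : r0 <= x <= L -> - L <= y <= L -> x = L \/ `|y| = L ->
    `|wx (x, y)| <= 3 * C / L ^+ 2 /\ `|wy (x, y)| <= 3 * C / L ^+ 2.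
  by move=> hx hy ho; have [] := Hout hx hy ho.
have S := side_flux c2 c3 Hs.
have cl : continuous (fun p => wxx p + wyy p) by exact: cont_add.
have cr : continuous (fun p : R * R => lam + k0 * e p).
  by apply: cont_add; [exact: cont_cst|apply: cont_mul => //; exact: cont_cst].
have I : int2 Q (fun p => wxx p + wyy p) <= lam * ((L - - L) * (L - r0)) + k0 * M.
  apply: (@le_trans _ _ (int2 Q (fun p => lam + k0 * e p))).
    apply: le_int2 => // x y /andP[hx _] _; rewrite Hpde //.
    have x0 : 0 < x by lra.
    have := absorb y 1 hx; rewrite mul1r expr1n mulr1 => h.
    have : 0 <= e (x, y) / (2 * x).
      by rewrite divr_ge0 ?e_ge0 // mulr_ge0 // ltW.
    by have := le_trans (ler_norm _) h; lra.
  rewrite int2D; [|exact: cont_cst|by apply: cont_mul => //; exact: cont_cst].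
  by rewrite int2_cst lerD2l; exact: int2_e_le.
have -> : beta = - int1 (- L) L (fun y => wx (r0, y)).
  rewrite /beta -[RHS]mulN1r -int1Z; last exact: continuous_slice_y.
  by apply: eq_int1 => y _; rewrite mulN1r.
move: S; rewrite -G ler_norml => /andP[S1 S2].
have k4 : 4 * (3 * C / L ^+ 2) * L = 12 * C / L by field; rewrite gt_eqF.
rewrite k4 in S1 S2.
have : 0 <= lam * (L * r0) by rewrite !mulr_ge0 // ltW.
by lra.
Qed.

Variables (x1 x2 eps : R).
Hypotheses (x1_ge : r0 + sg <= x1) (x1_le : x1 <= r1) (x2_le : `|x2| <= r1 / 2).
Hypotheses (eps0 : 0 < eps) (epsL : eps <= L).

Notation s := (sq x1 x2 eps).
Notation G := (GK r0 L x1 x2 eps).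
Notation Gx := (GKx r0 x1 x2 eps).
Notation Gy := (GKy r0 x1 x2 eps).
Notation K := (KK r0 x1 x2 eps).
Notation cf := (cflux r0 L x1 x2 eps).
Notation w0 := (w (x1, x2)).
Notation lk := (LK (8 * L) x1 x2 eps).

(** [KK] is not a point mass; this is the error of replacing [w] under it by its value at the
    pole. *)
Definition defect : R := int2 Q (fun p => (w p - w0) * K p).

Let cK : continuous K.
Proof.
have [_ _ _ c4 c5 _ _ _ _] := GK_C2 r0 L x1 x2 eps0.
have -> : K = (fun p => - (GKxx r0 x1 x2 eps p + GKyy r0 x1 x2 eps p)).
  by apply/funext => p; rewrite KKE // opprK.
by apply: cont_opp; exact: cont_add.
Qed.

(** [O] collects the outer sides, where the components of [G grad w - w grad G] are at most
    [(16 * 3 + 3 * 12) C / L^2] over a length of at most [4 L]. On rho = r0 the reflection gives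
    [Gx = 0], so only [wx] remains. *)
Lemma representation :
  exists O : R, `|O| <= 336 * C / L /\
  w0 * cf = O + int1 (- L) L (fun y => G (r0, y) * - wx (r0, y))
    - int2 Q (fun p => G p * (wxx p + wyy p)) - defect.
Proof.
geo; pose proof L0 as geo7; pose proof rL as geo8; pose proof LL as geo9.
have [c1 c2 c3 c4 c5 _ _ _ _] := w2.
have HG := GK_C2 r0 L x1 x2 eps0; have [g1 g2 g3 g4 g5 _ _ _ _] := HG.
have Gr := green rL LL w2 HG.
have cX : continuous (fun p => G p * wx p - w p * Gx p) by cont.
have cY : continuous (fun p => G p * wy p - w p * Gy p) by cont.
have k9 : 16 * (3 * C / L ^+ 2) + 3 * C / L * (12 / L) = 84 * C / L ^+ 2.
  by field; rewrite gt_eqF.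
have Hs (x y : R) : r0 <= x <= L -> - L <= y <= L -> x = L \/ `|y| = L ->
    `|G (x, y) * wx (x, y) - w (x, y) * Gx (x, y)| <= 84 * C / L ^+ 2 /\
    `|G (x, y) * wy (x, y) - w (x, y) * Gy (x, y)| <= 84 * C / L ^+ 2.
  move=> hx hy ho.
  have [h1 h2 h3] := Hout hx hy ho.
  have [h4 h5 h6] := GK_outer r0_gt0 sg_gt0 r01 r1L x1_ge x1_le x2_le eps0 epsL hx hy ho.
  by rewrite -k9; split; (apply: nleD; [exact: nleM|apply: nleN; exact: nleM]).
have S := side_flux cX cY Hs; set B := bflux _ _ _ _ _ _ in Gr S.
have k4 : 4 * (84 * C / L ^+ 2) * L = 336 * C / L by field; rewrite gt_eqF.
rewrite k4 in S.
exists (B + int1 (- L) L (fun y => G (r0, y) * wx (r0, y) - w (r0, y) * Gx (r0, y))); split.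
  exact: S.
have E0 : int1 (- L) L (fun y => G (r0, y) * wx (r0, y) - w (r0, y) * Gx (r0, y))
  = - int1 (- L) L (fun y => G (r0, y) * - wx (r0, y)).
  rewrite -[RHS]mulN1r -int1Z; last first.
    apply: cont_mul; first exact: continuous_slice_y.
    by apply: cont_opp; exact: continuous_slice_y.
  by apply: eq_int1 => y _; rewrite GK_axis // mulr0 subr0 mulN1r mulrN opprK.
have E1 : int2 Q (fun p => G p * (wxx p + wyy p)
     - w p * (GKxx r0 x1 x2 eps p + GKyy r0 x1 x2 eps p))
   = int2 Q (fun p => G p * (wxx p + wyy p)) + defect + w0 * cf.
  rewrite -(cfluxE x2 r0_gt0 sg_gt0 r01 r1L x1_ge x1_le eps0 epsL) /defect -int2Z //.
  have k1 : continuous (fun p => G p * (wxx p + wyy p)) by cont.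
  have k2 : continuous (fun p => (w p - w0) * K p).
    by apply: cont_mul => //; apply: cont_add => //; exact: cont_cst.
  have k3 : continuous (fun p => w0 * K p) by apply: cont_mul => //; exact: cont_cst.
  rewrite -int2D // -int2D //; last exact: cont_add.
  congr (int2 Q _); apply/funext => p; rewrite KKE //; ring.
rewrite E1 in Gr; rewrite E0 -Gr; ring.
Qed.

Definition CG : R := 2048 * L * (1 + 5 * L ^+ 2) ^+ 2.

(** [exp (lk / 2)] is [sqrt (8 L)] times the mollified [|p - x|^(-1/2)]. The half is the reason for
    the exponent 1/2, a singularity that regular curves integrate. *)
Lemma lk_half p : expR (lk p / 2) ^+ 2 = 8 * L * wgt (s p) ^+ 2.
Proof.
geo; pose proof L0 as geo7; have D0 : 0 < 8 * L by rewrite mulr_gt0.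
rewrite -!expRM_natl -{2}(lnK (x := 8 * L)) ?posrE // -expRD; congr expR.
by rewrite /LK lnXn // -mulr_natl; field.
Qed.

(** [G <= 2 lk <= 4 exp (lk / 2)] gives up the logarithm for a power, which is then majorised by a
    product of functions of one variable. *)
Lemma GK_sqr_le x y : r0 <= x <= L -> - L <= y <= L ->
  G (x, y) ^+ 2 <= 128 * L * (wgt ((x - x1) ^+ 2 + eps ^+ 2) * wgt ((y - x2) ^+ 2 + eps ^+ 2)).
Proof.
geo; pose proof L0 as geo7; move=> hx hy.
have /andP[g0 g1] := GK_bounds r0_gt0 sg_gt0 r01 r1L x1_ge x1_le x2_le eps0 epsL hx hy.
have h1 := expR_ge1Dx (lk (x, y) / 2).
have g2 : G (x, y) <= 4 * expR (lk (x, y) / 2) by lra.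
apply: (@le_trans _ _ (16 * expR (lk (x, y) / 2) ^+ 2)).
  have -> : 16 * expR (lk (x, y) / 2) ^+ 2 = (4 * expR (lk (x, y) / 2)) ^+ 2 by ring.
  by rewrite ler_pXn2r ?nnegrE // mulr_ge0 // expR_ge0.
rewrite lk_half mulrA.
have -> : 16 * (8 * L) = 128 * L by ring.
rewrite ler_pM2l ?mulr_gt0 //.
apply: wgt_sqr_le; rewrite ?sqr_eps_gt0 // /sq /= lerD2r.
  by rewrite lerDl sqr_ge0.
by rewrite lerDr sqr_ge0.
Qed.

(** The separated majorant reduces the bound to two integrals on segments, uniformly in the pole and
    in [eps]; [2048 = 128 * 4 * 4]. *)
Lemma int2_GK_sqr : int2 Q (fun p => G p ^+ 2) <= CG.
Proof.
geo; pose proof L0 as geo7; pose proof rL as geo8; pose proof LL as geo9.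
pose proof x1_ge as geo10; pose proof x1_le as geo11; pose proof epsL as geo12.
pose proof eps0 as geo13.
have [g1 _ _ _ _ _ _ _ _] := GK_C2 r0 L x1 x2 eps0.
pose A (x : R) := wgt ((x - x1) ^+ 2 + eps ^+ 2).
pose B (y : R) := wgt ((y - x2) ^+ 2 + eps ^+ 2).
have cwgt (T : topologicalType) (f : T -> R) k : continuous f ->
    continuous (fun t => wgt ((f t - k) ^+ 2 + eps ^+ 2)).
  move=> cf; apply: cont_wgt; first by move=> t; exact: sqr_eps_gt0.
  by apply: cont_add; [apply: cont_exp; apply: cont_add => //; exact: cont_cst|exact: cont_cst].
have cA : continuous A by apply: cwgt => t; exact: cvg_id.
have cB : continuous B by apply: cwgt => t; exact: cvg_id.
have cAp : continuous (fun p : R * R => A p.1) by apply: cwgt; exact: cont_fst.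
have cBp : continuous (fun p : R * R => B p.2) by apply: cwgt; exact: cont_snd.
have cAB := cont_mul cAp cBp.
apply: (@le_trans _ _ (int2 Q (fun p => 128 * L * (A p.1 * B p.2)))).
  apply: le_int2; first exact: cont_exp.
    by apply: cont_mul => //; exact: cont_cst.
  by move=> x y hx hy; exact: GK_sqr_le.
rewrite int2Z //.
have -> : int2 Q (fun p => A p.1 * B p.2) = int1 r0 L A * int1 (- L) L B.
  rewrite (@int2_iter_x _ Q _ (- L) L (fun _ => r0) (fun _ => L)) //=.
  - transitivity (int1 (- L) L (fun y => int1 r0 L A * B y)); last exact: (int1Z _ _ _ cB).
    apply: eq_int1 => y _; rewrite mulrC -(int1Z _ _ (B y) cA).
    by apply: eq_int1 => x _; exact: mulrC.
  - exact: measurable_rect.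
  - exact: integrable_rect.
  - by move=> x y; rewrite rectE; split=> -[].
have /andP[b1 b2] : - (L / 4) <= x2 <= L / 4.
  by rewrite -ler_norml; apply: (le_trans x2_le); lra.
have IA : int1 r0 L A <= 4 * (1 + (2 * L) ^+ 2 + eps ^+ 2).
  by apply: int1_wgt_id => //; rewrite ler_norml; apply/andP; split; lra.
have IB : int1 (- L) L B <= 4 * (1 + (2 * L) ^+ 2 + eps ^+ 2).
  by apply: int1_wgt_id => //; rewrite ler_norml; apply/andP; split; lra.
have I0 : 4 * (1 + (2 * L) ^+ 2 + eps ^+ 2) <= 4 * (1 + 5 * L ^+ 2).
  have : eps ^+ 2 <= L ^+ 2 by rewrite ler_pXn2r ?nnegrE ?(ltW geo7) ?(ltW geo13).
  have -> : 5 * L ^+ 2 = (2 * L) ^+ 2 + L ^+ 2 by ring.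
  by move=> h; rewrite ler_pM2l // -!addrA !lerD2l.
have A0 : 0 <= int1 r0 L A by apply: Rintegral_ge0 => t _; exact: expR_ge0.
have B0 : 0 <= int1 (- L) L B by apply: Rintegral_ge0 => t _; exact: expR_ge0.
have AB : int1 r0 L A * int1 (- L) L B <= 4 * (1 + 5 * L ^+ 2) * (4 * (1 + 5 * L ^+ 2)).
  by apply: ler_pM; [exact: A0|exact: B0|exact: (le_trans IA I0)|exact: (le_trans IB I0)].
apply: (@le_trans _ _ (128 * L * (4 * (1 + 5 * L ^+ 2) * (4 * (1 + 5 * L ^+ 2))))).
  by rewrite ler_pM2l ?mulr_gt0.
by rewrite le_eqVlt; apply/orP; left; apply/eqP; rewrite /CG; ring.
Qed.

Lemma int2_remainder : int2 Q (fun p => lam * G p ^+ 2 + k0 * e p) <= lam * CG + k0 * M.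
Proof.
have [g1 _ _ _ _ _ _ _ _] := GK_C2 r0 L x1 x2 eps0.
have c1 : continuous (fun p => lam * G p ^+ 2).
  by apply: cont_mul; [exact: cont_cst|exact: cont_exp].
have c2 : continuous (fun p => k0 * e p) by apply: cont_mul => //; exact: cont_cst.
rewrite int2D //; apply: lerD; last exact: int2_e_le.
rewrite int2Z; last exact: cont_exp.
by rewrite ler_pM2l // int2_GK_sqr.
Qed.

(** [G (- wx)] on rho = r0 and [G e / (2 x)] inside are nonnegative and enter with a plus sign, so
    both are dropped. *)
Lemma potential_lower :
  - (336 * C / L + lam * CG + k0 * M + `|defect|) <= w0 * cf.
Proof.
geo; pose proof L0 as geo7; pose proof rL as geo8; pose proof LL as geo9.
have [c1 c2 c3 c4 c5 _ _ _ _] := w2.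
have [g1 _ _ _ _ _ _ _ _] := GK_C2 r0 L x1 x2 eps0.
have [ob [hO ->]] := representation.
have I1 : 0 <= int1 (- L) L (fun y => G (r0, y) * - wx (r0, y)).
  apply: Rintegral_ge0 => y; rewrite /= in_itv /= => hy.
  have hr : r0 <= r0 <= L by rewrite lexx.
  have /andP[h _] := GK_bounds r0_gt0 sg_gt0 r01 r1L x1_ge x1_le x2_le eps0 epsL hr hy.
  by rewrite mulr_ge0 // oppr_ge0.
have cc : continuous (fun p => lam * G p ^+ 2 + k0 * e p).
  by apply: cont_add; apply: cont_mul => //; [exact: cont_cst|exact: cont_exp|exact: cont_cst].
have I2 : int2 Q (fun p => G p * (wxx p + wyy p)) <= lam * CG + k0 * M.
  apply: le_trans int2_remainder; apply: le_int2 => //.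
    by apply: cont_mul => //; exact: cont_add.
  move=> x y hx hy; have /andP[hx1 hx2] := hx; rewrite Hpde //.
  have h := le_trans (ler_norm _) (absorb y (G (x, y)) hx1).
  have /andP[h' _] := GK_bounds r0_gt0 sg_gt0 r01 r1L x1_ge x1_le x2_le eps0 epsL hx hy.
  have : 0 <= G (x, y) * (e (x, y) / (2 * x)).
    rewrite mulr_ge0 // divr_ge0 ?e_ge0 // mulr_ge0 //; lra.
  by rewrite mulrBr; lra.
have hd := ler_norm defect.
move: hO; rewrite ler_norml => /andP[hO _].
lra.
Qed.

(** The pole has distance at least [sg] from rho = r0, so the kernel is at most [4 sqrt (8 L / sg)]
    there and the boundary term is controlled by [beta]. The energy term, dropped from below,
    survives here as a logarithmic potential. *)
Lemma potential_upper :
  w0 * cf <= 336 * C / L + 4 * Num.sqrt (8 * L / sg) * (12 * C / L + 2 * lam * L ^+ 2 + k0 * M)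
   + lam * CG + k0 * M + `|defect| + r0^-1 * int2 Q (fun p => lk p * e p).
Proof.
geo; pose proof L0 as geo7; pose proof rL as geo8; pose proof LL as geo9.
have [c1 c2 c3 c4 c5 _ _ _ _] := w2.
have [g1 _ _ _ _ _ _ _ _] := GK_C2 r0 L x1 x2 eps0.
have [l1 _ _ _ _ _ _ _ _] := LK_C2 (8 * L) x1 x2 eps0.
have [ob [hO ->]] := representation.
have I1 : int1 (- L) L (fun y => G (r0, y) * - wx (r0, y))
   <= 4 * Num.sqrt (8 * L / sg) * (12 * C / L + 2 * lam * L ^+ 2 + k0 * M).
  apply: (@le_trans _ _ (int1 (- L) L (fun y => 4 * Num.sqrt (8 * L / sg) * - wx (r0, y)))).
    apply: le_int1.
    - apply: cont_mul; first exact: continuous_slice_y.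
      by apply: cont_opp; exact: continuous_slice_y.
    - apply: cont_mul; first exact: cont_cst.
      by apply: cont_opp; exact: continuous_slice_y.
    - move=> y hy; apply: ler_wpM2r; first by rewrite oppr_ge0.
      have hr : r0 <= r0 <= L by rewrite lexx.
      have /andP[_ h] := GK_bounds r0_gt0 sg_gt0 r01 r1L x1_ge x1_le x2_le eps0 epsL hr hy.
      apply: (le_trans h).
      have hs : sg ^+ 2 <= s (r0, y).
        rewrite /sq /= -addrA; apply: ler_wpDr; first by rewrite addr_ge0 ?sqr_ge0.
        have h1 : sg <= - (r0 - x1) by pose proof x1_ge as geo10; lra.
        by rewrite -(sqrrN (r0 - x1)) ler_pXn2r ?nnegrE // ?(ltW geo2) // (le_trans (ltW geo2) h1).
      have := LK_le r0_gt0 sg_gt0 r01 r1L x1_ge x1_le eps0 epsL sg_gt0 hs; lra.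
  rewrite int1Z; last by apply: cont_opp; exact: continuous_slice_y.
  apply: ler_wpM2l; last exact: beta_le.
  by rewrite mulr_ge0 // sqrtr_ge0.
have cle := cont_mul l1 ce.
have cc : continuous (fun p => lam * G p ^+ 2 + k0 * e p).
  by apply: cont_add; apply: cont_mul => //; [exact: cont_cst|exact: cont_exp|exact: cont_cst].
have cm : continuous (fun p => - 1 * (G p * (wxx p + wyy p))).
  by apply: cont_mul; [exact: cont_cst|apply: cont_mul => //; exact: cont_add].
have cr : continuous (fun p => r0^-1 * (lk p * e p)).
  by apply: cont_mul => //; exact: cont_cst.
have I2 : - int2 Q (fun p => G p * (wxx p + wyy p))
    <= r0^-1 * int2 Q (fun p => lk p * e p) + (lam * CG + k0 * M).
  rewrite -mulN1r -int2Z; last by apply: cont_mul => //; exact: cont_add.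
  rewrite -int2Z //.
  apply: (@le_trans _ _ (int2 Q (fun p => r0^-1 * (lk p * e p) + (lam * G p ^+ 2 + k0 * e p)))).
    apply: le_int2 => //; first exact: cont_add.
    move=> x y hx hy; have /andP[hx1 hx2] := hx; rewrite Hpde //.
    have x0 : 0 < x by lra.
    have := absorb y (G (x, y)) hx1; rewrite ler_norml => /andP[h _].
    have /andP[h' h''] := GK_bounds r0_gt0 sg_gt0 r01 r1L x1_ge x1_le x2_le eps0 epsL hx hy.
    have : G (x, y) * (e (x, y) / (2 * x)) <= r0^-1 * (lk (x, y) * e (x, y)).
      apply: (@le_trans _ _ (2 * lk (x, y) * (e (x, y) / (2 * x)))).
        by apply: ler_wpM2r => //; rewrite divr_ge0 ?e_ge0 // mulr_ge0 // ltW.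
      have -> : 2 * lk (x, y) * (e (x, y) / (2 * x)) = x^-1 * (lk (x, y) * e (x, y)).
        by field; rewrite gt_eqF.
      apply: ler_wpM2r; last by rewrite lef_pV2 ?posrE.
      by rewrite mulr_ge0 ?e_ge0 //; lra.
    by rewrite mulN1r mulrBr; lra.
  by rewrite int2D // lerD2l; exact: int2_remainder.
have hd := ler_norm (- defect); rewrite normrN in hd.
move: hO; rewrite ler_norml => /andP[_ hO].
lra.
Qed.

(** Near the pole the oscillation is at most [eta] against a charge of at most 48. Elsewhere
    [KK <= 4 eps^2 / del^4] and [|w - w0| <= 2 W], over an area of at most [2 L^2]. *)
Lemma defect_le eta del W : 0 <= eta -> 0 < del ->
  (forall x y, r0 <= x <= L -> - L <= y <= L -> `|w (x, y)| <= W) ->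
  (forall x y, r0 <= x <= L -> - L <= y <= L -> `|x - x1| < del -> `|y - x2| < del ->
    `|w (x, y) - w0| <= eta) ->
  `|w0| <= W ->
  `|defect| <= 48 * eta + 16 * W * L ^+ 2 * eps ^+ 2 / del ^+ 4.
Proof.
geo; pose proof L0 as geo7; pose proof rL as geo8; pose proof LL as geo9.
have [c1 c2 c3 c4 c5 _ _ _ _] := w2.
move=> eta0 del0 HW Hm Hw0.
have W0 : 0 <= W by exact: le_trans Hw0.
have d40 : 0 < del ^+ 4 by rewrite exprn_gt0.
set b := 8 * W * eps ^+ 2 / del ^+ 4.
have b0 : 0 <= b.
  apply: divr_ge0; last exact: ltW.
  by apply: mulr_ge0; [exact: mulr_ge0|exact: sqr_ge0].
have pt x y : r0 <= x <= L -> - L <= y <= L ->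
    `|(w (x, y) - w0) * K (x, y)| <= eta * K (x, y) + b.
  move=> hx hy; have K0 := KK_ge0 r0 x1 x2 eps (x, y).
  rewrite normrM (ger0_norm K0).
  have far : del ^+ 2 <= s (x, y) -> `|w (x, y) - w0| * K (x, y) <= eta * K (x, y) + b.
    move=> hs; have /andP[hx1 _] := hx.
    have hs' : del ^+ 2 <= sq (2 * r0 - x1) x2 eps (x, y).
      by apply: (le_trans hs); exact: (s_le_s' x2 r0_gt0 sg_gt0 r01 r1L x1_ge x1_le eps0 epsL).
    have fr q : del ^+ 2 <= q -> 2 * eps ^+ 2 / q ^+ 2 <= 2 * eps ^+ 2 / del ^+ 4.
      move=> hq; apply: ler_wpM2l; first by rewrite mulr_ge0 ?sqr_ge0.
      have q0 : 0 < q by apply: lt_le_trans hq; rewrite exprn_gt0.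
      rewrite lef_pV2 ?posrE ?exprn_gt0 // (exprM del 2 2) ler_pXn2r ?nnegrE //.
        by rewrite exprn_ge0 // ltW.
      exact: ltW.
    have hK : K (x, y) <= 4 * eps ^+ 2 / del ^+ 4.
      have := fr _ hs; have := fr _ hs'; rewrite /KK; lra.
    have hw : `|w (x, y) - w0| <= 2 * W.
      by apply: (le_trans (ler_normB _ _)); rewrite mulr2n mulrDl mul1r lerD // HW.
    apply: (@le_trans _ _ (2 * W * (4 * eps ^+ 2 / del ^+ 4))); first exact: ler_pM.
    apply: ler_wpDl; first by rewrite mulr_ge0.
    by rewrite le_eqVlt; apply/orP; left; apply/eqP; rewrite /b; field; rewrite gt_eqF.
  have [h1|h1] := ltP `|x - x1| del; last first.
    apply: far; rewrite /sq /= -addrA; apply: ler_wpDr; first by rewrite addr_ge0 ?sqr_ge0.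
    by rewrite -(real_normK (num_real (x - x1))) ler_pXn2r ?nnegrE // ltW.
  have [h2|h2] := ltP `|y - x2| del; last first.
    apply: far; rewrite /sq /= addrAC; apply: ler_wpDl; first by rewrite addr_ge0 ?sqr_ge0.
    by rewrite -(real_normK (num_real (y - x2))) ler_pXn2r ?nnegrE // ltW.
  by apply: ler_wpDr => //; apply: ler_wpM2r => //; exact: Hm.
have cw : continuous (fun p => (w p - w0) * K p).
  by apply: cont_mul => //; apply: cont_add => //; exact: cont_cst.
have ceK : continuous (fun p => eta * K p) by apply: cont_mul => //; exact: cont_cst.
have cb : continuous (fun p => eta * K p + b) by apply: cont_add => //; exact: cont_cst.
have hI : int2 Q (fun p => eta * K p + b) <= 48 * eta + 16 * W * L ^+ 2 * eps ^+ 2 / del ^+ 4.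
  rewrite int2D //; last exact: cont_cst.
  rewrite int2_cst int2Z // (cfluxE x2 r0_gt0 sg_gt0 r01 r1L x1_ge x1_le eps0 epsL).
  have /andP[_ hc] := cflux_bounds r0_gt0 sg_gt0 r01 r1L x1_ge x1_le x2_le eps0 epsL.
  apply: lerD; first by rewrite mulrC; apply: ler_wpM2r.
  apply: (@le_trans _ _ (b * (2 * L * L))).
    apply: ler_wpM2l => //; nra.
  by rewrite le_eqVlt; apply/orP; left; apply/eqP; rewrite /b; field; rewrite gt_eqF.
apply: le_trans hI; rewrite ler_norml; apply/andP; split.
  rewrite -mulN1r -int2Z //; apply: le_int2 => //; first by apply: cont_mul => //; exact: cont_cst.
  move=> x y hx hy; have := pt x y hx hy; rewrite ler_norml => /andP[h _].
  by rewrite mulN1r.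
apply: le_int2 => // x y hx hy; exact: le_trans (ler_norm _) (pt x y hx hy).
Qed.

End potential.

(** * Jensen's inequality and the choice of the mollification *)

Section estimates.
Context {R : realType}.

Lemma rect_bounded (a b c d : R) (f : R * R -> R) : continuous f ->
  exists2 B, 0 <= B & forall x y, a <= x <= b -> c <= y <= d -> `|f (x, y)| <= B.
Proof.
move=> cf.
have : bounded_set (f @` rect a b c d).
  apply: compact_bounded; apply: continuous_compact; last exact: compact_rect.
  exact: continuous_subspaceT.
move=> [N [_ hN]]; exists (`|N| + 1); first by rewrite addr_ge0.
move=> x y hx hy; apply: (hN (`|N| + 1)).
  by rewrite (le_lt_trans (ler_norm N)) // ltrDl.
by exists (x, y) => //; exact/rectE.
Qed.

Lemma mvt_norm_le (a b B x y : R) (f df : R -> R) :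
  (forall t : R, is_derive t 1 f (df t)) -> (forall t, a <= t <= b -> `|df t| <= B) ->
  a <= x <= b -> a <= y <= b -> `|f x - f y| <= B * `|x - y|.
Proof.
move=> fd hB.
have main u v : a <= u -> v <= b -> u <= v -> `|f v - f u| <= B * `|v - u|.
  move=> au vb uv.
  have [t] := MVT_segment uv (fun t _ => fd t)
    (@continuous_subspaceT _ _ _ f (is_derive_continuous fd)).
  rewrite in_itv /= => /andP[ut tv] ->.
  rewrite normrM; apply: ler_wpM2r => //; apply: hB.
  by rewrite (le_trans au ut) (le_trans tv vb).
move=> /andP[ax xb] /andP[ay yb].
have [h|h] := leP x y; first by rewrite distrC (distrC x); exact: main.
by apply: main => //; exact: ltW.
Qed.

(* Tangent line of [expR] at the mean, with the missing mass [1 - int2 F]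
   placed where [a = 0]. *)
Lemma jensen_expR (b c d e : R) (a F : R * R -> R) : continuous a -> continuous F ->
  (forall x y, b <= x <= c -> d <= y <= e -> 0 <= F (x, y)) ->
  int2 (rect b c d e) F <= 1 ->
  expR (int2 (rect b c d e) (fun p => a p * F p))
    <= 1 + int2 (rect b c d e) (fun p => expR (a p) * F p).
Proof.
move=> ca cF F0 F1; set Q := rect b c d e.
set A := int2 Q (fun p => a p * F p).
have caF := cont_mul ca cF.
have c1 : continuous (fun p => expR A * (a p * F p)) by apply: cont_mul => //; exact: cont_cst.
have c2 : continuous (fun p => expR A * (1 - A) * F p) by apply: cont_mul => //; exact: cont_cst.
have I0 : 0 <= int2 Q F.
  by apply: Rintegral_ge0 => -[x y] /rectE [hx hy]; exact: F0.
have h : int2 Q (fun p => expR A * (a p * F p) + expR A * (1 - A) * F p)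
    <= int2 Q (fun p => expR (a p) * F p).
  apply: le_int2; first exact: cont_add.
    by apply: cont_mul => //; exact: cont_expR.
  move=> x y hx hy; have Fp := F0 x y hx hy.
  rewrite mulrA -mulrDl; apply: ler_wpM2r => //.
  have -> : expR (a (x, y)) = expR A * expR (a (x, y) - A) by rewrite -expRD addrC subrK.
  rewrite -mulrDr; apply: ler_wpM2l; first exact: expR_ge0.
  by have := expR_ge1Dx (a (x, y) - A); lra.
rewrite (@int2D _ _ _ _ _ _ _ c1 c2) (@int2Z _ _ _ _ _ _ _ caF) (@int2Z _ _ _ _ _ _ _ cF) -/Q -/A in h.
have e1 : expR A * (1 - A) <= 1.
  have := expR_ge1Dx (- A); have := expR_gt0 A; have := expRxMexpNx_1 A.
  move: (expR A) (expR (- A)) => p q pq p0 hq.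
  by apply: (@le_trans _ _ (p * q)); [apply: ler_wpM2l => //; exact: ltW|rewrite pq].
(* The tangent line gives [e^A (1 - (1 - A) (1 - int2 Q F))]; the loss is the missing mass, between
   0 and 1, times [e^A (1 - A) <= 1]. *)
have e2 : (1 - int2 Q F) * (expR A * (1 - A)) <= 1.
  have [h1|h1] := leP 0 (expR A * (1 - A)).
    apply: le_trans e1; rewrite ler_piMl //; lra.
  apply: (@le_trans _ _ 0) => //; apply: mulr_ge0_le0; last exact: ltW.
  by rewrite subr_ge0.
move: h e2; lra.
Qed.

(** [eps] depends on [w] through its size and gradient on the rectangle, but serves all poles at
    once. *)
Lemma defect_small (r0 sg r1 L eta : R) (w wx wy wxx wyy : R * R -> R) :
  0 < r0 -> 0 < sg -> r0 < r1 -> 2 * r1 <= L -> 0 < eta -> C2 w wx wy wxx wyy ->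
  exists2 eps, 0 < eps <= L & forall x1 x2, r0 + sg <= x1 <= r1 -> `|x2| <= r1 / 2 ->
    `|defect r0 L w x1 x2 eps| <= eta.
Proof.
move=> r00 sg0 r01 r1L eta0 w2; have [c1 c2 c3 _ _ dx dy _ _] := w2.
have L0 : 0 < L by lra.
have [W W0 hW] := rect_bounded r0 L (- L) L c1.
have [B1 B10 hB1] := rect_bounded r0 L (- L) L c2.
have [B2 B20 hB2] := rect_bounded r0 L (- L) L c3.
pose B := B1 + B2 + 1; have B0 : 0 < B by rewrite /B; lra.
(* The Lipschitz bound makes the oscillation at most [eta / 96], which the charge 48 turns into
   [eta / 2]; [q] below leaves [eta / 2] for the region away from the pole. *)
pose del := eta / (96 * B); have del0 : 0 < del by rewrite divr_gt0 // mulr_gt0.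
pose k := 16 * W * L ^+ 2 / del ^+ 4.
have k0 : 0 <= k by apply: divr_ge0; rewrite ?exprn_ge0 ?(ltW del0) // !mulr_ge0 // ltW.
pose q := eta / (2 * (k + 1)); have q0 : 0 < q by rewrite divr_gt0 // mulr_gt0 //; lra.
pose eps := Num.min L (Num.min 1 q).
have eps0 : 0 < eps by rewrite !lt_min L0 ltr01.
have epsL : eps <= L by rewrite ge_min lexx.
have eps1 : eps <= 1 by rewrite !ge_min lexx orbT.
have epsq : eps <= q by rewrite !ge_min lexx !orbT.
exists eps; first by rewrite eps0.
move=> x1 x2 /andP[hx1 hx1'] hx2.
have bx1 : r0 <= x1 <= L by apply/andP; split; lra.
have bx2 : - L <= x2 <= L by rewrite -ler_norml; lra.
have hl x y : r0 <= x <= L -> - L <= y <= L -> `|x - x1| < del -> `|y - x2| < del ->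
    `|w (x, y) - w (x1, x2)| <= eta / 96.
  move=> hx hy h1 h2.
  have m1 := mvt_norm_le (fun t => dx t y) (fun t ht => hB1 t y ht hy) hx bx1.
  have m2 := mvt_norm_le (fun t => dy x1 t) (fun t ht => hB2 x1 t bx1 ht) hy bx2.
  have -> : w (x, y) - w (x1, x2) = (w (x, y) - w (x1, y)) + (w (x1, y) - w (x1, x2)).
    by rewrite addrA subrK.
  apply: (le_trans (ler_normD _ _)).
  have n1 : B1 * `|x - x1| <= B1 * del by apply: ler_wpM2l => //; exact: ltW.
  have n2 : B2 * `|y - x2| <= B2 * del by apply: ler_wpM2l => //; exact: ltW.
  have hd : B * del = eta / 96 by rewrite /del; field; rewrite gt_eqF.
  have : B * del = B1 * del + B2 * del + del by rewrite /B !mulrDl mul1r.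
  lra.
have e96 : 0 <= eta / 96 by rewrite divr_ge0 // ltW.
have := defect_le r00 sg0 r01 r1L (lexx 0) ltr01 w2 hx1 hx1' hx2 eps0 epsL e96 del0 hW hl
  (hW x1 x2 bx1 bx2).
have -> : 16 * W * L ^+ 2 * eps ^+ 2 / del ^+ 4 = k * eps ^+ 2 by rewrite /k mulrAC.
have : k * eps ^+ 2 <= eta / 2.
  apply: (@le_trans _ _ (k * q)).
    apply: ler_wpM2l => //; apply: le_trans epsq; rewrite expr2 ler_piMl //; exact: ltW.
  have -> : eta / 2 = (k + 1) * q by rewrite /q; field; rewrite gt_eqF //; lra.
  by apply: ler_wpM2r; [exact: ltW|rewrite lerDl].
lra.
Qed.

End estimates.

(** * Bounds on the weight, uniform over the family *)

Section metric_weight.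
Context {R : realType}.

(* The area element of a metric is [expR weight] times the Euclidean one. *)
Definition weight (g : axisym_data R) (p : R * R) : R := on2 (ax_alpha g) p - 2 * on2 (ax_u g) p.
Definition weight_d (i : 'I_2) (g : axisym_data R) (p : R * R) : R :=
  on2 (partial i (ax_alpha g)) p - 2 * on2 (partial i (ax_u g)) p.
Definition weight_dd (i : 'I_2) (g : axisym_data R) (p : R * R) : R :=
  on2 (partial i (partial i (ax_alpha g))) p - 2 * on2 (partial i (partial i (ax_u g))) p.

Section one_metric.
Variable g : axisym_data R.
Hypothesis Hg : axisymmetric_metric g.
Let Hs : [/\ smooth (ax_u g), smooth (ax_alpha g), smooth (ax_A g) & smooth (ax_B g)].
Proof. by case: Hg. Qed.

Lemma weight_C2 :
  C2 (weight g) (weight_d 0 g) (weight_d 1 g) (weight_dd 0 g) (weight_dd 1 g).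
Proof.
have [su sa _ _] := Hs.
have c (f h : 'rV[R]_2 -> R) : smooth f -> smooth h ->
    continuous (fun p => on2 f p - 2 * on2 h p).
  move=> sf sh; apply: cont_add; first exact: cont_on2.
  by apply: cont_opp; apply: cont_mul; [exact: cont_cst|exact: cont_on2].
split; rewrite /weight /weight_d /weight_dd; try by apply: c => //; do ?apply: smooth_partial.
- move=> x y; apply: is_derive_sub; first exact: is_derive_on2x.
  by apply: is_derive_scale; exact: is_derive_on2x.
- move=> x y; apply: is_derive_sub; first exact: is_derive_on2y.
  by apply: is_derive_scale; exact: is_derive_on2y.
- move=> x y; apply: is_derive_sub; first by apply: is_derive_on2x; exact: smooth_partial.
  by apply: is_derive_scale; apply: is_derive_on2x; exact: smooth_partial.
- move=> x y; apply: is_derive_sub; first by apply: is_derive_on2y; exact: smooth_partial.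
  by apply: is_derive_scale; apply: is_derive_on2y; exact: smooth_partial.
Qed.

Lemma weight_laplacian (x y : R) : 0 < x -> weight_dd 0 g (x, y) + weight_dd 1 g (x, y)
  = 2 * on2 (partial 0 (ax_u g)) (x, y) / x - energy g (x, y) / (2 * x).
Proof.
move=> x0; rewrite /weight_dd /energy /Wr1 /Wz2.
generalize (on2 (partial 0 (partial 0 (ax_u g))) (x, y)) (on2 (partial 1 (partial 1 (ax_u g))) (x, y))
  (on2 (partial 0 (partial 0 (ax_alpha g))) (x, y)) (on2 (partial 1 (partial 1 (ax_alpha g))) (x, y))
  (on2 (partial 0 (ax_u g)) (x, y)) => a b c d e /=.
by field; rewrite gt_eqF.
Qed.

Lemma weight_source (x y : R) : nonneg_scalar_curvature g -> 0 < x ->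
  on2 (partial 0 (ax_u g)) (x, y) ^+ 2 <= energy g (x, y) / (2 * x).
Proof.
move=> Hn x0; rewrite ler_pdivlMr ?mulr_gt0 // mulrC.
apply: le_trans (energy_ge Hg Hn y x0); apply: ler_wpM2l; first by rewrite mulr_ge0 // ltW.
by rewrite lerDl sqr_ge0.
Qed.

End one_metric.

(** [|alpha| + 2 |u| <= 3 C / r], and likewise for the gradients. The constant serves the whole
    family, so [L] can be fixed before the metric. *)
Lemma weight_far (M : set (axisym_data R)) (R0 : R) : uniformly_asymptotically_flat M R0 ->
  exists2 C, 0 <= C & forall g L x y, M g -> 0 < L -> R0 <= L -> 0 <= x -> x = L \/ `|y| = L ->
  [/\ `|weight g (x, y)| <= 3 * C / L, `|weight_d 0 g (x, y)| <= 3 * C / L ^+ 2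
    & `|weight_d 1 g (x, y)| <= 3 * C / L ^+ 2].
Proof.
move=> /uaf_bounds [C [C0 h]]; exists C => // g L x y Mg L0 RL x0 hxy.
have [h1 h2] := le_radius x y.
have Lr : L <= radius x y.
  by case: hxy => [<-|<-]; [exact: le_trans (ler_norm _) h1|].
have r0 := lt_le_trans L0 Lr.
have [hu ha hdu hda] := h g Mg x y x0 r0 (le_trans RL Lr).
have i1 : C / radius x y <= C / L by apply: ler_wpM2l => //; rewrite lef_pV2 ?posrE.
have i2 : C / radius x y ^+ 2 <= C / L ^+ 2.
  apply: ler_wpM2l => //; rewrite lef_pV2 ?posrE ?exprn_gt0 //.
  by rewrite ler_pXn2r ?nnegrE // ltW.
have t (a b c d : R) : `|a| <= c -> `|b| <= c -> c <= d -> `|a - 2 * b| <= 3 * d.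
  move=> ha' hb' cd; apply: (le_trans (ler_normB _ _)).
  by rewrite normrM (ger0_norm (ler0n R 2)); lra.
by split; rewrite -mulrA; [exact: t ha hu i1|exact: t (hda 0) (hdu 0) i2|exact: t (hda 1) (hdu 1) i2].
Qed.

Variables (Ms : set (axisym_data R)) (R0 r0 r1 sg : R).
Hypothesis hM : forall g, Ms g -> axisymmetric_metric g.
Hypothesis hscal : forall g, Ms g -> nonneg_scalar_curvature g.
Hypothesis huaf : uniformly_asymptotically_flat Ms R0.
Hypothesis hmono : radially_monotone Ms r0.
Hypotheses (r0_gt0 : 0 < r0) (r01 : r0 < r1) (sg_gt0 : 0 < sg).

(** [L] is chosen from [eta], then [lam] from [L], then [delta] from both; [eps] alone depends on
    the metric. [K] depends only on [L] and [r0]. *)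
Lemma weight_bounds (eta : R) : 0 < eta -> exists L K delta : R,
  [/\ 2 * r1 <= L, 0 <= K, 0 < delta & forall g m, Ms g -> is_adm_mass g m -> m < delta ->
   (forall x1 x2, r0 + sg <= x1 <= r1 -> `|x2| <= r1 / 2 -> - eta <= weight g (x1, x2)) /\
   exists2 eps, 0 < eps <= L & forall x1 x2, r0 + sg <= x1 <= r1 -> `|x2| <= r1 / 2 ->
     expR (weight g (x1, x2)) <= expR eta *
       (1 + K * int2 (rect r0 L (- L) L) (fun p => wgt (sq x1 x2 eps p) * energy g p))].
Proof.
move=> eta0; have [C C0 hC] := weight_far huaf.
(* Four groups of errors (outer sides, [lam], mass, defect) are kept below [eta'] each; division by
   the charge, at least 1/5, turns [4 eta'] into [eta]. *)
pose eta' := eta / 20; have eta'0 : 0 < eta' by rewrite divr_gt0.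
pose S0 := Num.sqrt (8 / sg); have S00 : 0 <= S0 := sqrtr_ge0 _.
pose k := (336 + 48 * S0) * C; have k_ge0 : 0 <= k.
  apply: mulr_ge0 C0; apply: addr_ge0; first exact: ler0n.
  by apply: mulr_ge0 S00; exact: ler0n.
pose T := 1 + 2 * r1 + `|R0| + k / eta'.
have T1 : 1 + 2 * r1 + `|R0| <= T by rewrite /T lerDl divr_ge0 // ltW.
have R00 := normr_ge0 R0.
have T1' : 1 <= T by apply: le_trans T1; pose proof r0_gt0; pose proof r01; lra.
have T0 : 0 < T := lt_le_trans ltr01 T1'.
have kT : k / T <= eta'.
  rewrite ler_pdivrMr // mulrC -ler_pdivrMr //.
  by rewrite /T lerDr; pose proof r0_gt0; pose proof r01; lra.
(* A square, so that [sqrt (8 L / sg)] is [T] times a constant and the outer terms are O(1 / T). *)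
pose L := T ^+ 2; have TL : T <= L by rewrite /L expr2 ler_peMl // ltW.
have L0 : 0 < L := lt_le_trans T0 TL.
have r1L : 2 * r1 <= L by lra.
have R0L : R0 <= L by have := ler_norm R0; pose proof r0_gt0; pose proof r01; lra.
have r0L : r0 <= L by pose proof r0_gt0; pose proof r01; lra.
have hS : Num.sqrt (8 * L / sg) = T * S0.
  by rewrite mulrAC mulrC /L sqrtrM ?sqr_ge0 // sqrtr_sqr ger0_norm // ltW.
set S := Num.sqrt (8 * L / sg) in hS.
have S_ge0 : 0 <= S := sqrtr_ge0 _.
have far_le : 336 * C / L + 4 * S * (12 * C / L) <= eta'.
  apply: le_trans kT.
  have -> : 336 * C / L + 4 * S * (12 * C / L) = (336 * C / T + 48 * S0 * C) / T.
    by rewrite hS /L; field; rewrite gt_eqF.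
  apply: ler_wpM2r; first by rewrite invr_ge0 ltW.
  have : 336 * C / T <= 336 * C.
    have c1 : 0 <= 336 * C by apply: mulr_ge0 C0; exact: ler0n.
    have c2 : T^-1 <= 1 by rewrite invf_le1.
    exact: (ler_piMr c1 c2).
  by rewrite /k; lra.
have CG0 : 0 <= CG L.
  apply: mulr_ge0; last exact: sqr_ge0.
  by apply: mulr_ge0; [exact: ler0n|exact: ltW].
pose N := 8 * S * L ^+ 2 + CG L + 1.
have SL0 : 0 <= 8 * S * L ^+ 2.
  by apply: mulr_ge0; [exact: mulr_ge0|exact: sqr_ge0].
have N1 : 1 <= N by rewrite /N lerDr; exact: addr_ge0.
have N0 : 0 < N := lt_le_trans ltr01 N1.
pose lam := eta' / N; have lam0 : 0 < lam by rewrite divr_gt0.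
have lamN : 8 * S * L ^+ 2 * lam + lam * CG L <= eta'.
  have -> : eta' = N * lam by rewrite /lam mulrCA mulfV ?mulr1 // gt_eqF.
  by rewrite /N; lra.
pose kk := k0 r0 lam.
have kk0 : 0 < kk.
  by rewrite /kk /k0 invr_gt0; apply: mulr_gt0; [exact: mulr_gt0|exact: exprn_gt0].
pose P := 8 * kk * (4 * S + 1).
have P0 : 0 < P.
  apply: mulr_gt0; first exact: mulr_gt0.
  by apply: ltr_wpDl => //; exact: mulr_ge0.
(* The first entry bounds the mass terms by [eta']; the second makes [(10 / r0) (8 delta) <= 1], the
   mass condition of Jensen's inequality. *)
pose delta := Num.min (eta' / P) (r0 / 80).
have delta0 : 0 < delta by rewrite lt_min !divr_gt0.
have dP : 4 * S * (kk * (8 * delta)) + kk * (8 * delta) <= eta'.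
  have -> : 4 * S * (kk * (8 * delta)) + kk * (8 * delta) = delta * P by rewrite /P; ring.
  by rewrite -ler_pdivlMr // /delta ge_min lexx.
have dr : 80 * delta <= r0 by rewrite mulrC -ler_pdivlMr // /delta ge_min lexx orbT.
clearbody N P delta.
exists L, (Num.sqrt (8 * L) * (10 / r0)), delta; split=> //.
  by rewrite mulr_ge0 ?sqrtr_ge0 // divr_ge0 // ltW.
move=> g m Mg hm hdel.
have Hg := hM Mg; have Hn := hscal Mg.
have w2 := weight_C2 Hg.
have ce : continuous (energy g) by exact: cont_energy.
have pos x : r0 <= x -> 0 < x by move=> hx; exact: lt_le_trans hx.
have Hmass : int2 (rect r0 L (- L) L) (energy g) <= 8 * delta.
  have h := mass_bound Hg Hn L (- L) L huaf Mg hm (ltW r0_gt0).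
  apply: (le_trans h).
  by rewrite ler_pM2l // ltW.
have Hmono y : weight_d 0 g (r0, y) <= 0.
  by have [Hs _ _ _] := Hg; case: Hg => _ Hs' _ _; exact: (radially_monotone_weight Hs' y r0_gt0 hmono Mg).
have Hout x y : r0 <= x <= L -> - L <= y <= L -> x = L \/ `|y| = L ->
  [/\ `|weight g (x, y)| <= 3 * C / L, `|weight_d 0 g (x, y)| <= 3 * C / L ^+ 2
    & `|weight_d 1 g (x, y)| <= 3 * C / L ^+ 2].
  move=> /andP[hx _] _ hxy; apply: hC => //; exact: ltW (pos _ hx).
have Hpde x y : r0 <= x -> weight_dd 0 g (x, y) + weight_dd 1 g (x, y)
  = 2 * on2 (partial 0 (ax_u g)) (x, y) / x - energy g (x, y) / (2 * x).
  by move=> /pos; exact: weight_laplacian.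
have Hv x y : r0 <= x -> on2 (partial 0 (ax_u g)) (x, y) ^+ 2 <= energy g (x, y) / (2 * x).
  by move=> /pos; exact: weight_source.
have [eps /andP[eps0 epsL] hdef] := defect_small r0_gt0 sg_gt0 r01 r1L eta'0 w2.
have e20 : eta = 5 * (4 * eta') by rewrite /eta'; field.
split=> [x1 x2 hx1 hx2|].
  have hd := hdef _ _ hx1 hx2; have /andP[h1 h1'] := hx1.
  have := potential_lower r0_gt0 sg_gt0 r01 r1L C0 lam0 w2 ce Hpde Hv Hmono Hout Hmass h1 h1' hx2 eps0 epsL.
  have /andP[cf _] := cflux_bounds r0_gt0 sg_gt0 r01 r1L h1 h1' hx2 eps0 epsL.
  rewrite -/kk => low.
  have q1 : 0 <= 4 * S * (12 * C / L).
    by apply: mulr_ge0; rewrite ?mulr_ge0 // invr_ge0 ltW.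
  have q2 : 0 <= 8 * S * L ^+ 2 * lam by exact: mulr_ge0 SL0 (ltW lam0).
  have q3 : 0 <= 4 * S * (kk * (8 * delta)).
    apply: mulr_ge0; first exact: mulr_ge0.
    by apply: mulr_ge0; [exact: ltW|apply: mulr_ge0 => //; exact: ltW].
  have low' : - (4 * eta') <= weight g (x1, x2) * cflux r0 L x1 x2 eps by lra.
  move: low' cf; clear - eta'0 e20; generalize (weight g (x1, x2)) (cflux r0 L x1 x2 eps) => w c hw hc.
  by have [w0|w0] := leP 0 w; nra.
exists eps; first by rewrite eps0.
move=> x1 x2 hx1 hx2.
have hd := hdef _ _ hx1 hx2; have /andP[h1 h1'] := hx1.
have /andP[cf _] := cflux_bounds r0_gt0 sg_gt0 r01 r1L h1 h1' hx2 eps0 epsL.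
set Q := rect r0 L (- L) L.
have I0 : 0 <= int2 Q (fun p => wgt (sq x1 x2 eps p) * energy g p).
  apply: Rintegral_ge0 => -[x y] /rectE [/andP[hx _] _]; apply: mulr_ge0; first exact: expR_ge0.
  by apply: (energy_ge0 Hg Hn); exact: ltW (pos _ hx).
have K0 : 0 <= Num.sqrt (8 * L) * (10 / r0).
  by rewrite mulr_ge0 ?sqrtr_ge0 // divr_ge0 // ltW.
have [w0|w0] := leP (weight g (x1, x2)) 0.
  apply: (@le_trans _ _ 1); first by rewrite -expR0 ler_expR.
  apply: (@le_trans _ _ (1 * 1)); first by rewrite mulr1.
  apply: ler_pM => //; first by rewrite -expR0 ler_expR ltW.
  by rewrite lerDl mulr_ge0.
have [l1 _ _ _ _ _ _ _ _] := LK_C2 (8 * L) x1 x2 eps0.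
have up := potential_upper r0_gt0 sg_gt0 r01 r1L C0 lam0 w2 ce Hpde Hv Hmono Hout Hmass h1 h1' hx2 eps0 epsL.
rewrite -/kk -/S -/Q in up.
set I := int2 Q (fun p => LK (8 * L) x1 x2 eps p * energy g p) in up.
have wI : weight g (x1, x2) <= eta + 5 / r0 * I.
  move: up; rewrite (mulrC r0^-1) => up.
  have up' : weight g (x1, x2) * cflux r0 L x1 x2 eps <= 4 * eta' + I / r0.
    by move: up; rewrite mulrDr mulrDr; lra.
  have -> : 5 / r0 * I = 5 * (I / r0) by rewrite mulrAC mulrA.
  move: up' cf w0; clear - e20; generalize (weight g (x1, x2)) (cflux r0 L x1 x2 eps) (I / r0) => w c J hw hc w0.
  by nra.
apply: (le_trans (y := expR (eta + 5 / r0 * I))); first by rewrite ler_expR.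
rewrite expRD; apply: ler_wpM2l; first exact: expR_ge0.
(* The exponent [(5 / r0) lk e] is split as [(lk / 2) ((10 / r0) e)]: Jensen exponentiates only
   [lk / 2], whose exponential is the integrable weight. *)
pose F p := 10 / r0 * energy g p.
have cF : continuous F by apply: cont_mul => //; exact: cont_cst.
pose a p := 2^-1 * LK (8 * L) x1 x2 eps p.
have ca : continuous a by apply: cont_mul => //; exact: cont_cst.
have r10 : 0 <= 10 / r0 by rewrite divr_ge0 // ltW.
have F0 x y : r0 <= x <= L -> - L <= y <= L -> 0 <= F (x, y).
  move=> /andP[hx _] _; apply: mulr_ge0 => //.
  by apply: (energy_ge0 Hg Hn); exact: ltW (pos _ hx).
have F1 : int2 Q F <= 1.
  rewrite /F (@int2Z _ _ _ _ _ _ _ ce).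
  apply: (@le_trans _ _ (10 / r0 * (8 * delta))); first exact: ler_wpM2l.
  by rewrite mulrAC ler_pdivrMr // mul1r; lra.
have := jensen_expR ca cF F0 F1; rewrite -/Q.
have -> : int2 Q (fun p => a p * F p) = 5 / r0 * I.
  rewrite /I -(int2Z _ _ _ _ _ (cont_mul l1 ce)); congr int2; apply/funext => p.
  by rewrite /a /F; generalize (LK (8 * L) x1 x2 eps p) (energy g p) => u v; field; rewrite gt_eqF.
move=> h; apply: (le_trans h); rewrite lerD2l.
have cwe : continuous (fun p => wgt (sq x1 x2 eps p) * energy g p).
  apply: cont_mul => //; apply: cont_wgt; first by move=> p; rewrite /sq -addrA ltr_wpDl ?sqr_ge0 ?sqr_eps_gt0.
  apply: cont_add; last exact: cont_cst.
  by apply: cont_add; apply: cont_exp; apply: cont_add; (exact: cont_cst || exact: cont_fst || exact: cont_snd).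
rewrite -(int2Z _ _ _ _ _ cwe) le_eqVlt; apply/orP; left; apply/eqP; congr int2; apply/funext => p.
have -> : expR (a p) = Num.sqrt (8 * L) * wgt (sq x1 x2 eps p).
  have hh := lk_half r0_gt0 sg_gt0 r01 r1L C0 lam0 x1 x2 eps p.
  rewrite -(ger0_norm (expR_ge0 (a p))) -sqrtr_sqr /a mulrC hh sqrtrM ?mulr_ge0 // ?ltW //.
  by rewrite sqrtr_sqr ger0_norm // expR_ge0.
by rewrite /F mulrACA.
Qed.

End metric_weight.

(** * Areas of rotated curves *)

Section curve.
Context {R : realType}.
Notation mu := (@lebesgue_measure R).

Lemma measurable_EFin_cont (D : set R) (f : R -> R) : continuous f ->
  measurable_fun (D : set (g_sigma_algebraType (R.-ocitv.-measurable))) (EFin \o f).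
Proof.
move=> cf; apply/measurable_EFinP; apply: measurable_funTS; exact: continuous_measurable_fun.
Qed.

Lemma ge0_subset_int (A B : set R) (f : R -> R) : measurable A -> measurable B ->
  continuous f -> (forall t, 0 <= f t) -> A `<=` B ->
  (\int[mu]_(t in A) (f t)%:E <= \int[mu]_(t in B) (f t)%:E)%E.
Proof.
move=> mA mB cf f0 AB; apply: ge0_subset_integral => //.
- exact: measurable_EFin_cont.
- by move=> t _; rewrite lee_fin.
Qed.
Lemma ge0_le_int (A : set R) (f h : R -> R) : measurable A ->
  measurable_fun A f -> measurable_fun A h -> (forall t, 0 <= f t) ->
  (forall t, A t -> f t <= h t) ->
  (\int[mu]_(t in A) (f t)%:E <= \int[mu]_(t in A) (h t)%:E)%E.
Proof.
move=> mA mf mh f0 fh; apply: ge0_le_integral => //.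
- by move=> t _; rewrite lee_fin.
- exact/measurable_EFinP.
- exact/measurable_EFinP.
Qed.

Lemma ge0_intD (A : set R) (f h : R -> R) : measurable A ->
  measurable_fun A f -> measurable_fun A h -> (forall t, 0 <= f t) -> (forall t, 0 <= h t) ->
  (\int[mu]_(t in A) (f t + h t)%:E = \int[mu]_(t in A) (f t)%:E + \int[mu]_(t in A) (h t)%:E)%E.
Proof.
move=> mA mf mh f0 h0; under eq_integral do rewrite EFinD.
apply: ge0_integralD => //.
- by move=> t _; rewrite lee_fin.
- exact/measurable_EFinP.
- by move=> t _; rewrite lee_fin.
- exact/measurable_EFinP.
Qed.

Lemma ge0_intZ (A : set R) (f : R -> R) (k : R) : measurable A ->
  measurable_fun A f -> (forall t, 0 <= f t) -> 0 <= k ->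
  (\int[mu]_(t in A) (k * f t)%:E = k%:E * \int[mu]_(t in A) (f t)%:E)%E.
Proof.
move=> mA mf f0 k0; under eq_integral do rewrite EFinM.
apply: ge0_integralZl_EFin => //.
- by move=> t _; rewrite lee_fin.
- exact/measurable_EFinP.
Qed.

Lemma ge0_int_setU (A B : set R) (f : R -> R) : measurable A -> measurable B ->
  continuous f -> (forall t, 0 <= f t) -> [disjoint A & B] ->
  (\int[mu]_(t in A `|` B) (f t)%:E = \int[mu]_(t in A) (f t)%:E + \int[mu]_(t in B) (f t)%:E)%E.
Proof.
move=> mA mB cf f0 AB; apply: ge0_integral_setU => //.
- exact: measurable_EFin_cont.
- by move=> t _; rewrite lee_fin.
Qed.

(** Continuous induction: the supremum of the points reachable from [a] is reached, and cannot lie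
    before [b]. *)
Lemma interval_local_to_global (P : R -> R -> Prop) :
  (forall a b c, a <= b <= c -> P a b -> P b c -> P a c) ->
  (forall x, exists2 d, 0 < d & forall a b, x - d <= a -> a <= b -> b <= x + d -> P a b) ->
  forall a b, a <= b -> P a b.
Proof.
move=> Pcat Ploc a b ab.
pose S : set R := [set x | a <= x <= b /\ P a x].
have Sa : S a.
  split; first by rewrite lexx.
  by have [d d0 h] := Ploc a; apply: h => //; lra.
have hS : has_sup S by split; [exists a|exists b => x [/andP[]]].
have [d d0 h] := Ploc (sup S).
have [x [/andP[ax xb] Px] sx] := sup_adherent d0 hS.
have xs : x <= sup S by apply: ub_le_sup => //; [case: hS|split=> //; rewrite ax].
pose y := Num.min b (sup S + d).
have xy : x <= y by rewrite le_min xb /=; lra.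
have yb : y <= b by rewrite ge_min lexx.
have Py : P a y.
  apply: (Pcat a x y) => //; first by rewrite ax xy.
  by apply: h => //; [exact: ltW|rewrite ge_min lexx orbT].
have ys : y <= sup S.
  by apply: ub_le_sup; [case: hS|split=> //; rewrite yb (le_trans ax xy)].
have [sb|bs] := leP (sup S + d) b; last by rewrite /y min_l ?(ltW bs) // in Py.
by rewrite /y min_r // in ys; lra.
Qed.

Lemma continuous_sign (f : R -> R) (x : R) : continuous f -> f x != 0 ->
  exists2 d, 0 < d & (forall t, x - d <= t <= x + d -> `|f x| / 2 <= f t) \/
    (forall t, x - d <= t <= x + d -> f t <= - (`|f x| / 2)).
Proof.
move=> cf fx0; have e0 : 0 < `|f x| / 2 by rewrite divr_gt0 // normr_gt0.
have /cvgrPdist_lt /(_ _ e0) /nbhs_ballP[d /= d0 hd] := cf x.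
exists (d / 2); first by rewrite divr_gt0.
have near t : x - d / 2 <= t <= x + d / 2 -> `|f x - f t| < `|f x| / 2.
  by move=> /andP[h1 h2]; apply: hd; rewrite -ball_normE /= ltr_norml; apply/andP; split; lra.
have [fx|fx] := leP 0 (f x).
  left=> t /near; rewrite (ger0_norm fx) ltr_norml => /andP[]; lra.
right=> t /near; rewrite (ltr0_norm fx) ltr_norml => /andP[]; lra.
Qed.

(** By continuity the coordinate keeps at least half its speed, with constant sign, around [x], and
    [int1_wgt] applies with that speed as [lam]. *)
Lemma curve_wgt_local (L x : R) (c dc : R -> R) :
  (forall t : R, is_derive t (1 : R) c (dc t)) -> continuous dc -> dc x != 0 ->
  exists d CE : R, [/\ 0 < d, 0 <= CE & forall a b eps y, x - d <= a -> a <= b -> b <= x + d ->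
    0 < eps <= L -> `|y| <= L -> int1 a b (fun t => wgt ((c t - y) ^+ 2 + eps ^+ 2)) <= CE].
Proof.
move=> dC cdc x0; have [d d0 hd] := continuous_sign cdc x0.
have cc := is_derive_continuous dC.
have lam0 : 0 < `|dc x| / 2 by rewrite divr_gt0 // normr_gt0.
have cf : continuous (fun p : R * R => c p.1).
  by move=> p; apply: (@continuous_comp _ _ _ fst c); [exact: cvg_fst|exact: cc].
have [B B0 hB] := rect_bounded (x - d) (x + d) 0 0 cf.
exists d, (4 / (`|dc x| / 2) * (1 + (B + L) ^+ 2 + L ^+ 2)); split=> //.
  apply: mulr_ge0; first by rewrite divr_ge0 // ltW.
  by rewrite !addr_ge0 ?sqr_ge0.
move=> a b eps y xa ab bx /andP[e0 eL] hy.
have sub t : a <= t <= b -> x - d <= t <= x + d.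
  by move=> /andP[h1 h2]; rewrite (le_trans xa h1) (le_trans h2 bx).
have hM t : a <= t <= b -> `|c t - y| <= B + L.
  move=> /sub ht; apply: (le_trans (ler_normB _ _)); apply: lerD => //.
  by apply: (hB t 0 ht); rewrite lexx.
have hs : (forall t, a <= t <= b -> `|dc x| / 2 <= dc t) \/
    (forall t, a <= t <= b -> dc t <= - (`|dc x| / 2)).
  by case: hd => h; [left|right] => t /sub; exact: h.
apply: (le_trans (int1_wgt e0 ab lam0 cdc dC hM hs)).
apply: ler_wpM2l; first by rewrite divr_ge0 // ltW.
by rewrite lerD2l ler_pXn2r ?nnegrE ?(ltW e0) // (le_trans (ltW e0)).
Qed.

Variables (c0 c1 d0 d1 : R -> R) (E : set R) (L : R).
Hypotheses (dc0 : forall t : R, is_derive t (1 : R) c0 (d0 t)) (dc1 : forall t : R, is_derive t (1 : R) c1 (d1 t)).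
Hypotheses (cd0 : continuous d0) (cd1 : continuous d1) (Ecl : closed E).
Hypothesis reg : forall t, E t -> d0 t != 0 \/ d1 t != 0.

Let kern (eps y1 y2 t : R) : R := wgt ((c0 t - y1) ^+ 2 + (c1 t - y2) ^+ 2 + eps ^+ 2).

Let cc0 : continuous c0 := is_derive_continuous dc0.
Let cc1 : continuous c1 := is_derive_continuous dc1.

Lemma cont_curve_wgt (eps y1 y2 : R) : 0 < eps ->
  continuous (fun t => wgt ((c0 t - y1) ^+ 2 + (c1 t - y2) ^+ 2 + eps ^+ 2)).
Proof.
move=> e0; apply: cont_wgt.
  by move=> t; rewrite -addrA ltr_wpDl ?sqr_ge0 ?sqr_eps_gt0.
apply: cont_add; last exact: cont_cst.
by apply: cont_add; apply: cont_exp; apply: cont_add => //; exact: cont_cst.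
Qed.

(** At a parameter in [E] one coordinate has nonzero velocity, and the weight is at most the
    one-dimensional weight of that coordinate. A parameter outside the closed set [E] has a
    neighbourhood that contributes nothing. The local bounds add up over [[a, b]]. *)
Lemma curve_wgt_bound (a b : R) : a <= b -> exists2 CE, 0 <= CE &
  forall eps y1 y2, 0 < eps <= L -> `|y1| <= L -> `|y2| <= L ->
  (\int[mu]_(t in E `&` `[a, b])
    (wgt ((c0 t - y1) ^+ 2 + (c1 t - y2) ^+ 2 + eps ^+ 2))%:E <= CE%:E)%E.
Proof.
have mI (i : interval R) : measurable (E `&` [set` i]).
  by apply: measurableI; [exact: closed_measurable|exact: measurable_itv].
pose P x1 x2 := exists2 CE, 0 <= CE &
  forall eps y1 y2, 0 < eps <= L -> `|y1| <= L -> `|y2| <= L ->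
  (\int[mu]_(t in E `&` `[x1, x2]) (kern eps y1 y2 t)%:E <= CE%:E)%E.
have k0 eps y1 y2 t : 0 <= kern eps y1 y2 t by exact: expR_ge0.
(* The common passage from a one-coordinate majorant of the kernel to the local form of [P], used
   for either coordinate. *)
have lift (c dc : R -> R) x :
    (forall t : R, is_derive t (1 : R) c (dc t)) -> continuous dc -> dc x != 0 ->
    (forall eps y1 y2, 0 < eps <= L -> `|y1| <= L -> `|y2| <= L -> exists2 y, `|y| <= L &
       forall t, kern eps y1 y2 t <= wgt ((c t - y) ^+ 2 + eps ^+ 2)) ->
    exists2 d, 0 < d & forall a b, x - d <= a -> a <= b -> b <= x + d -> P a b.
  move=> dC cdc x0 hk; have [d [CE [dpos CE0 h]]] := curve_wgt_local L dC cdc x0.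
  exists d => // x1 x2 h1 h2 h3; exists CE => // eps y1 y2 he hy1 hy2.
  have [y hy hle] := hk _ _ _ he hy1 hy2; have /andP[e0 _] := he.
  have ck : continuous (kern eps y1 y2) by exact: cont_curve_wgt.
  have cw : continuous (fun t => wgt ((c t - y) ^+ 2 + eps ^+ 2)).
    apply: cont_wgt; first by move=> t; exact: sqr_eps_gt0.
    apply: cont_add; last exact: cont_cst.
    by apply: cont_exp; apply: cont_add; [exact: is_derive_continuous dC|exact: cont_cst].
  have mseg : measurable (`[x1, x2]%classic : set R) by exact: measurable_itv.
  apply: (le_trans (ge0_subset_int (mI `[x1, x2]) mseg ck (k0 eps y1 y2) _)) => //.
  have mc (f : R -> R) : continuous f -> measurable_fun `[x1, x2] f.
    by move=> cf; apply: measurable_funTS; exact: continuous_measurable_fun.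
  apply: (le_trans (ge0_le_int mseg (mc _ ck) (mc _ cw) (k0 eps y1 y2) (fun t _ => hle t))).
  by rewrite integral_seg // lee_fin; exact: h.
apply: (@interval_local_to_global P).
  move=> x y z /andP[xy yz] [C1 C10 h1] [C2 C20 h2]; exists (C1 + C2); first exact: addr_ge0.
  move=> eps y1 y2 he hy1 hy2; have /andP[e0 _] := he.
  have ck : continuous (kern eps y1 y2) by exact: cont_curve_wgt.
  have -> : E `&` `[x, z]%classic = (E `&` `[x, y]%classic) `|` (E `&` `]y, z]%classic).
    rewrite -setIUr; congr (_ `&` _); apply/seteqP; split=> t /=; rewrite !in_itv /=.
      by move=> /andP[xt tz]; have [ty|yt] := leP t y; [left; rewrite xt|right].
    by move=> [/andP[xt ty]|/andP[yt tz]]; [rewrite xt (le_trans ty)|rewrite tz (le_trans xy (ltW yt))].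
  rewrite (ge0_int_setU (mI `[x, y]) (mI `]y, z]) ck (k0 eps y1 y2)); last first.
    apply/disj_setPS => t [[_ /=]]; rewrite in_itv /= => /andP[_ ty] [_ /=]; rewrite in_itv /= => /andP[yt _].
    by move: (lt_le_trans yt ty); rewrite ltxx.
  rewrite EFinD; apply: leeD; first exact: h1.
  apply: le_trans (h2 _ _ _ he hy1 hy2); apply: (ge0_subset_int (mI `]y, z]) (mI `[y, z]) ck) => //.
  by move=> t [Et /=]; rewrite in_itv /= => /andP[yt tz]; split=> //=; rewrite in_itv /= tz ltW.
move=> x; have [Ex|nEx] := pselect (E x).
  case: (reg Ex) => hx; [apply: (lift c0 d0) => //|apply: (lift c1 d1) => //];
    move=> eps y1 y2 /andP[e0 _] hy1 hy2; [exists y1|exists y2] => // t;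
    (apply: wgt_le; first exact: sqr_eps_gt0).
    by rewrite lerD2r lerDl sqr_ge0.
  by rewrite lerD2r lerDr sqr_ge0.
have : nbhs x (~` E) by apply: open_nbhs_nbhs; split=> //; exact: closed_openC.
move=> /nbhs_ballP[d /= dpos hd]; exists (d / 2); first by rewrite divr_gt0.
move=> x1 x2 h1 h2 h3; exists 0 => // eps y1 y2 _ _ _.
rewrite (_ : _ `&` _ = set0) ?integral_set0 //.
rewrite -subset0 => t [Et /=]; rewrite in_itv /= => /andP[t1 t2].
by apply: (hd t) Et; rewrite -ball_normE /= ltr_norml; apply/andP; split; lra.
Qed.

End curve.

(** * Area elements of rotated curves *)

Section area.
Context {R : realType}.

Definition speed (S : axisym_surface R) (t : R) : R :=
  Num.sqrt (velocity (crv S) 0 t ^+ 2 + velocity (crv S) 1 t ^+ 2).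

Lemma det_mx2 (A : 'M[R]_2) : \det A = A 0 0 * A 1 1 - A 0 1 * A 1 0.
Proof.
rewrite (expand_det_row _ 0) !big_ord_recl big_ord0 addr0 /cofactor !det_mx11 !mxE /=.
rewrite expr0 expr1 mul1r mulN1r mulrN.
by congr (_ * A _ _ - A _ _ * A _ _); apply/val_inj.
Qed.

Lemma surface_gram (G : 'M[R]_3) (S : axisym_surface R) (p : R * R) :
  let v i := velocity (crv S) i p.1 in
  \det (surface_tangents S p *m G *m (surface_tangents S p)^T) =
  (v 0 * (v 0 * G 0 0 + v 1 * G 1 0) + v 1 * (v 0 * G 0 1 + v 1 * G 1 1)) * G 2 2
  - (v 0 * G 0 2 + v 1 * G 1 2) * (v 0 * G 2 0 + v 1 * G 2 1).
Proof.
move=> v; rewrite det_mx2 !mxE !big_ord_recl !big_ord0 !mxE !big_ord_recl !big_ord0 !mxE /=.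
rewrite -!/(v _).
have -> : lift 0 0 = 1 :> 'I_3 by apply/val_inj.
have -> : lift 0 (lift 0 0) = 2 :> 'I_3 by apply/val_inj.
have -> : ord0 = 0 :> 'I_3 by apply/val_inj.
generalize (v 0) (v 1) (G 0 0) (G 0 1) (G 0 2) (G 1 0) (G 1 1) (G 1 2) (G 2 0) (G 2 1) (G 2 2) => *.
ring.
Qed.

(** A and B shear the profile curve along the orbits of the rotation, which does not change the
    area; what remains is [rho e^(-u)] times [e^(alpha - u)] times the Euclidean speed. *)
Lemma area_density_cyl (g : axisym_data R) (S : axisym_surface R) (p : R * R) :
  area_density (cyl_metric g) S p =
  `|crv S p.1 0 0| * expR (weight g (crv S p.1 0 0, crv S p.1 0 1)) * speed S p.1.
Proof.
rewrite /area_density surface_gram.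
have hp : half_plane_part (surface_point S p) = vec2 (crv S p.1 0 0) (crv S p.1 0 1).
  by rewrite /half_plane_part !vec3E.
rewrite /cyl_metric hp !mxE !big_ord_recl !big_ord0 !mxE /= /weight /on2 /=.
set x := crv S p.1 0 0; set y := crv S p.1 0 1.
rewrite /speed.
generalize (velocity (crv S) 0 p.1) (velocity (crv S) 1 p.1) => a b.
generalize (ax_A g (vec2 x y)) (ax_B g (vec2 x y)) => A B.
generalize (ax_u g (vec2 x y)) (ax_alpha g (vec2 x y)) => u al.
have -> : expR (al - 2 * u) = Num.sqrt (expR (2 * al - 2 * u) * expR (- (2 * u))).
  rewrite -expRD (_ : 2 * al - 2 * u + - (2 * u) = (al - 2 * u) + (al - 2 * u)); last by ring.
  by rewrite (expRD (al - 2 * u) (al - 2 * u)) -expr2 sqrtr_sqr ger0_norm // expR_ge0.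
rewrite -sqrtr_sqr -!sqrtrM ?sqr_ge0 //; last by rewrite mulr_ge0 ?sqr_ge0 // mulr_ge0 ?expR_ge0.
congr Num.sqrt.
generalize (expR (2 * al - 2 * u)) (expR (- (2 * u))) => k l.
ring.
Qed.

Lemma area_density_euclidean (S : axisym_surface R) (p : R * R) :
  area_density (@euclidean_cyl_metric R) S p = `|crv S p.1 0 0| * speed S p.1.
Proof.
rewrite /area_density surface_gram /euclidean_cyl_metric !mxE /= /speed.
rewrite -sqrtr_sqr -sqrtrM ?sqr_ge0 //; congr Num.sqrt.
generalize (velocity (crv S) 0 p.1) (velocity (crv S) 1 p.1) (crv S p.1 0 0) => a b c.
ring.
Qed.

Notation mu := (@lebesgue_measure R).

Lemma integral_rotation (E : set R) (f : R -> R) : measurable E -> continuous f ->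
  (forall t, 0 <= f t) ->
  (\int[mu \x mu]_(p in E `*` `[0%R, (2 * pi)%R[) (f p.1)%:E
   = (2 * pi)%:E * \int[mu]_(t in E) (f t)%:E)%E.
Proof.
move=> mE cf f0.
have mA : measurable (E `*` `[0%R, (2 * pi)%R[%classic : set (measurableTypeR R * measurableTypeR R)).
  by apply: measurableX => //; exact: measurable_itv.
have mf1 : measurable_fun setT (fun p : measurableTypeR R * measurableTypeR R => (f p.1)%:E).
  apply/measurable_EFinP; apply: (@measurableT_comp _ _ _ _ _ _ f _ fst).
    exact: continuous_measurable_fun.
  exact: measurable_fst.
rewrite integral_mkcond fubini_tonelli1; first last.
- by move=> p; rewrite patchE; case: ifP => _ //; rewrite lee_fin.
- by apply: (iffLR (measurable_restrictT _ mA)); apply: measurable_funTS; exact: mf1.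
rewrite -ge0_integralZl; first last.
- by rewrite lee_fin mulr_ge0 // pi_ge0.
- by move=> t _; rewrite lee_fin.
- exact: measurable_EFin_cont.
- exact: mE.
rewrite [RHS]integral_mkcond; apply: eq_integral => t _.
rewrite /fubini_F /= patchE; case: ifPn => [/set_mem Et|nEt].
  rewrite (_ : (fun _ => _) = (cst (f t)%:E \_ `[0%R, (2 * pi)%R[%classic)); last first.
    by apply/funext => y; rewrite !patchE in_setX mem_set //.
  rewrite -integral_mkcond integral_cst; last exact: measurable_itv.
  rewrite [RHS]muleC; congr (_ * _)%E.
  have h : mu `[0%R, (2 * pi)%R[%classic = (2 * pi)%:E.
    by rewrite lebesgue_measure_itv /= lte_fin mulr_gt0 ?pi_gt0 // oppr0 adde0.
  exact: h.
apply: integral0_eq => y _; rewrite patchE in_setX ifN //= negb_and nEt //.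
Qed.

End area.

(* The library only makes products of subprobabilities canonically sigma-finite. *)
Definition plane_measure {R : realType} : set (measurableTypeR R * measurableTypeR R)%type -> \bar R :=
  (@lebesgue_measure R \x @lebesgue_measure R)%E.

HB.instance Definition _ (R : realType) := Measure.on (@plane_measure R).

Lemma plane_measure_sigma_finite {R : realType} : sigma_finite setT (@plane_measure R).
Proof.
exists (fun n : nat => rect (- n%:R) n%:R (- n%:R) (n%:R : R)).
  apply/esym; rewrite -subTset => -[x y] _.
  pose k := maxn (Num.bound `|x : R|) (Num.bound `|y : R|).
  have h (z : R) : (Num.bound `|z| <= k)%N -> - k%:R <= z <= k%:R.
    move=> zk; rewrite -ler_norml; apply: (le_trans (ltW (archi_boundP (normr_ge0 z)))).
    by rewrite ler_nat.
  by exists k => //; apply/rectE; split; apply: h; rewrite ?leq_maxl ?leq_maxr.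
move=> n; split; [exact: measurable_rect|exact: mu2_rect_lty].
Qed.

HB.instance Definition _ (R : realType) :=
  Measure_isSigmaFinite.Build _ _ _ (@plane_measure R) plane_measure_sigma_finite.

(** * Exchange of the integrals over the curve and over the rectangle *)

Section conclusion.
Context {R : realType}.
Notation mu := (@lebesgue_measure R).
Notation RT := (measurableTypeR R).
Notation R2 := (RT * RT)%type.
Notation R3 := (RT * R2)%type.

Lemma integral_rect (a b c d : R) (f : R * R -> R) : continuous f ->
  (\int[mu \x mu]_(p in rect a b c d) (f p)%:E)%E = (int2 (rect a b c d) f)%:E.
Proof.
by move=> cf; rewrite fineK //; apply: integrable_fin_num; [exact: measurable_rect|exact: integrable_rect].
Qed.

Variables (E : set R) (a b c d : R) (k : R -> R * R -> R) (e : R * R -> R).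
Hypotheses (mE : measurable E) (ce : continuous e).
Hypothesis mk : measurable_fun setT (fun z : R3 => k z.1 z.2).
Hypotheses (ck : forall t, continuous (k t)) (ck' : forall p, continuous (k^~ p)).
Hypothesis k0 : forall t p, 0 <= k t p.
Hypothesis e0 : forall x y, a <= x <= b -> c <= y <= d -> 0 <= e (x, y).

Notation Q := (rect a b c d).
Let mQ : measurable (Q : set R2) := @measurable_rect R a b c d.
Let mEQ : measurable (E `*` Q : set R3). Proof. exact: measurableX. Qed.
Let F : R3 -> \bar R := (fun z : R3 => (k z.1 z.2 * e z.2)%:E) \_ (E `*` Q).

Let F0 z : (0 <= F z)%E.
Proof.
rewrite /F patchE; case: ifPn => // /set_mem [_ /= hz]; rewrite lee_fin mulr_ge0 //.
by case: z hz => t [x y] /= /rectE [hx hy]; exact: e0.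
Qed.

Let mF : measurable_fun (setT : set R3) F.
Proof.
apply: (iffLR (measurable_restrictT _ mEQ)); apply: measurable_funTS.
apply/measurable_EFinP; apply: measurable_funM => //.
apply: (@measurableT_comp _ _ _ _ _ _ e _ snd); last exact: measurable_snd.
exact: continuous_measurable_fun2.
Qed.

Let slice t : (((fun t => (int2 Q (fun p => (k t p * e p)%R))%:E) \_ E) t = \int[mu \x mu]_p F (t, p))%E.
Proof.
rewrite patchE; case: ifPn => [/set_mem Et|nEt].
  rewrite -integral_rect; last exact: cont_mul.
  rewrite [LHS]integral_mkcond; apply: eq_integral => p _; rewrite /F !patchE in_setX /=.
  by rewrite (mem_set Et).
apply/esym; apply: integral0_eq => p _; rewrite /F patchE in_setX ifN //=.
by rewrite negb_and nEt.
Qed.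

Lemma measurable_int2_kernel : measurable_fun E (fun t => int2 Q (fun p => k t p * e p)).
Proof.
apply/measurable_EFinP; apply: (iffRL (measurable_restrictT _ mE)).
rewrite (_ : _ \_ _ = (fun t => \int[plane_measure]_p F (t, p))%E); last exact/funext/slice.
exact: (measurable_fun_fubini_tonelli_F F).
Qed.

(** After the exchange the inner integral runs over the curve with the pole fixed, where the uniform
    bound [K] is available, and the outer one is that of [e]. *)
Lemma tonelli_bound (K : R) : 0 <= K ->
  (forall x y, a <= x <= b -> c <= y <= d -> (\int[mu]_(t in E) (k t (x, y))%:E <= K%:E)%E) ->
  (\int[mu]_(t in E) (int2 Q (fun p => k t p * e p))%:E <= (K * int2 Q e)%:E)%E.
Proof.
move=> K0 hK; rewrite integral_mkcond.
have E1 : (\int[mu]_t ((fun t => (int2 Q (fun p => (k t p * e p)%R))%:E) \_ E) t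
  = \int[mu]_t \int[mu \x mu]_p F (t, p))%E by apply: eq_integral => t _; exact: slice.
have E2 : (\int[mu]_t \int[mu \x mu]_p F (t, p) = \int[mu \x mu]_p \int[mu]_t F (t, p))%E.
  exact: (@fubini_tonelli _ _ _ _ _ mu plane_measure F mF F0).
rewrite E1 E2 -(int2Z _ _ _ _ _ ce) -integral_rect; last by apply: cont_mul => //; exact: cont_cst.
rewrite [X in (_ <= X)%E]integral_mkcond.
apply: ge0_le_integral => //.
- by move=> p _; apply: integral_ge0 => t _; exact: F0.
- exact: measurable_fun_fubini_tonelli_G.
- apply: (iffLR (measurable_restrictT _ mQ)); apply: measurable_funTS.
  apply/measurable_EFinP; apply: measurable_funM => //.
  exact: continuous_measurable_fun2.
move=> [x y] _; rewrite patchE; case: ifPn => [/set_mem Qp|nQp].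
  have [hx hy] := (rectE _ _ _ _ _ _).1 Qp.
  rewrite (_ : (fun t => F (t, (x, y))) = (fun t => (e (x, y))%:E * (k t (x, y))%:E)%E \_ E); last first.
    by apply/funext => t; rewrite /F !patchE in_setX (mem_set Qp) andbT /= -EFinM mulrC.
  rewrite -integral_mkcond ge0_integralZl //.
  - by rewrite mulrC EFinM; apply: lee_wpmul2l; [rewrite lee_fin; exact: e0|exact: hK].
  - have h : continuous (fun t => k t (x, y)) by exact: ck'.
    apply/measurable_EFinP; apply: measurable_funTS; exact: continuous_measurable_fun.
  - by move=> t _; rewrite lee_fin.
  - by rewrite lee_fin; exact: e0.
rewrite integral0_eq // => t _; rewrite /F patchE in_setX ifN //=.
by rewrite negb_and nQp orbT.
Qed.
End conclusion.

(** * The part of the surface inside the box *)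

Section surface.
Context {R : realType}.
Notation mu := (@lebesgue_measure R).
Notation RT := (measurableTypeR R).
Notation R3 := (RT * (RT * RT))%type.

Lemma measurable_curve_kernel (c0 c1 : R -> R) (eps : R) : continuous c0 -> continuous c1 ->
  measurable_fun setT (fun z : R3 => wgt (sq (c0 z.1) (c1 z.1) eps z.2)).
Proof.
move=> cc0 cc1.
have mwgt : measurable_fun setT (@wgt R).
  rewrite /wgt; apply: measurableT_comp => //.
  by apply: measurable_funN; apply: measurable_funM => //; exact: measurable_ln.
apply: (measurableT_comp mwgt); rewrite /sq.
have m1 (c : R -> R) : continuous c -> measurable_fun setT (fun z : R3 => c z.1).
  by move=> cc; apply: (measurableT_comp (continuous_measurable_fun cc)); exact: measurable_fst.
have m2 : measurable_fun setT (fun z : R3 => z.2.1).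
  by apply: (measurableT_comp measurable_fst); exact: measurable_snd.
have m3 : measurable_fun setT (fun z : R3 => z.2.2).
  by apply: (measurableT_comp measurable_snd); exact: measurable_snd.
apply: measurable_funD => //; apply: measurable_funD; apply: measurable_funX;
  by apply: measurable_funB => //; exact: m1.
Qed.

Variables (S : axisym_surface R) (rho0 rho1 sigma : R).

Notation c0 := (fun t => crv S t 0 0).
Notation c1 := (fun t => crv S t 0 1).

Lemma is_derive_crv (k : 'I_2) (t : R) :
  is_derive t (1 : R) (fun s => crv S s 0 k) (velocity (crv S) k t).
Proof. by rewrite /velocity derive1E; apply: derivableP; exact: crv_derivable. Qed.

Lemma cont_crv (k : 'I_2) : continuous (fun s => crv S s 0 k).
Proof. exact: (is_derive_continuous (is_derive_crv k)). Qed.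

Lemma cont_speed : continuous (speed S).
Proof.
have h : continuous (fun t => velocity (crv S) 0 t ^+ 2 + velocity (crv S) 1 t ^+ 2).
  by apply: cont_add; apply: cont_exp; exact: crv_C1.
by move=> t; apply: continuous_comp; [exact: h|exact: sqrt_continuous].
Qed.

Definition box_params : set R :=
  dom S `&` [set t | rho0 + sigma <= c0 t <= rho1 /\ `|c1 t| <= rho1 / 2].

Lemma closed_box_params : closed box_params.
Proof.
apply: closedI; first exact: dom_closed.
have -> : [set t | rho0 + sigma <= c0 t <= rho1 /\ `|c1 t| <= rho1 / 2] =
  (c0 @^-1` [set x | rho0 + sigma <= x]) `&` (c0 @^-1` [set x | x <= rho1])
  `&` ((fun t => `|c1 t|) @^-1` [set x | x <= rho1 / 2]).
  by apply/seteqP; split=> t /= => [[/andP[h1 h2] h3]|[[h1 h2] h3]]; split=> //; apply/andP.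
have cn : continuous (fun t => `|c1 t|) by apply: cont_norm; exact: cont_crv.
apply: closedI; first apply: closedI.
- by apply: closed_comp; [move=> t _; exact: cont_crv|exact: closed_ge].
- by apply: closed_comp; [move=> t _; exact: cont_crv|exact: closed_le].
- by apply: closed_comp; [move=> t _; exact: cn|exact: closed_le].
Qed.

(** The box lies in the disc of radius [sqrt 2 rho1] about the origin of the half-plane, so
    properness of the curve bounds the parameters. *)
Lemma box_params_bounded : 0 <= rho0 + sigma -> exists2 T, 0 <= T & box_params `<=` `[- T, T].
Proof.
move=> r0; pose r := Num.sqrt (rho1 ^+ 2 + rho1 ^+ 2).
have [N [_ hN]] := crv_proper S r.
exists (`|N| + 1); first exact: addr_ge0.
move=> t [dt [/andP[h1 h2] h3]] /=; rewrite in_itv /= -ler_norml.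
apply: (hN (`|N| + 1)); first by rewrite (le_lt_trans (ler_norm N)) // ltrDl.
split=> //=; rewrite /enorm /r; apply: ler_wsqrtr.
rewrite !big_ord_recl big_ord0 addr0.
have -> : lift ord0 ord0 = 1 :> 'I_2 by apply/val_inj.
have r1 : 0 <= rho1 by apply: le_trans h2; exact: le_trans h1.
apply: lerD; first by rewrite ler_pXn2r ?nnegrE // (le_trans r0).
rewrite -(real_normK (num_real (crv S t 0 1))) ler_pXn2r ?nnegrE //.
by apply: (le_trans h3); rewrite ler_pdivrMr // ler_peMr // ler1n.
Qed.

(** The area per unit of parameter and angle: [w = 0] gives the Euclidean one, [w = weight g] the
    one of the metric. *)
Definition weighted_speed (w : R * R -> R) (t : R) : R := `|c0 t| * expR (w (c0 t, c1 t)) * speed S t.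

Lemma weighted_speed_ge0 w t : 0 <= weighted_speed w t.
Proof. by rewrite /weighted_speed mulr_ge0 ?sqrtr_ge0 // mulr_ge0 ?expR_ge0. Qed.

Lemma cont_weighted_speed w : continuous w -> continuous (weighted_speed w).
Proof.
move=> cw; apply: cont_mul; last exact: cont_speed.
apply: cont_mul; first by apply: cont_norm; exact: cont_crv.
apply: cont_expR => t; apply: (@continuous_comp _ _ _ (fun t => (c0 t, c1 t)) w); last exact: cw.
exact: (cvg_pair (@cont_crv 0 t) (@cont_crv 1 t)).
Qed.

Lemma box_paramsE : [set p : R * R | dom S p.1 /\ Omega_tilde rho0 rho1 sigma (surface_point S p)]
  = box_params `*` `[0, 2 * pi[.
Proof.
apply/seteqP; split=> -[t p] /=; rewrite /Omega_tilde /= !vec3E /= in_itv /=.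
  by move=> [dt [h1 [h2 h3]]]; split.
by move=> [[dt [h1 h2]] h3]; split.
Qed.

Lemma area_weighted (G : 'rV[R]_3 -> 'M[R]_3) (w : R * R -> R) : continuous w ->
  (forall p, area_density G S p = weighted_speed w p.1) ->
  (area G S (Omega_tilde rho0 rho1 sigma)
    = (2 * pi)%:E * \int[mu]_(t in box_params) (weighted_speed w t)%:E)%E.
Proof.
move=> cw hG; rewrite /area box_paramsE.
rewrite -integral_rotation; first by apply: eq_integral => p _; rewrite hG.
- by apply: closed_measurable; exact: closed_box_params.
- exact: cont_weighted_speed.
- exact: weighted_speed_ge0.
Qed.

End surface.

(** * Comparison of the two areas *)

Section estimate.
Context {R : realType}.
Notation mu := (@lebesgue_measure R).
Variables (S : axisym_surface R) (rho0 rho1 sigma : R).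
Hypotheses (r0 : 0 < rho0) (r01 : rho0 < rho1) (sg : 0 < sigma).

Notation E := (box_params S rho0 rho1 sigma).
Notation fw := (weighted_speed S).
Notation f0 := (fw (fun _ => 0)).

Let mE : measurable E. Proof. by apply: closed_measurable; exact: closed_box_params. Qed.
Let cf0 : continuous f0. Proof. by apply: cont_weighted_speed; exact: cont_cst. Qed.

Let mcont (f : R -> R) : continuous f -> measurable_fun E f.
Proof. by move=> cf; apply: measurable_funTS; exact: continuous_measurable_fun. Qed.
Let mf0 : measurable_fun E f0 := mcont cf0.

Lemma weighted_speed0 t : f0 t = `|crv S t 0 0| * speed S t.
Proof. by rewrite /weighted_speed expR0 mulr1. Qed.

Lemma box_params_seg : exists2 T, 0 <= T & E = E `&` `[- T, T].
Proof.
have [|T T0 hT] := @box_params_bounded _ S rho0 rho1 sigma; first by rewrite addr_ge0 // ltW.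
by exists T => //; rewrite setIidl.
Qed.

Lemma speed_bound : exists2 V, 0 <= V & forall t, E t -> speed S t <= V.
Proof.
have [|T T0 hT] := @box_params_bounded _ S rho0 rho1 sigma; first by rewrite addr_ge0 // ltW.
have cs : continuous (fun p : R * R => speed S p.1).
  by move=> p; apply: (@continuous_comp _ _ _ fst (speed S)); [exact: cvg_fst|exact: cont_speed].
have [V V0 hV] := rect_bounded (- T) T 0 0 cs; exists V => // t /hT /=.
rewrite in_itv /= => ht; apply: (le_trans (ler_norm _)).
by apply: (hV t 0); rewrite ?lexx.
Qed.

Lemma euclidean_finite : exists2 a, 0 <= a & (\int[mu]_(t in E) (f0 t)%:E = a%:E)%E.
Proof.
have [T T0 hT] := box_params_seg.
have I0 : (0 <= \int[mu]_(t in E) (f0 t)%:E)%E.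
  by apply: integral_ge0 => t _; rewrite lee_fin weighted_speed_ge0.
have fin : (\int[mu]_(t in E) (f0 t)%:E < +oo)%E.
  apply: (@le_lt_trans _ _ (\int[mu]_(t in `[(- T)%R, T]) (f0 t)%:E)%E).
    apply: (ge0_subset_int mE _ cf0 (weighted_speed_ge0 S _)); first exact: measurable_itv.
    by rewrite hT; exact: subIsetr.
  by rewrite integral_seg // ltry.
exists (fine (\int[mu]_(t in E) (f0 t)%:E)%E); first exact: fine_ge0.
by rewrite fineK // ge0_fin_numE.
Qed.

Lemma weighted_lower (w : R * R -> R) (eta : R) : continuous w ->
  (forall t, E t -> - eta <= w (crv S t 0 0, crv S t 0 1)) ->
  ((expR (- eta))%:E * \int[mu]_(t in E) (f0 t)%:E <= \int[mu]_(t in E) (fw w t)%:E)%E.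
Proof.
move=> cw hw; rewrite -(ge0_intZ mE mf0 (weighted_speed_ge0 S _) (expR_ge0 _)).
have mk : measurable_fun E (fun t => expR (- eta) * f0 t).
  by apply: measurable_funM; [exact: measurable_cst|exact: mf0].
apply: (ge0_le_int mE mk (mcont (cont_weighted_speed cw))).
  by move=> t; rewrite mulr_ge0 ?expR_ge0 ?weighted_speed_ge0.
move=> t Et; rewrite weighted_speed0 /weighted_speed.
rewrite mulrA; apply: ler_wpM2r; first exact: sqrtr_ge0.
by rewrite mulrC; apply: ler_wpM2l => //; rewrite ler_expR hw.
Qed.

Lemma curve_kernel_bound (L : R) : exists2 CE, 0 <= CE &
  forall eps y1 y2, 0 < eps <= L -> `|y1| <= L -> `|y2| <= L ->
  (\int[mu]_(t in E) (wgt (sq (crv S t 0 0) (crv S t 0 1) eps (y1, y2)))%:E <= CE%:E)%E.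
Proof.
have [T T0 hT] := box_params_seg.
have reg t : E t -> velocity (crv S) 0 t != 0 \/ velocity (crv S) 1 t != 0.
  move=> [dt _]; have [i hv] := crv_regular dt.
  case: (unliftP 0 i) => [j ij|ij]; last by left; rewrite -ij.
  by right; have <- : i = 1 by rewrite ij (ord1 j); exact/val_inj.
have TT : - T <= T by rewrite (le_trans _ T0) // oppr_le0.
have [CE CE0 h] := curve_wgt_bound L (is_derive_crv S 0) (is_derive_crv S 1)
  (@crv_C1 _ S 0) (@crv_C1 _ S 1) (@closed_box_params _ S rho0 rho1 sigma) reg TT.
exists CE; first exact: CE0.
move=> eps y1 y2 he hy1 hy2; apply: le_trans (h _ _ _ he hy1 hy2).
rewrite -hT le_eqVlt; apply/orP; left; apply/eqP; apply: eq_integral => t _.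
by rewrite /sq /= -(sqrrN (y1 - _)) -(sqrrN (y2 - _)) !opprB.
Qed.

(** The bound on [expR w] is not uniform in the point, but its kernel term is multiplied by at most
    [rho1 V] and integrates over the curve to at most [K CE M] by [tonelli_bound]. *)
Lemma weighted_upper (w e : R * R -> R) (L K B V CE M eps : R) :
  continuous w -> continuous e -> 0 <= K -> 0 <= B -> 0 <= V -> 0 <= CE -> 0 < eps ->
  (forall x y, rho0 <= x <= L -> - L <= y <= L -> 0 <= e (x, y)) ->
  (forall t, E t -> speed S t <= V) ->
  int2 (rect rho0 L (- L) L) e <= M ->
  (forall x1 x2, rho0 + sigma <= x1 <= rho1 -> `|x2| <= rho1 / 2 -> expR (w (x1, x2)) <=
     B * (1 + K * int2 (rect rho0 L (- L) L) (fun p => wgt (sq x1 x2 eps p) * e p))) ->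
  (forall x y, rho0 <= x <= L -> - L <= y <= L ->
    (\int[mu]_(t in E) (wgt (sq (crv S t 0 0) (crv S t 0 1) eps (x, y)))%:E <= CE%:E)%E) ->
  (\int[mu]_(t in E) (fw w t)%:E <=
     B%:E * (\int[mu]_(t in E) (f0 t)%:E + (rho1 * V * K * CE * M)%:E))%E.
Proof.
move=> cw ce K0 B0 V0 CE0 eps0 e0 hV hM hw hCE.
pose k t p := wgt (sq (crv S t 0 0) (crv S t 0 1) eps p).
have sq0 x1 x2 p : 0 < sq x1 x2 eps p by rewrite /sq -addrA ltr_wpDl ?sqr_ge0 ?sqr_eps_gt0.
have ck t : continuous (k t).
  apply: cont_wgt; first by move=> p; exact: sq0.
  apply: cont_add; last exact: cont_cst.
  by apply: cont_add; apply: cont_exp; apply: cont_add; (exact: cont_cst || exact: cont_fst || exact: cont_snd).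
have ck' p : continuous (k^~ p).
  apply: cont_wgt; first by move=> t; exact: sq0.
  apply: cont_add; last exact: cont_cst.
  by apply: cont_add; apply: cont_exp; apply: cont_add; (exact: cont_cst || (apply: cont_opp; exact: cont_crv)).
have k0 t p : 0 <= k t p by exact: expR_ge0.
have mk := measurable_curve_kernel eps (@cont_crv _ S 0) (@cont_crv _ S 1).
pose J t := int2 (rect rho0 L (- L) L) (fun p => k t p * e p).
have mJ : measurable_fun E J by exact: (measurable_int2_kernel mE ce mk ck k0 e0).
have J0 t : 0 <= J t.
  apply: Rintegral_ge0 => -[x y] /rectE [hx hy]; apply: mulr_ge0; first exact: k0.
  exact: e0.
have IJ := tonelli_bound mE ce mk ck ck' k0 e0 CE0 hCE.
have r1 : 0 <= rho1 by apply: ltW; exact: lt_trans r01.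
pose D := rho1 * V * K.
have D0 : 0 <= D by rewrite /D !mulr_ge0.
have mD : measurable_fun E (fun t => D * J t).
  by apply: measurable_funM; [exact: measurable_cst|exact: mJ].
have mB : measurable_fun E (fun t => B * (f0 t + D * J t)).
  by apply: measurable_funM; [exact: measurable_cst|exact: measurable_funD].
apply: (@le_trans _ _ (\int[mu]_(t in E) (B * (f0 t + D * J t))%:E)%E).
  apply: (ge0_le_int mE (mcont (cont_weighted_speed cw)) mB (weighted_speed_ge0 S _)).
  move=> t Et; have [dt [h1 h2]] := Et; rewrite weighted_speed0.
  have s0 : 0 <= speed S t := sqrtr_ge0 _.
  rewrite /weighted_speed; apply: (@le_trans _ _ (`|crv S t 0 0| * (B * (1 + K * J t)) * speed S t)).
    by apply: ler_wpM2r => //; apply: ler_wpM2l => //; exact: hw.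
  have -> : `|crv S t 0 0| * (B * (1 + K * J t)) * speed S t =
    B * (`|crv S t 0 0| * speed S t + `|crv S t 0 0| * speed S t * (K * J t)) by ring.
  apply: ler_wpM2l => //; rewrite lerD2l /D -(mulrA _ K); apply: ler_wpM2r; first exact: mulr_ge0.
  apply: ler_pM => //; last exact: hV.
  have /andP[h3 h4] := h1; rewrite ger0_norm //.
  by apply: (le_trans _ h3); apply: addr_ge0; exact: ltW.
have DJ0 u : 0 <= D * J u := mulr_ge0 D0 (J0 u).
have mF : measurable_fun E (fun u => f0 u + D * J u) by exact: measurable_funD.
have F0 u : 0 <= f0 u + D * J u := addr_ge0 (weighted_speed_ge0 S _ u) (DJ0 u).
have -> : (\int[mu]_(t in E) (B * (f0 t + D * J t))%:E =
    B%:E * \int[mu]_(t in E) (f0 t + D * J t)%:E)%E := ge0_intZ mE mF F0 B0.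
apply: lee_wpmul2l; first by rewrite lee_fin.
have -> : (\int[mu]_(t in E) (f0 t + D * J t)%:E =
    \int[mu]_(t in E) (f0 t)%:E + \int[mu]_(t in E) (D * J t)%:E)%E.
  exact: (ge0_intD mE mf0 mD (weighted_speed_ge0 S _) DJ0).
apply: leeD => //.
rewrite (ge0_intZ mE mJ J0 D0).
apply: (@le_trans _ _ (D%:E * (CE * int2 (rect rho0 L (- L) L) e)%:E)%E).
  by apply: lee_wpmul2l; [rewrite lee_fin|exact: IJ].
by rewrite -EFinM lee_fin -mulrA; apply: ler_wpM2l => //; apply: ler_wpM2l.
Qed.

End estimate.

Theorem theorem1p6 (R : realType) (M : set (axisym_data R)) (R0 rho0 : R)
  (hM : forall g, M g -> axisymmetric_metric g)
  (hscal : forall g, M g -> nonneg_scalar_curvature g)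
  (huaf : uniformly_asymptotically_flat M R0)
  (hrho0 : 0 < rho0)
  (hmono : radially_monotone M rho0)
  (Sigma : axisym_surface R) (eps sigma rho1 : R)
  (heps : 0 < eps) (hsigma : 0 < sigma) (hrho1 : Num.max rho0 R0 < rho1) :
  exists delta : R, 0 < delta /\
    forall (g : axisym_data R) (m : R),
      M g -> is_adm_mass g m -> m < delta ->
      let Omega := Omega_tilde rho0 rho1 sigma in
      (metric_area g Sigma Omega <= euclidean_area Sigma Omega + eps%:E)%E /\
      (euclidean_area Sigma Omega - eps%:E <= metric_area g Sigma Omega)%E.
Proof.
have [r01 R01] : rho0 < rho1 /\ R0 < rho1 by apply/andP; rewrite -gt_max.
have [a a0 Ia] := euclidean_finite Sigma rho1 hrho0 hsigma.
have [V V0 hV] := speed_bound Sigma rho1 hrho0 hsigma.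
have pi0 : 0 < pi :> R := pi_gt0 R.
(* [2 pi a] is the Euclidean area, so a relative error [kappa] costs at most [eps / 2]. Taking
   [eta = ln (1 + kappa)] makes the exponential bounds [(1 + kappa)] and its inverse. *)
pose kappa := Num.min 1 (eps / (4 * pi * a + 1)).
have pa0 : 0 <= 4 * pi * a by rewrite !mulr_ge0 // ltW.
have k0 : 0 < kappa by rewrite lt_min ltr01 divr_gt0 //; lra.
have k1 : kappa <= 1 by rewrite ge_min lexx.
have k2 : 4 * pi * a * kappa <= eps.
  have : kappa * (4 * pi * a + 1) <= eps by rewrite -ler_pdivlMr ?ge_min ?lexx ?orbT //; lra.
  lra.
have ek : expR (ln (1 + kappa)) = 1 + kappa by rewrite lnK // posrE; lra.
have eta0 : 0 < ln (1 + kappa) by rewrite ln_gt0 //; lra.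
have [L [K [delta [L1 K0 d0 hw]]]] := weight_bounds hM hscal huaf hmono hrho0 r01 hsigma eta0.
have [CE CE0 hCE] := curve_kernel_bound Sigma rho1 hrho0 hsigma L.
have rho10 : 0 < rho1 := lt_trans hrho0 r01.
(* The factor 8 is that of [mass_bound]. With [m < q] and [1 + kappa <= 2] the potential term costs
   at most [4 pi Z q <= eps / 2]. *)
pose Z := rho1 * V * K * CE * 8.
have Z0 : 0 <= Z by rewrite /Z !mulr_ge0 // ltW.
have pZ0 : 0 <= 8 * pi * Z by rewrite !mulr_ge0 // ltW.
pose q := eps / (8 * pi * Z + 1).
have q0 : 0 < q by rewrite divr_gt0 //; lra.
exists (Num.min delta q); split; first by rewrite lt_min d0 q0.
move=> g m Mg hm; rewrite lt_min => /andP[md mq] Omega.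
have Hg := hM _ Mg; have Hn := hscal _ Mg.
have [low [e0 /andP[e00 e0L] up]] := hw g m Mg hm md.
have [cw _ _ _ _ _ _ _ _] := weight_C2 Hg.
have ce : continuous (energy g) by exact: cont_energy.
have c0 : continuous (fun _ : R * R => 0 : R) by exact: cont_cst.
pose I := (\int[@lebesgue_measure R]_(t in box_params Sigma rho0 rho1 sigma)
  (weighted_speed Sigma (weight g) t)%:E)%E.
have -> : metric_area g Sigma Omega = ((2 * pi)%:E * I)%E.
  by apply: (area_weighted _ _ _ cw) => p; rewrite area_density_cyl.
have -> : euclidean_area Sigma Omega = (2 * pi * a)%:E.
  rewrite EFinM -Ia; apply: (area_weighted _ _ _ c0) => p.
  by rewrite area_density_euclidean /weighted_speed expR0 mulr1.
have p2 : 0 <= 2 * pi :> R by rewrite mulr_ge0 // ltW.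
have IB : (I <= ((1 + kappa) * (a + Z * m))%:E)%E.
  have e_ge0 x y : rho0 <= x <= L -> - L <= y <= L -> 0 <= energy g (x, y).
    by move=> /andP[hx _] _; apply: (energy_ge0 Hg Hn); exact: le_trans (ltW hrho0) hx.
  have hmass := mass_bound Hg Hn L (- L) L huaf Mg hm (ltW hrho0).
  have B0 : 0 <= 1 + kappa by rewrite addr_ge0 // ltW.
  have hk x y : rho0 <= x <= L -> - L <= y <= L ->
      (\int[@lebesgue_measure R]_(t in box_params Sigma rho0 rho1 sigma)
        (wgt (sq (crv Sigma t 0 0) (crv Sigma t 0 1) e0 (x, y)))%:E <= CE%:E)%E.
    move=> /andP[hx xL] hy; apply: hCE; first by rewrite e00.
      by rewrite ger0_norm // (le_trans (ltW hrho0)).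
    by rewrite ler_norml.
  rewrite ek in up.
  have := weighted_upper hrho0 r01 hsigma cw ce K0 B0 V0 CE0 e00 e_ge0 hV hmass up hk.
  rewrite Ia -EFinD -EFinM -/I => h; apply: (le_trans h); rewrite lee_fin.
  by rewrite /Z -!mulrA.
have IA : (((1 + kappa)^-1 * a)%:E <= I)%E.
  have h t : box_params Sigma rho0 rho1 sigma t ->
      - ln (1 + kappa) <= weight g (crv Sigma t 0 0, crv Sigma t 0 1).
    by move=> [_ [h1 h2]]; exact: low.
  by have := weighted_lower cw h; rewrite Ia -EFinM expRN ek.
split.
  apply: (@le_trans _ _ ((2 * pi)%:E * ((1 + kappa) * (a + Z * m))%:E)%E).
    by apply: lee_wpmul2l; rewrite ?lee_fin.
  rewrite -EFinM -EFinD lee_fin.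
  have Zm : Z * m <= Z * q by apply: ler_wpM2l => //; exact: ltW.
  have hq : q * (8 * pi * Z + 1) = eps by rewrite /q divfK // gt_eqF //; lra.
  have h1 : 2 * pi * ((1 + kappa) * (a + Z * m)) <= 2 * pi * ((1 + kappa) * (a + Z * q)).
    by do 2 apply: ler_wpM2l => //; [lra|rewrite lerD2l].
  have h2 : 2 * pi * ((1 + kappa) * (Z * q)) <= 2 * pi * (2 * (Z * q)).
    apply: ler_wpM2l => //; apply: ler_wpM2r; last by lra.
    by rewrite mulr_ge0 // ltW.
  have -> : 2 * pi * a + eps = 2 * pi * a + 2^-1 * eps + 2^-1 * eps by field.
  apply: (le_trans h1); clear - k2 hq h2 q0; nra.
apply: (@le_trans _ _ ((2 * pi)%:E * ((1 + kappa)^-1 * a)%:E)%E); last first.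
  by apply: lee_wpmul2l; rewrite ?lee_fin.
rewrite -EFinM -EFinB lee_fin.
have hk : 1 - kappa <= (1 + kappa)^-1.
  rewrite -[leRHS]mul1r ler_pdivlMr; last by lra.
  have : 0 <= kappa ^+ 2 := sqr_ge0 kappa.
  lra.
have : 2 * pi * ((1 - kappa) * a) <= 2 * pi * ((1 + kappa)^-1 * a).
  by apply: ler_wpM2l => //; apply: ler_wpM2r.
lra.
Qed.
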